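(* Let $f:\widetilde C\to C$ be a connected étale cyclic cover of degree $d=3$ of a hyperelliptic curve of genus $g$, let $C_0$ and $n=g(C_0)=g-1$ be as in the context, and assume $n\ge4$. Fix $x\in C_0$ and let $T_1'\subset\mathrm{Pic}^{n-1}(C_0)$ be the theta-dual defined in the context. Then, set-theoretically, $$T_1'=K_{C_0}-x-W_{n-2}(C_0).$$
   Context: All varieties are over $\mathbb C$; curves are smooth, projective and connected. Let $\sigma$ be a generator of the deck group of $f$. The hyperelliptic involution of $C$ lifts to an involution $j\in\mathrm{Aut}(\widetilde C)$ with $j\sigma j=\sigma^{-1}$. Put $C_0:=\widetilde C/\langle j\rangle$, a curve of genus $n=g-1$; the quotient $\widetilde C\to\widetilde C/\langle\sigma,j\rangle\cong\mathbb P^1$ induces a degree-three map $h:C_0\to\mathbb P^1$. Divisor classes and line bundles are written additively, and $K_{C_0}$ is the canonical class. For $p\in C_0$ choose a lift $p'\in\widetilde C$ and let $p_a\in C_0$ be the image of $\sigma^a(p')$; the divisor $p_1+p_2$ does not depend on the choice of lift. Put $D_1:=x_1+x_2$. The endomorphism $\sigma+\sigma^{-1}$ of $J\widetilde C$ induces an endomorphism $\beta_1$ of $JC_0$ (embedded in $J\widetilde C$ by pullback), given on the Abel–Jacobi curve by $\beta_1([p-x])=[p_1+p_2-D_1]$. Write $\beta_1(C_0):=\{\beta_1([p-x]):p\in C_0\}\subset JC_0$. For $r\ge0$, $W_r(C_0):=\{L\in\mathrm{Pic}^r(C_0):h^0(C_0,L)>0\}$. The theta-dual is $T_1':=\{\xi\in\mathrm{Pic}^{n-1}(C_0):\beta_1(C_0)+\xi\subset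 W_{n-1}(C_0)\}$, and $K_{C_0}-x-W_{n-2}(C_0)$ denotes $\{K_{C_0}-x-B:B\in W_{n-2}(C_0)\}$. *)

(* Defs.v *)
(* A smooth projective connected curve over k (k algebraically closed of
   characteristic 0; below k is the field of complex numbers) is given by its
   field of rational functions, and its points are the normalized discrete
   valuations of that field that are trivial on k, i.e., the discrete
   valuation rings of k(X)/k (the "abstract nonsingular curve" of Hartshorne,
   I.6).  A finite (= nonconstant) morphism X -> Y is given by the pullback
   k(Y) -> k(X) of rational functions. *)
From HB Require Import structures.
From mathcomp Require Import all_boot all_order all_algebra.
From mathcomp Require Import generic_quotient ring_quotient.
From mathcomp.classical Require Import boolp classical_sets.
From mathcomp Require Import reals.
From mathcomp Require Import complex.
From mathcomp Require Import freeg.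

Set Implicit Arguments.
Unset Strict Implicit.
Unset Printing Implicit Defensive.

Import Order.TTheory GRing.Theory Num.Theory.

Local Open Scope classical_set_scope.
Local Open Scope ring_scope.

(* V is free of rank m over S, where S is a subfield of F. *)
Definition dim_over (F : fieldType) (S V : set F) (m : nat) : Prop :=
  exists b : 'I_m -> F,
    (forall c : 'I_m -> F, (forall i, S (c i)) -> V (\sum_i c i * b i)) /\
    (forall u, V u -> exists! c : {ffun 'I_m -> F},
       (forall i, S (c i)) /\ u = \sum_i c i * b i).

Section RationalFunctions.
Variables (k F : fieldType) (emb : {rmorphism k -> F}).

Definition evalp (p : {poly k}) (t : F) : F := (map_poly emb p).[t].

Definition transcendental (t : F) : Prop :=
  forall p : {poly k}, p != 0 -> evalp p t != 0.

(* The subfield k(t) of F. *)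
Definition adjoin (t : F) : set F :=
  [set u | exists p q : {poly k}, evalp q t != 0 /\ u = evalp p t / evalp q t].

End RationalFunctions.

Record curve (k : fieldType) := Curve {
  ratfun :> fieldType;
  const : {rmorphism k -> ratfun};
  function_fieldP : exists2 t : ratfun, transcendental const t &
    exists m : nat, dim_over (adjoin const t) setT m }.

Arguments const {k} X : rename.

Section Curves.
Variable k : fieldType.
Implicit Types X Y Z : curve k.

(* ord P 0 is not meaningful; it is set to 0 so that a point is determined by
   its order function. *)
Record closed_point X := ClosedPoint {
  ord :> X -> int;
  _ : ord 0 = 0;
  _ : forall u v, u != 0 -> v != 0 -> ord (u * v) = ord u + ord v;
  _ : forall u v, u != 0 -> v != 0 -> u + v != 0 ->
        Num.min (ord u) (ord v) <= ord (u + v);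
  _ : forall c, ord (const X c) = 0;
  _ : exists u, ord u = 1 }.

HB.instance Definition _ X := gen_eqMixin (closed_point X).
HB.instance Definition _ X := gen_choiceMixin (closed_point X).

Definition divisor X := {freeg (closed_point X) / int}.

Definition is_div X (u : X) (D : divisor X) : Prop :=
  forall P : closed_point X, coeff P D = ord P u.

Definition principal X : {pred divisor X} :=
  fun D => `[< exists u : X, u != 0 /\ is_div u D >].
Arguments principal : clear implicits.

Lemma principal_zmod_closed X : zmod_closed (principal X).
Proof.
have ord1 (P : closed_point X) : ord P 1 = 0.
  by case: P => o /= _ _ _ oc _; rewrite -(oc 1) rmorph1.
have ordM (P : closed_point X) u v : u != 0 -> v != 0 ->
    ord P (u * v) = ord P u + ord P v by case: P => o /= _ oM _ _ _; exact: oM.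
split.
  apply/asboolP; exists 1; split; first exact: oner_neq0.
  by move=> P; rewrite coeff0 ord1.
move=> D E /asboolP[u [u0 uD]] /asboolP[v [v0 vE]].
apply/asboolP; exists (u / v); split; first by rewrite mulf_neq0 // invr_eq0.
move=> P; rewrite coeffB uD vE; apply/eqP; rewrite subr_eq.
by rewrite -ordM ?mulf_neq0 ?invr_eq0 // divfK.
Qed.

HB.instance Definition _ X :=
  GRing.isZmodClosed.Build (divisor X) (principal X) (principal_zmod_closed X).

Definition Pic X : zmodType := Quotient.quot (principal X).

Definition divclass X (D : divisor X) : Pic X :=
  (\pi_(Quotient.quot (principal X)) D)%qT.

Definition Pic_deg X (r : nat) : set (Pic X) :=
  [set L | exists D : divisor X, divclass D = L /\ deg D = r%:Z].
Arguments Pic_deg : clear implicits.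

(* H^0(X, O(D)) *)
Definition sections X (D : divisor X) : set X :=
  [set u | u = 0 \/ forall P : closed_point X, 0 <= ord P u + coeff P D].

(* h^0(X, L) = m *)
Definition h0 X (L : Pic X) (m : nat) : Prop :=
  exists D : divisor X, divclass D = L /\
    dim_over (range (const X)) (sections D) m.

Definition W X (r : nat) : set (Pic X) :=
  [set L | Pic_deg X r L /\ exists m : nat, h0 L m /\ (0 < m)%N].
Arguments W : clear implicits.

Definition derivation X (d : X -> X) : Prop :=
  [/\ forall u v, d (u + v) = d u + d v,
      forall u v, d (u * v) = u * d v + v * d u
    & forall c, d (const X c) = 0].

(* D is the divisor of the rational differential form f dt <> 0.  If u is a
   uniformizer at P, then f dt = (f * d t) du, where d = d/du is the
   k-derivation of k(X) with d u = 1, and the order of f dt at P is that of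
   f * d t.  As k has characteristic 0 and is algebraically closed, dt <> 0
   means that t is not constant. *)
Definition canonical_divisor X (D : divisor X) : Prop :=
  exists f t : X, [/\ f != 0, ~ range (const X) t &
    forall P : closed_point X, exists u : X, exists d : X -> X,
      [/\ ord P u = 1, derivation d, d u = 1 & coeff P D = ord P (f * d t)]].

Definition canonical_class X (K : Pic X) : Prop :=
  exists D : divisor X, canonical_divisor D /\ divclass D = K.

Definition genus X (g : nat) : Prop :=
  exists K : Pic X, canonical_class K /\ h0 K g.

Record morphism X Y := Morphism {
  pull : {rmorphism Y -> X};
  pull_const : forall c, pull (const Y c) = const X c }.

Definition eqm X Y (phi psi : morphism X Y) : Prop := pull phi =1 pull psi.

Definition idm X : morphism X X.
Proof. by exists idfun. Defined.

Definition compm X Y Z (phi : morphism Y Z) (psi : morphism X Y) :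
  morphism X Z.
Proof.
by exists (pull psi \o pull phi) => c; rewrite /= !pull_const.
Defined.

Definition iterm X (a : nat) (phi : morphism X X) : morphism X X :=
  iter a (compm phi) (idm X).

Definition degree X Y (phi : morphism X Y) (m : nat) : Prop :=
  dim_over (range (pull phi)) setT m.

(* phi maps P to Q, with ramification index e. *)
Definition ramification X Y (phi : morphism X Y) (P : closed_point X)
    (Q : closed_point Y) (e : nat) : Prop :=
  (0 < e)%N /\ forall v : Y, ord P (pull phi v) = ord Q v *+ e.

Definition maps X Y (phi : morphism X Y) (P : closed_point X)
    (Q : closed_point Y) : Prop :=
  exists e : nat, ramification phi P Q e.

(* Finite morphisms of smooth curves are flat, and over an algebraically
   closed field of characteristic 0 unramified means that all the ramification
   indices are 1. *)
Definition etale X Y (phi : morphism X Y) : Prop :=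
  forall P Q e, ramification phi P Q e -> e = 1%N.

Definition deck X Y (phi : morphism X Y) (tau : morphism X X) : Prop :=
  eqm (compm phi tau) phi.

(* phi is a Galois cover of degree d whose deck group is cyclic of order d,
   generated by sigma. *)
Definition cyclic_cover X Y (phi : morphism X Y) (d : nat)
    (sigma : morphism X X) : Prop :=
  [/\ degree phi d, deck phi sigma,
      forall a : nat, eqm (iterm a sigma) (idm X) <-> (d %| a)%N
    & forall tau, deck phi tau -> exists a : nat, eqm tau (iterm a sigma)].

(* Y = X/<j>: the function field of the quotient is the fixed field of j. *)
Definition quotient_by X Y (phi : morphism X Y) (j : morphism X X) : Prop :=
  forall u : X, pull j u = u <-> range (pull phi) u.

(* A degree 2 morphism X -> P^1 is a rational function t with
   [k(X) : k(t)] = 2. *)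
Definition double_cover_P1 X (t : X) : Prop :=
  dim_over (adjoin (const X) t) setT 2.

Definition hyperelliptic X (g : nat) : Prop :=
  [/\ genus X g, (2 <= g)%N & exists t : X, double_cover_P1 t].

(* The nontrivial deck transformation of the double cover X -> P^1. *)
Definition hyperelliptic_involution X (iota : morphism X X) : Prop :=
  ~ eqm iota (idm X) /\ exists t : X, double_cover_P1 t /\ pull iota t = t.

Section ThetaDual.
Variables (Ct C0 : curve k) (sigma : morphism Ct Ct) (pi : morphism Ct C0).

(* E = p_1 + p_2, where p_a = pi (sigma^a p') for some lift p' of p. *)
Definition conjugates (p : closed_point C0) (E : divisor C0) : Prop :=
  exists (p' : closed_point Ct) (p1 p2 : closed_point C0),
    [/\ maps pi p' p,
        maps (compm pi (iterm 1 sigma)) p' p1,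
        maps (compm pi (iterm 2 sigma)) p' p2
      & E = << p1 >> + << p2 >>].

(* b = beta_1([p - x]), where beta_1 is the endomorphism of JC_0 induced by
   sigma + sigma^-1: with D_1 = x_1 + x_2, it is [p_1 + p_2 - D_1], since
   sigma + sigma^-1 sends pi^* p to pi^* (p_1 + p_2). *)
Definition beta1 (x p : closed_point C0) (b : Pic C0) : Prop :=
  exists E D1 : divisor C0,
    [/\ conjugates p E, conjugates x D1 & b = divclass (E - D1)].

Definition beta1_curve (x : closed_point C0) : set (Pic C0) :=
  [set b | exists p : closed_point C0, beta1 x p b].

Definition theta_dual (x : closed_point C0) (n : nat) : set (Pic C0) :=
  [set xi | Pic_deg C0 (n - 1) xi /\
    [set b + xi | b in beta1_curve x] `<=` W C0 (n - 1)].

End ThetaDual.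

End Curves.

Arguments idm {k} X.
Arguments principal {k} X.
Arguments Pic_deg {k} X r _.
Arguments W {k} X r _.
Arguments genus {k} X g.
Arguments hyperelliptic {k} X g.

(* Main.v *)
From HB Require Import structures.
Require Import Defs.
From mathcomp Require Import all_boot all_order all_algebra.
From mathcomp.classical Require Import boolp classical_sets.
From mathcomp Require Import reals complex freeg.
From mathcomp Require Import zify ring.

(* Since p + p_1 + p_2 is a fibre of h, it lies in a fixed class, so that
   beta_1([p - x]) = [x - p]. Hence xi belongs to T_1' iff xi + x - p is
   effective for every p, i.e., iff h^0(xi + x) >= 2; as deg (xi + x) = n, by
   Riemann-Roch this says that K - x - xi is effective.
   Riemann-Roch is obtained from a nonconstant t : X -> P^1. Choosing
   successive minima for the pole order along t = oo splits the direct image of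
   O(D) into a sum of m line bundles O(-delta_i) on P^1. The dual basis for the
   trace form of k(X)/k(t) splits in the same way the direct image of O(K - D),
   where K = div(dt): in characteristic 0 every ramification is tame, and the
   inverse different is O(R) with R the ramification divisor. This computes
   h^0(D) - h^0(K - D) as the sum of the 1 - delta_i, which grows by at most 1
   when a point is added to D and by exactly m when a fibre of t is. *)

Set Implicit Arguments.
Unset Strict Implicit.
Unset Printing Implicit Defensive.

Import Order.TTheory GRing.Theory Num.Theory.

Local Open Scope classical_set_scope.
Local Open Scope ring_scope.

(** * Linear independence over a subfield *)

(** Points are valuations, so even a zero of a nonconstant function has to be constructed, by
    Chevalley's extension argument. That principal divisors have degree 0 is obtained along with
    Riemann-Roch, from the invariance of chi under linear equivalence. [canonical_divisor] admits at
    each point any derivation [d] with [d u = 1], whose effect on orders is under control only once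
    [d] is known to preserve the local ring. In the geometric part, the delicate point is that p +
    p_1 + p_2 is a fibre with the right multiplicities. Etaleness excludes fixed points of [sigma]:
    at such a point a uniformizer pulled back from C would be fixed by [sigma], forcing [sigma] to
    be trivial. If two of the three points coincide, [j] fixes the remaining point of the orbit
    upstairs, so [pi] ramifies there, and the [sigma]-invariance of s produces a multiple zero at
    the coincident image. Hence p + p_1 + p_2 is at most the fibre, and degrees conclude; an upper
    bound 3 for the degree of h is enough, and it follows from 2 [k(C_0) : k(s)] <= [k(Ct) : k(t)]
    <= 2 * 3. *)

Section LinearAlgebra.
Variables (K F : fieldType) (e : {rmorphism K -> F}).

Definition lfree (I : finType) (b : I -> F) : Prop :=
  forall c : I -> K, \sum_i e (c i) * b i = 0 -> forall i, c i = 0.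

Definition lspan (I : finType) (b : I -> F) : set F :=
  [set u | exists c : I -> K, u = \sum_i e (c i) * b i].

(** Equivalent to [dim_over] for subspaces, but with scalars in a field type [K] embedded by [e], so
    that matrices and polynomials over the subfield are available. *)
Definition has_dim (V : set F) (m : nat) : Prop :=
  exists b : 'I_m -> F,
    [/\ forall i, V (b i), lfree b & forall u, V u -> lspan b u].

Definition lsub (V : set F) : Prop :=
  [/\ V 0, forall u v, V u -> V v -> V (u + v) & forall a u, V u -> V (e a * u)].

Lemma lsub_sum (V : set F) (I : finType) (c : I -> K) (b : I -> F) :
  lsub V -> (forall i, V (b i)) -> V (\sum_i e (c i) * b i).
Proof.
by move=> [V0 VD VZ] Vb; apply: (big_ind V) => // i _; exact: VZ.
Qed.

Lemma lsub_opp (V : set F) u : lsub V -> V u -> V (- u).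
Proof. by case=> _ _ VZ Vu; rewrite -mulN1r -(rmorph1 e) -rmorphN; exact: VZ. Qed.

Lemma lsub_sub (V : set F) u v : lsub V -> V u -> V v -> V (u - v).
Proof. by move=> sV Vu Vv; case: (sV) => _ VD _; apply: VD => //; exact: lsub_opp. Qed.

Lemma lsub_span (I : finType) (b : I -> F) : lsub (lspan b).
Proof.
split.
- by exists (fun=> 0); rewrite big1 // => i _; rewrite rmorph0 mul0r.
- move=> _ _ [c ->] [d ->]; exists (fun i => c i + d i).
  by rewrite -big_split; apply: eq_bigr => i _; rewrite rmorphD mulrDl.
- move=> a _ [c ->]; exists (fun i => a * c i).
  by rewrite mulr_sumr; apply: eq_bigr => i _; rewrite rmorphM mulrA.
Qed.

Lemma mem_lspan (I : finType) (b : I -> F) i : lspan b (b i).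
Proof.
exists (fun j => (j == i)%:R); rewrite (bigD1 i) //= eqxx rmorph1 mul1r.
by rewrite big1 ?addr0 // => j /negPf ->; rewrite rmorph0 mul0r.
Qed.

(** With more rows than columns, the matrix of coordinates has a nonzero vector in its left kernel,
    which is a relation among the [b i]. *)
Lemma steinitz (I J : finType) (b : I -> F) (c : J -> F) :
  lfree b -> (forall i, lspan c (b i)) -> (#|I| <= #|J|)%N.
Proof.
move=> fb /choice[A bA]; rewrite leqNgt; apply/negP => ltJI.
pose M : 'M[K]_(#|I|, #|J|) := \matrix_(i, j) A (enum_val i) (enum_val j).
have /rowV0Pn[v /sub_kermxP vM v0] : kermx M != 0.
  rewrite -mxrank_eq0 mxrank_ker -lt0n subn_gt0.
  exact: leq_ltn_trans (rank_leq_col M) ltJI.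
case/negP: v0; apply/eqP/rowP => i; rewrite mxE.
have <- : v 0 (enum_rank (enum_val i)) = v 0 i by rewrite enum_valK.
apply: (fb (fun j => v 0 (enum_rank j))).
under eq_bigr => j _ do rewrite bA mulr_sumr.
rewrite exchange_big big1 //= => l _.
under eq_bigr => j _ do rewrite mulrA -rmorphM.
rewrite -mulr_suml -rmorph_sum (_ : \sum_(_ | _) _ = 0) ?rmorph0 ?mul0r //.
transitivity ((v *m M) 0 (enum_rank l)); last by rewrite vM mxE.
rewrite mxE (reindex (@enum_rank I)) /=; last first.
  by exists enum_val => j _; rewrite ?enum_rankK ?enum_valK.
by apply: eq_bigr => j _; rewrite mxE !enum_rankK.
Qed.

Lemma lfree_extend (I : finType) (b : I -> F) u :
  lfree b -> ~ lspan b u -> lfree (oapp b u).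
Proof.
move=> fb bu c; rewrite (bigD1 None) //=.
rewrite (reindex_omap (@Some I) id) => [/=|[i|]//].
under eq_bigl => i do rewrite eqxx.
have [c0|c0 cE] := eqVneq (c None) 0.
  by rewrite c0 rmorph0 mul0r add0r => /(fb (c \o Some)) cS [i|]; [exact: cS|].
case: bu; exists (fun i => - (c (Some i) / c None)).
have ec0 : e (c None) != 0 by rewrite fmorph_eq0.
apply: (mulfI ec0); rewrite mulr_sumr; move/eqP: cE; rewrite addr_eq0 => /eqP ->.
rewrite -sumrN; apply: eq_bigr => i _; rewrite rmorphN rmorphM fmorphV.
by rewrite mulNr mulrN; congr (- _); rewrite mulrA mulrCA divff ?mulr1.
Qed.

Lemma lfree_comp (I J : finType) (b : I -> F) (h : J -> I) :
  injective h -> lfree b -> lfree (b \o h).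
Proof.
move=> hI fb c cE j.
have := fb (fun i => if [pick l | h l == i] is Some l then c l else 0).
have pickh l : [pick l' | h l' == h l] = Some l.
  by case: pickP => [l' /eqP/hI ->//|/(_ l)/[!eqxx]].
suff -> : \sum_i e (if [pick l | h l == i] is Some l then c l else 0) * b i = 0.
  by move/(_ erefl (h j)); rewrite pickh.
rewrite (bigID (fun i => i \in codom h)) /= addrC big1 => [|i hi]; last first.
  case: pickP => [l /eqP hl|_]; last by rewrite rmorph0 mul0r.
  by rewrite -hl codom_f in hi.
rewrite add0r -big_uniq /=; last first.
  by rewrite map_inj_uniq ?enum_uniq.
rewrite big_map big_enum /= -[RHS]cE; apply: eq_bigr => l _.
by rewrite pickh.
Qed.

Lemma has_dim_basis (I : finType) (b : I -> F) (V : set F) :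
  (forall i, V (b i)) -> lfree b -> (forall u, V u -> lspan b u) ->
  has_dim V #|I|.
Proof.
move=> Vb fb gb; exists (b \o enum_val); split=> [i|| u /gb[c ->]].
- exact: Vb.
- exact: lfree_comp enum_val_inj fb.
- exists (c \o enum_val); rewrite (reindex (@enum_val I predT)) //=.
  by exists enum_rank => i _; rewrite ?enum_rankK ?enum_valK.
Qed.

Lemma has_dim_free (V : set F) m (I : finType) (b : I -> F) :
  has_dim V m -> (forall i, V (b i)) -> lfree b -> (#|I| <= m)%N.
Proof.
move=> [c [Vc fc gc]] Vb fb; rewrite -(card_ord m).
by apply: (steinitz fb) => i; apply/gc/Vb.
Qed.

Lemma has_dim_leq (V V' : set F) m m' :
  has_dim V m -> has_dim V' m' -> V `<=` V' -> (m <= m')%N.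
Proof.
move=> [b [Vb fb _]] hV' sub; rewrite -(card_ord m).
by apply: has_dim_free hV' _ fb => i; apply/sub/Vb.
Qed.

Lemma has_dim_uniq (V : set F) m m' : has_dim V m -> has_dim V m' -> m = m'.
Proof. by move=> h h'; apply/eqP; rewrite eqn_leq !(has_dim_leq h h', has_dim_leq h' h). Qed.

(** A free family of maximal size generates [V]: otherwise [lfree_extend] would enlarge it. *)
Lemma has_dim_bounded (V : set F) N :
  (forall n (b : 'I_n -> F), (forall i, V (b i)) -> lfree b -> (n <= N)%N) ->
  exists2 m, (m <= N)%N & has_dim V m.
Proof.
move=> bN; pose P n := `[< exists b : 'I_n -> F, (forall i, V (b i)) /\ lfree b >].
have P0 : exists n, P n.
  exists 0%N; apply/asboolP; exists (fun=> 0); split=> [[]//|c _ []//].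
have PN n : P n -> (n <= N)%N by case/asboolP => b [Vb fb]; exact: bN fb.
case: (ex_maxnP P0 PN) => m /[dup]/PN mN /asboolP[b [Vb fb]] max.
exists m => //; exists b; split=> // u Vu; apply: contrapT => nu.
have fb' := lfree_extend fb nu.
have Vb' i : V (oapp b u i) by case: i.
suff /max : P #|{: option 'I_m}| by rewrite card_option card_ord ltnn.
apply/asboolP; exists (oapp b u \o enum_val); split=> [i|]; first exact: Vb'.
exact: lfree_comp enum_val_inj fb'.
Qed.

Lemma has_dim_sub (V V' : set F) m' : V `<=` V' -> has_dim V' m' ->
  exists2 m, (m <= m')%N & has_dim V m.
Proof.
move=> sub hV'; apply: has_dim_bounded => n b Vb fb; rewrite -(card_ord n).
by apply: has_dim_free hV' _ fb => i; apply/sub/Vb.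
Qed.

Lemma has_dim_codim1 (V V' : set F) m : lsub V -> lsub V' -> V `<=` V' ->
  has_dim V m ->
  (forall w w', V' w -> V' w' -> ~ V w' -> exists c, V (w - e c * w')) ->
  exists2 m', has_dim V' m' & (m <= m' <= m.+1)%N.
Proof.
move=> sV sV' sub hV codim.
have [sub'|] := pselect (V' `<=` V).
  have VE : V = V' by apply/seteqP; split.
  by exists m; rewrite -?VE ?leqnn ?leqnSn.
move=> /existsNP[w0 /not_implyP[V'w0 nVw0]].
case: (hV) => b [Vb fb gb].
exists #|{: option 'I_m}|; last by rewrite card_option card_ord leqnSn leqnn.
apply: (@has_dim_basis _ (oapp b w0)) => [[i|]//=||w V'w].
- exact/sub/Vb.
- by apply: lfree_extend => // -[c w0E]; apply: nVw0; rewrite w0E; exact: lsub_sum.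
- have [c /gb[d dE]] := codim _ _ V'w V'w0 nVw0.
  exists (oapp d c); rewrite (bigD1 None) //=.
  rewrite (reindex_omap (@Some 'I_m) id) => [/=|[i|]//].
  under eq_bigl => i do rewrite eqxx.
  by rewrite -dE addrC subrK.
Qed.

Lemma range_choice (I : Type) (c : I -> F) :
  (forall i, range e (c i)) -> exists d, forall i, c i = e (d i).
Proof.
move=> cR; have /choice[d dE] : forall i, exists d, c i = e d.
  by move=> i; case: (cR i) => d _ <-; exists d.
by exists d.
Qed.

Lemma dim_over_has_dim (V : set F) m : dim_over (range e) V m -> has_dim V m.
Proof.
case=> b [Vb Ub]; exists b; split.
- move=> i; have := Vb (fun j => e (j == i)%:R).
  rewrite (bigD1 i) //= eqxx rmorph1 mul1r big1 ?addr0.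
    by apply=> j; exists (j == i)%:R.
  by move=> j /negPf ->; rewrite rmorph0 mul0r.
- move=> c cE i.
  have V0 : V 0 by rewrite -cE; apply: Vb => l; exists (c l).
  have [d [_ dU]] := Ub _ V0.
  have d1 : d = [ffun i => e (c i)].
    apply: dU; split=> [l|]; first by rewrite ffunE; exists (c l).
    by rewrite -[LHS]cE; apply: eq_bigr => l _; rewrite ffunE.
  have d2 : d = [ffun i => 0].
    apply: dU; split=> [l|]; first by rewrite ffunE; exists 0; rewrite ?rmorph0.
    by rewrite big1 // => l _; rewrite ffunE mul0r.
  move/ffunP/(_ i): d2; rewrite d1 !ffunE => /eqP; rewrite fmorph_eq0 => /eqP.
  exact.
- move=> u /Ub[c [[cR uE] _]]; have [d dE] := range_choice cR.
  by exists d; rewrite uE; apply: eq_bigr => i _; rewrite dE.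
Qed.

Lemma has_dim_dim_over (V : set F) m :
  lsub V -> has_dim V m -> dim_over (range e) V m.
Proof.
move=> sV [b [Vb fb gb]]; exists b; split.
  move=> c cR; have [d dE] := range_choice cR.
  under eq_bigr => i _ do rewrite dE.
  exact: lsub_sum.
move=> u /gb[c uE]; exists [ffun i => e (c i)]; split.
  split=> [i|]; first by rewrite ffunE; exists (c i).
  by rewrite uE; apply: eq_bigr => i _; rewrite ffunE.
move=> d [dR]; have [d' dE] := range_choice dR; rewrite uE => /eqP.
rewrite -subr_eq0 -sumrB => /eqP cd; apply/ffunP => i; rewrite ffunE.
rewrite dE; congr (e _); apply/eqP; rewrite -subr_eq0; apply/eqP.
apply: (fb (fun i => c i - d' i)); rewrite -[RHS]cd; apply: eq_bigr => l _.
by rewrite rmorphB mulrBl dE.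
Qed.

End LinearAlgebra.

(** * Function fields are finite over k(u) *)

Section Evaluation.
Variables (k F : fieldType) (emb : {rmorphism k -> F}) (t : F).

Lemma evalpD p q : evalp emb (p + q) t = evalp emb p t + evalp emb q t.
Proof. by rewrite /evalp rmorphD hornerD. Qed.

Lemma evalpN p : evalp emb (- p) t = - evalp emb p t.
Proof. by rewrite /evalp rmorphN hornerN. Qed.

Lemma evalpB p q : evalp emb (p - q) t = evalp emb p t - evalp emb q t.
Proof. by rewrite evalpD evalpN. Qed.

Lemma evalpM p q : evalp emb (p * q) t = evalp emb p t * evalp emb q t.
Proof. by rewrite /evalp rmorphM hornerM. Qed.

Lemma evalpC c : evalp emb c%:P t = emb c.
Proof. by rewrite /evalp map_polyC hornerC. Qed.

Lemma evalp0 : evalp emb 0 t = 0.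
Proof. by rewrite evalpC rmorph0. Qed.

Lemma evalp1 : evalp emb 1 t = 1.
Proof. by rewrite evalpC rmorph1. Qed.

Lemma evalpX : evalp emb 'X t = t.
Proof. by rewrite /evalp map_polyX hornerX. Qed.

Lemma evalpXn n : evalp emb 'X^n t = t ^+ n.
Proof. by rewrite /evalp map_polyXn hornerXn. Qed.

Lemma evalpXsubC c : evalp emb ('X - c%:P) t = t - emb c.
Proof. by rewrite evalpB evalpX evalpC. Qed.

Lemma evalpZ c p : evalp emb (c *: p) t = emb c * evalp emb p t.
Proof. by rewrite -mul_polyC evalpM evalpC. Qed.

Lemma evalp_sum (I : Type) (r : seq I) (P : pred I) (f : I -> {poly k}) :
  evalp emb (\sum_(i <- r | P i) f i) t = \sum_(i <- r | P i) evalp emb (f i) t.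
Proof. exact: (big_morph (fun p => evalp emb p t) evalpD evalp0). Qed.

Lemma evalp_prod (I : Type) (r : seq I) (P : pred I) (f : I -> {poly k}) :
  evalp emb (\prod_(i <- r | P i) f i) t = \prod_(i <- r | P i) evalp emb (f i) t.
Proof. exact: (big_morph (fun p => evalp emb p t) evalpM evalp1). Qed.

Lemma evalpE p : evalp emb p t = \sum_(i < size p) emb p`_i * t ^+ i.
Proof.
rewrite -{1}[p]coefK poly_def evalp_sum.
by apply: eq_bigr => i _; rewrite evalpZ evalpXn.
Qed.

Lemma evalp_poly n (f : nat -> k) :
  evalp emb (\poly_(i < n) f i) t = \sum_(i < n) emb (f i) * t ^+ i.
Proof.
by rewrite poly_def evalp_sum; apply: eq_bigr => i _; rewrite evalpZ evalpXn.
Qed.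

End Evaluation.

(** Over an algebraically closed field this amounts to being transcendental, by [evalp_neq0]. *)
Definition nonconst (k : fieldType) (X : curve k) (t : X) : Prop :=
  ~ range (const X) t.

Section Subfield.
Variables (k : fieldType) (X : curve k) (t : X).

Definition adjoin_pred : {pred X} := fun u => `[< adjoin (const X) t u >].

Lemma adjoin_predP u :
  reflect (exists p q, evalp (const X) q t != 0 /\
                       u = evalp (const X) p t / evalp (const X) q t)
          (u \in adjoin_pred).
Proof. exact: asboolP. Qed.

Lemma adjoin_evalp p : evalp (const X) p t \in adjoin_pred.
Proof. by apply/adjoin_predP; exists p, 1; rewrite evalp1 oner_neq0 divr1. Qed.

Lemma adjoin_divring_closed : divring_closed adjoin_pred.
Proof.
split.
- by rewrite -(evalp1 (const X) t) adjoin_evalp.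
- move=> _ _ /adjoin_predP[p [q [q0 ->]]] /adjoin_predP[p' [q' [q'0 ->]]].
  apply/adjoin_predP; exists (p * q' - p' * q), (q * q').
  rewrite !evalpB !evalpM mulf_neq0 //; split=> //; field.
  by rewrite q0 q'0.
- move=> _ _ /adjoin_predP[p [q [q0 ->]]] /adjoin_predP[p' [q' [q'0 ->]]].
  have [p'0|p'0] := eqVneq (evalp (const X) p' t) 0.
    by rewrite p'0 mul0r invr0 mulr0 -(evalp0 (const X) t) adjoin_evalp.
  apply/adjoin_predP; exists (p * q'), (q * p').
  rewrite !evalpM mulf_neq0 //; split=> //; field.
  by rewrite q0 q'0 p'0.
Qed.

HB.instance Definition _ :=
  GRing.isDivringClosed.Build X adjoin_pred adjoin_divring_closed.

(** k(t) as a field type, needed to form polynomials and matrices over it. *)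
Record ratK := RatK { ratK_val : X; _ : ratK_val \in adjoin_pred }.
HB.instance Definition _ := [isSub for ratK_val].
HB.instance Definition _ := [Choice of ratK by <:].
HB.instance Definition _ := [SubChoice_isSubIntegralDomain of ratK by <:].
HB.instance Definition _ := [SubIntegralDomain_isSubField of ratK by <:].
Fact rat_emb_subproof : {e : {rmorphism ratK -> X} | forall a, e a = ratK_val a}.
Proof. by exists (val : {rmorphism ratK -> X}). Qed.

(* Sealed, lest simplification unfold it to the bare projection. *)
Definition rat_emb : {rmorphism ratK -> X} := sval rat_emb_subproof.

Lemma rat_embE a : rat_emb a = ratK_val a.
Proof. exact: svalP rat_emb_subproof a. Qed.

Definition rat_poly p : ratK := RatK (adjoin_evalp p).

Lemma rat_polyE p : rat_emb (rat_poly p) = evalp (const X) p t.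
Proof. exact: rat_embE. Qed.

Lemma ratP (a : ratK) : exists p q, evalp (const X) q t != 0 /\
  rat_emb a = evalp (const X) p t / evalp (const X) q t.
Proof. by rewrite rat_embE; exact/adjoin_predP/(valP a). Qed.

Lemma range_rat_emb : range rat_emb = adjoin (const X) t.
Proof.
apply/seteqP; split=> [_ [a _ <-]|u /asboolP ut]; first exact: ratP.
by exists (RatK ut); rewrite ?rat_embE.
Qed.

Lemma rat_denominator (I : finType) (c : I -> ratK) :
  exists q (p : I -> {poly k}), evalp (const X) q t != 0 /\
    forall i, rat_emb (c i) * evalp (const X) q t = evalp (const X) (p i) t.
Proof.
have /choice[p /choice[q pq]] := fun i => ratP (c i).
exists (\prod_i q i), (fun i => p i * \prod_(j | j != i) q j); split.
  by rewrite evalp_prod; apply/prodf_neq0 => i _; have [] := pq i.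
move=> i; have [qi ->] := pq i.
by rewrite (bigD1 i) //= !evalpM mulrA divfK.
Qed.

End Subfield.

Section Finiteness.
Variables (k : closedFieldType) (X : curve k).
Implicit Types t u : X.

Lemma evalp_neq0 t p : nonconst t -> p != 0 -> evalp (const X) p t != 0.
Proof.
move=> nt p0; have [rs ->] := closed_field_poly_normal p.
rewrite evalpZ evalp_prod mulf_neq0 ?fmorph_eq0 ?lead_coef_eq0 //.
rewrite prodf_seq_neq0; apply/allP => r _ /=; rewrite evalpXsubC subr_eq0.
by apply/eqP => tr; apply: nt; exists r.
Qed.

Lemma transcendental_nonconst t : transcendental (const X) t -> nonconst t.
Proof.
move=> tt [c _ tc]; have /tt : 'X - c%:P != 0 by rewrite polyXsubC_eq0.
by rewrite evalpXsubC tc subrr eqxx.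
Qed.

Lemma algebraic_relation t m (x : X) : has_dim (rat_emb t) setT m ->
  exists p : 'I_m.+1 -> {poly k}, (exists i, p i != 0) /\
    \sum_i evalp (const X) (p i) t * x ^+ i = 0.
Proof.
move=> hm; have : ~ lfree (rat_emb t) (fun i : 'I_m.+1 => x ^+ i).
  by move=> /(has_dim_free hm (fun=> I)); rewrite card_ord ltnn.
move=> /existsNP[c /not_implyP[cE /existsNP[i ci]]].
have [q [p [q0 pE]]] := rat_denominator c.
exists p; split.
  exists i; apply/eqP => p0; have := pE i; rewrite p0 evalp0 => /eqP.
  by rewrite mulf_eq0 (negPf q0) orbF fmorph_eq0 => /eqP /ci.
under eq_bigr => j _ do rewrite -pE mulrAC.
by rewrite -mulr_suml cE mul0r.
Qed.

(** A relation sum p_i(t) u^i = 0 is reread as a polynomial in [t] with coefficients in k[u];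
    [evalp_neq0] keeps it nonzero. *)
Lemma algebraic_swap t u m : nonconst u -> has_dim (rat_emb t) setT m ->
  exists2 A : {poly ratK u}, A != 0 & evalp (rat_emb u) A t = 0.
Proof.
move=> nu /(algebraic_relation u)[p [[i pi0] pE]].
pose d := (\max_i size (p i))%N.
pose q j := \poly_(l < m.+1) (p (inord l))`_j.
have d_gt l : (size (p l) <= d)%N by apply: (leq_bigmax l).
exists (\poly_(j < d) rat_poly u (q j)).
  apply/eqP => /polyP/(_ (size (p i)).-1).
  have szp : (0 < size (p i))%N by rewrite size_poly_gt0.
  rewrite coef_poly coef0 (leq_trans _ (d_gt i)) ?prednK // => /(congr1 (rat_emb u)).
  rewrite rat_polyE rmorph0 => /eqP; apply/negP/evalp_neq0 => //.
  apply/eqP => /polyP/(_ i); rewrite coef_poly coef0 ltn_ord inord_val => /eqP.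
  by rewrite -/(lead_coef _) lead_coef_eq0 (negPf pi0).
rewrite evalp_poly.
transitivity (\sum_(j < d) \sum_(l < m.+1) const X (p l)`_j * u ^+ l * t ^+ j).
  apply: eq_bigr => j _; rewrite rat_polyE evalp_poly mulr_suml.
  by apply: eq_bigr => l _; rewrite inord_val.
rewrite exchange_big -[RHS]pE /=; apply: eq_bigr => l _.
rewrite evalpE mulr_suml (big_ord_widen d (fun j => const X (p l)`_j * t ^+ j * u ^+ l)) //.
rewrite [RHS]big_mkcond; apply: eq_bigr => j _ /=; case: ifPn => [_|].
  by rewrite mulrAC.
by rewrite -leqNgt => /leq_sizeP/(_ j (leqnn j)) ->; rewrite rmorph0 !mul0r.
Qed.

(** k(X) is finite over k(t) for some [t], which is algebraic over k(u). With [A] a minimal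
    polynomial of [t], of size d, all of k(t) lies in the k(u)-span of the [t ^+ i], i < d. *)
Theorem finite_over u : nonconst u ->
  exists m, has_dim (rat_emb u) setT m.
Proof.
move=> nu; have [t tt [m hm]] := function_fieldP X.
rewrite -range_rat_emb in hm; move/dim_over_has_dim: hm => hm.
have /cid2[A0 A00 A0t] := algebraic_swap nu hm.
pose P n := `[< exists A : {poly ratK u},
  [/\ A != 0, evalp (rat_emb u) A t = 0 & size A = n] >].
have P0 : exists n, P n by exists (size A0); apply/asboolP; exists A0.
case: (ex_minnP P0) => d /asboolP[A [A_neq0 At szA]] min {P0 A0 A00 A0t}.
have minA B : evalp (rat_emb u) B t = 0 -> (size B < d)%N -> B = 0.
  move=> Bt Bd; apply/eqP; apply: contraTT Bd => B0; rewrite -leqNgt.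
  by apply: min; apply/asboolP; exists B.
(* As [A] has minimal size among the polynomials killing [t], any [p] with p(t) nonzero is coprime
   to it, and Bezout inverts p(t). *)
have inv p : evalp (rat_emb u) p t != 0 ->
    exists q, (evalp (rat_emb u) p t)^-1 = evalp (rat_emb u) q t.
  move=> pt; have : coprimep p A.
    rewrite coprimep_def; have := dvdp_gcdr p A; have := dvdp_gcdl p A.
    set g := gcdp p A => /dvdpP[p' pE] /dvdpP[h AE].
    have g0 : evalp (rat_emb u) g t != 0.
      by apply: contra pt; rewrite pE evalpM => /eqP ->; rewrite mulr0.
    have h0 : evalp (rat_emb u) h t = 0.
      by move: At; rewrite AE evalpM => /eqP; rewrite mulf_eq0 (negPf g0) orbF => /eqP.
    have hn0 : h != 0 by apply: contraNneq A_neq0 => h_0; rewrite AE h_0 mul0r.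
    have gn0 : g != 0 by apply: contraNneq A_neq0 => g_0; rewrite AE g_0 mulr0.
    have : ~~ (size h < d)%N by apply: contra hn0 => /(minA _ h0) ->.
    rewrite -szA AE size_mul //; move: gn0; rewrite -size_poly_gt0 -leqNgt.
    by move: (size g) (size h) => a b a0; rewrite -subn1 leq_subLR addnC leq_add2r => a1; rewrite eqn_leq a1.
  move=> /Bezout_eq1_coprimepP[[a b] /= ab].
  exists a; apply: (mulfI pt); rewrite divff //.
  by rewrite -evalpM mulrC -(evalp1 (rat_emb u) t) -ab evalpD !evalpM At mulr0 addr0.
have inK (a : ratK t) : exists q, rat_emb t a = evalp (rat_emb u) q t.
  have lift p : exists q, evalp (const X) p t = evalp (rat_emb u) q t.
    exists (map_poly (fun c => rat_poly u c%:P) p).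
    rewrite /evalp -map_poly_comp_id0 ?rmorph0 //.
    apply/esym; congr (horner _ t); apply: eq_map_poly => c /=.
    by rewrite rat_polyE evalpC.
  have [p [q [q0 ->]]] := ratP a.
  have [p' p'E] := lift p; have [q' q'E] := lift q.
  rewrite q'E in q0 *; have [r ->] := inv _ q0.
  by exists (p' * r); rewrite p'E evalpM.
have inS (a : ratK t) : lspan (rat_emb u) (fun i : 'I_d => t ^+ i) (rat_emb t a).
  have [q ->] := inK a; rewrite (divp_eq q A) evalpD evalpM At mulr0 add0r.
  have sz : (size (q %% A)%R <= d)%N by rewrite -szA ltnW // ltn_modp.
  exists (fun i : 'I_d => (q %% A)`_i); rewrite evalpE.
  rewrite (big_ord_widen d (fun j => rat_emb u (q %% A)`_j * t ^+ j)) //.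
  rewrite [LHS]big_mkcond; apply: eq_bigr => j _ /=; case: ifPn => //.
  by rewrite -leqNgt => /leq_sizeP/(_ j (leqnn j)) ->; rewrite rmorph0 !mul0r.
have [b [_ _ gb]] := hm.
have : forall n (c : 'I_n -> X), (forall i, [set: X] (c i)) ->
    lfree (rat_emb u) c -> (n <= #|{: 'I_m * 'I_d}|)%N.
  move=> n c _ fc; rewrite -(card_ord n).
  apply: (steinitz fc (c := fun ij : 'I_m * 'I_d => t ^+ ij.2 * b ij.1)) => i.
  have [a ->] := gb (c i) I; have /choice[a' a'E] := fun j => inS (a j).
  exists (fun ij => a' ij.1 ij.2); rewrite -(pair_bigA _
    (fun i j => rat_emb u (a' i j) * (t ^+ j * b i))) /=.
  apply: eq_bigr => j _; rewrite a'E mulr_suml; apply: eq_bigr => l _.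
  by rewrite mulrA.
by move=> /has_dim_bounded[n _ hn]; exists n.
Qed.

End Finiteness.

(** * Places *)

Section Orders.
Variables (k : fieldType) (X : curve k) (P : closed_point X).
Implicit Types (u v : X) (n m : int).

Lemma ord_zero : ord P 0 = 0. Proof. by case: P. Qed.

Lemma ordM u v : u != 0 -> v != 0 -> ord P (u * v) = ord P u + ord P v.
Proof. by case: P => o /= _ oM _ _ _; exact: oM. Qed.

Lemma ordD u v : u != 0 -> v != 0 -> u + v != 0 ->
  Num.min (ord P u) (ord P v) <= ord P (u + v).
Proof. by case: P => o /= _ _ oD _ _; exact: oD. Qed.

Lemma ord_const c : ord P (const X c) = 0.
Proof. by case: P => o /= _ _ _ oc _; exact: oc. Qed.

Lemma ord_one : ord P 1 = 0.
Proof. by rewrite -(rmorph1 (const X)) ord_const. Qed.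

Lemma ord_unif : exists2 u, u != 0 & ord P u = 1.
Proof.
have [u u1] : exists u, ord P u = 1 by case: P.
by exists u => //; apply/eqP => u0; move: u1; rewrite u0 ord_zero.
Qed.

Lemma ordN u : ord P (- u) = ord P u.
Proof.
have [->|u0] := eqVneq u 0; first by rewrite oppr0.
rewrite -mulN1r -(rmorph1 (const X)) -rmorphN ordM ?ord_const ?add0r //.
by rewrite fmorph_eq0 oppr_eq0 oner_neq0.
Qed.

Lemma ordV u : ord P u^-1 = - ord P u.
Proof.
have [->|u0] := eqVneq u 0; first by rewrite invr0 ord_zero oppr0.
by apply/eqP; rewrite -addr_eq0 -ordM ?invr_eq0 // mulVf // ord_one.
Qed.

Lemma ord_div u v : u != 0 -> v != 0 -> ord P (u / v) = ord P u - ord P v.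
Proof. by move=> u0 v0; rewrite ordM ?invr_eq0 // ordV. Qed.

Lemma ordX u i : u != 0 -> ord P (u ^+ i) = ord P u *+ i.
Proof.
move=> u0; elim: i => [|i IH]; first by rewrite expr0 mulr0n ord_one.
by rewrite exprS ordM ?expf_neq0 // IH mulrS.
Qed.

Lemma ordXz u n : u != 0 -> ord P (u ^ n) = ord P u * n.
Proof.
move=> u0; case: n => i; first by rewrite -exprnP ordX // pmulrn mulrzz.
by rewrite NegzE -exprnN ordV ordX // mulrN pmulrn mulrzz.
Qed.

Lemma ord_prod (I : Type) (r : seq I) (Q : pred I) (f : I -> X) :
  (forall i, Q i -> f i != 0) ->
  ord P (\prod_(i <- r | Q i) f i) = \sum_(i <- r | Q i) ord P (f i).
Proof.
move=> f0; elim: r => [|i r IH]; first by rewrite !big_nil ord_one.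
rewrite !big_cons; case: ifP => // Qi; rewrite ordM ?f0 ?IH //.
apply: (big_ind (fun u => u != 0)) => //; first exact: oner_neq0.
by move=> *; exact: mulf_neq0.
Qed.

(* Here ord P 0 counts as +oo. *)
Definition vge n u := (u == 0) || (n <= ord P u).

Lemma vge0 n : vge n 0. Proof. by rewrite /vge eqxx. Qed.

Lemma vgeE n u : u != 0 -> vge n u = (n <= ord P u).
Proof. by rewrite /vge => /negPf ->. Qed.

Lemma vge_ord u : vge (ord P u) u. Proof. by rewrite /vge lexx orbT. Qed.

Lemma vgeW n m u : m <= n -> vge n u -> vge m u.
Proof. by rewrite /vge => mn /orP[->//|/(le_trans mn) ->]; rewrite orbT. Qed.

Lemma vgeD n u v : vge n u -> vge n v -> vge n (u + v).
Proof.
have [->|u0] := eqVneq u 0; first by rewrite add0r.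
have [->|v0] := eqVneq v 0; first by rewrite addr0.
have [->|uv0] := eqVneq (u + v) 0; first by rewrite !vge0.
rewrite !vgeE // => nu nv; apply: (le_trans _ (ordD u0 v0 uv0)).
by rewrite le_min nu.
Qed.

Lemma vgeN n u : vge n (- u) = vge n u.
Proof. by rewrite /vge oppr_eq0 ordN. Qed.

Lemma vgeB n u v : vge n u -> vge n v -> vge n (u - v).
Proof. by move=> nu nv; apply: vgeD => //; rewrite vgeN. Qed.

Lemma vgeM n m u v : vge n u -> vge m v -> vge (n + m) (u * v).
Proof.
have [->|u0] := eqVneq u 0; first by rewrite mul0r !vge0.
have [->|v0] := eqVneq v 0; first by rewrite mulr0 !vge0.
by rewrite !vgeE ?mulf_neq0 ?ordM //; exact: lerD.
Qed.

Lemma vgeMr n u v : v != 0 -> vge (n + ord P v) (u * v) = vge n u.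
Proof.
move=> v0; have [->|u0] := eqVneq u 0; first by rewrite mul0r !vge0.
by rewrite !vgeE ?mulf_neq0 // ordM // lerD2r.
Qed.

Lemma vge_const c : vge 0 (const X c).
Proof. by rewrite /vge ord_const lexx orbT. Qed.

Lemma vgeZ n c u : vge n u -> vge n (const X c * u).
Proof. by move=> nu; rewrite -[n]add0r; apply: vgeM => //; exact: vge_const. Qed.

Lemma vge1 : vge 0 1.
Proof. by rewrite -(rmorph1 (const X)) vge_const. Qed.

Lemma vgeX u i : vge 0 u -> vge 0 (u ^+ i).
Proof.
move=> u0; elim: i => [|i IH]; first exact: vge1.
by rewrite exprS -[0]addr0; apply: vgeM.
Qed.

Lemma vge_sum n (I : Type) (r : seq I) (Q : pred I) (f : I -> X) :
  (forall i, Q i -> vge n (f i)) -> vge n (\sum_(i <- r | Q i) f i).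
Proof.
move=> nf; apply: (big_ind (fun u => vge n u)) => //; first exact: vge0.
by move=> *; exact: vgeD.
Qed.

Lemma vge_evalp p u : vge 0 u -> vge 0 (evalp (const X) p u).
Proof.
by move=> u0; rewrite evalpE; apply: vge_sum => i _; apply: vgeZ; exact: vgeX.
Qed.

Lemma ord_dominant u v : u != 0 -> vge (ord P u + 1) v ->
  u + v != 0 /\ ord P (u + v) = ord P u.
Proof.
move=> u0 vu; have uv0 : u + v != 0.
  apply/eqP => /eqP; rewrite addr_eq0 => /eqP uv.
  by move: vu; rewrite -vgeN -uv vgeE // gerDl.
split=> //; apply/eqP; rewrite eq_le -[X in _ && X]vgeE //.
rewrite (vgeD (vge_ord u) (vgeW _ vu)) ?lerDl // andbT leNgt; apply/negP.
rewrite -lezD1 => lt.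
have : vge (ord P u + 1) (u + v - v).
  by apply: vgeB => //; rewrite vgeE.
by rewrite addrK vgeE // gerDl.
Qed.

Lemma ord_eqP u n : u != 0 -> vge n u -> ~~ vge (n + 1) u -> ord P u = n.
Proof.
move=> u0; rewrite !vgeE // => nu; rewrite -ltNge ltzD1 => un.
by apply/eqP; rewrite eq_le un.
Qed.

Lemma vge_sum_lt (I : finType) (f : I -> X) i : f i != 0 ->
  (forall j, j != i -> vge (ord P (f i) + 1) (f j)) ->
  \sum_j f j != 0 /\ ord P (\sum_j f j) = ord P (f i).
Proof.
move=> fi0 fj; rewrite (bigD1 i) //=; apply: ord_dominant => //.
exact: vge_sum.
Qed.

End Orders.

Section Residues.
Variables (k : closedFieldType) (X : curve k) (P : closed_point X).
Implicit Types (u v : X).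

Lemma nonconst_neq0 u : nonconst u -> u != 0.
Proof. by move=> nu; apply/eqP => u0; apply: nu; exists 0; rewrite ?rmorph0. Qed.

Lemma nonconst_subC u c : nonconst u -> u - const X c != 0.
Proof. by move=> nu; rewrite subr_eq0; apply/eqP => uc; apply: nu; exists c. Qed.

Lemma ord_nonconst u : ord P u != 0 -> nonconst u.
Proof. by move=> u0 [c _ uc]; rewrite -uc ord_const eqxx in u0. Qed.

Lemma ord_evalp_root u p : nonconst u -> p != 0 ->
  (forall c, ord P (u - const X c) = 0) -> ord P (evalp (const X) p u) = 0.
Proof.
move=> nu p0 u0; have [rs ->] := closed_field_poly_normal p.
rewrite evalpZ ordM ?ord_const ?fmorph_eq0 ?lead_coef_eq0 //; last first.
  rewrite evalp_neq0 // prodf_seq_neq0; apply/allP => r _ /=.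
  by rewrite polyXsubC_eq0.
rewrite add0r evalp_prod ord_prod => [|r _].
  by rewrite big1 // => r _; rewrite evalpXsubC u0.
by rewrite evalpXsubC nonconst_subC.
Qed.

(* Otherwise the valuation would be trivial on k(u), hence on the finite
   extension k(X). *)
Lemma residue_exists u : vge P 0 u -> exists c, vge P 1 (u - const X c).
Proof.
move=> u_ge0; have [[c _ uc]|nu] := pselect (range (const X) u).
  by exists c; rewrite uc subrr vge0.
apply: contrapT => /forallNP no.
have uc0 c : ord P (u - const X c) = 0.
  apply: ord_eqP; first exact: nonconst_subC.
    by apply: vgeB => //; exact: vge_const.
  by rewrite add0r; apply/negP/no.
have [m hm] := finite_over nu.
have [x x0 x1] := ord_unif P.
have [p [[i0 pi0] pE]] := algebraic_relation x hm.
(* All nonzero coefficients p_j(u) have order 0 at [P], so the terms p_j(u) x^j have distinct orders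
   j; the smallest one dominates and the sum cannot vanish. *)
pose Q (i : 'I_m.+1) := p i != 0.
case: (@arg_minnP _ i0 Q (fun i => i : nat) pi0) => i pi mini.
have [pxi0 pxi] : evalp (const X) (p i) u * x ^+ i != 0 /\
    ord P (evalp (const X) (p i) u * x ^+ i) = i.
  rewrite mulf_neq0 ?evalp_neq0 ?expf_neq0 // ordM ?evalp_neq0 ?expf_neq0 //.
  by rewrite ord_evalp_root // ordX // x1 add0r natz.
have [] := @vge_sum_lt _ _ P _ (fun i => evalp (const X) (p i) u * x ^+ i) i pxi0.
  move=> j ji; have [pj|pj] := eqVneq (p j) 0.
    by rewrite pj evalp0 mul0r vge0.
  rewrite vgeE ?mulf_neq0 ?evalp_neq0 ?expf_neq0 // pxi.
  rewrite ordM ?evalp_neq0 ?expf_neq0 // ord_evalp_root // ordX // x1 add0r natz.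
  by rewrite lezD1 ltz_nat ltn_neqAle eq_sym ji mini.
by rewrite pE eqxx.
Qed.

Lemma residue_ratio u v : u != 0 -> v != 0 -> ord P u = ord P v ->
  exists2 c, c != 0 & vge P (ord P v + 1) (u - const X c * v).
Proof.
move=> u0 v0 uv; have uv0 : ord P (u / v) = 0 by rewrite ord_div // uv subrr.
have [|c uc] := @residue_exists (u / v); first by rewrite -uv0 vge_ord.
exists c.
  apply/eqP => c0; move: uc; rewrite c0 rmorph0 subr0 vgeE ?uv0 //.
  by rewrite mulf_neq0 ?invr_eq0.
by rewrite -(divfK v0 u) -mulrBl addrC vgeMr.
Qed.

End Residues.

(** * Normalization of discrete valuations *)

Section Normalization.
Variables (k : fieldType) (X : curve k) (o : X -> int).
Hypotheses (o0 : o 0 = 0)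
  (oM : forall u v, u != 0 -> v != 0 -> o (u * v) = o u + o v)
  (oD : forall u v, u != 0 -> v != 0 -> u + v != 0 ->
    Num.min (o u) (o v) <= o (u + v))
  (oC : forall c, o (const X c) = 0)
  (o_nontrivial : exists u, o u != 0).

(** The values form a nonzero subgroup of the integers; dividing by its positive generator [e]
    normalizes [o]. *)
Lemma normalize_valuation : exists (P : closed_point X) (e : nat),
  (0 < e)%N /\ forall u, o u = ord P u *+ e.
Proof.
have o1 : o 1 = 0 by rewrite -(rmorph1 (const X)).
have oV u : u != 0 -> o u^-1 = - o u.
  by move=> u0; apply/eqP; rewrite -addr_eq0 -oM ?invr_eq0 // mulVf // o1.
have oX u i : u != 0 -> o (u ^+ i) = o u *+ i.
  move=> u0; elim: i => [|i IH]; first by rewrite expr0 mulr0n o1.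
  by rewrite exprS oM ?expf_neq0 // IH mulrS.
have oXz u z : u != 0 -> o (u ^ z) = o u * z.
  move=> u0; case: z => i; first by rewrite -exprnP oX // pmulrn mulrzz.
  by rewrite NegzE -exprnN oV ?expf_neq0 // oX // mulrN pmulrn mulrzz.
pose Q n := (0 < n)%N && `[< exists2 u, u != 0 & o u = n%:Z >].
have Qex : exists n, Q n.
  have [u ou0] := o_nontrivial.
  have u0 : u != 0 by apply: contraNneq ou0 => ->; rewrite o0.
  exists `|o u|%N; rewrite /Q absz_gt0 ou0; apply/asboolP.
  have [ou|ou] := leP 0 (o u); first by exists u; rewrite ?gez0_abs.
  by exists u^-1; rewrite ?invr_eq0 // oV // ltz0_abs.
case: (ex_minnP Qex) => e /andP[e_gt0 /asboolP[w w0 ow]] e_min.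
have e0 : e%:Z != 0 by lia.
have dvd u : o u = (o u %/ e)%Z * e.
  have [->|u0] := eqVneq u 0; first by rewrite o0 div0z mul0r.
  have rE : o (u * w ^ (- (o u %/ e)%Z)) = (o u %% e)%Z.
    rewrite oM ?expfz_neq0 // oXz // ow {1}(divz_eq (o u) e) mulrN mulrC.
    by rewrite addrAC subrr add0r.
  have r_ge0 := modz_ge0 (o u) e0.
  have r_lt : (o u %% e)%Z < e by apply: ltz_pmod.
  have [r0|r0] := eqVneq (o u %% e)%Z 0.
    by rewrite {1}(divz_eq (o u) e) r0 addr0.
  have /e_min : Q `|(o u %% e)%Z|%N.
    rewrite /Q absz_gt0 r0; apply/asboolP; exists (u * w ^ (- (o u %/ e)%Z)).
      by rewrite mulf_neq0 ?expfz_neq0.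
    by rewrite rE gez0_abs.
  by rewrite -lez_nat gez0_abs // leNgt r_lt.
have dvd_inj (a b : int) : (a * e <= b * e) = (a <= b) by rewrite ler_pM2r.
pose o' u := (o u %/ e)%Z.
have o'P u n : (o' u == n) = (o u == n * e).
  by rewrite [o u]dvd -/(o' u) (inj_eq (mulIf e0)).
have o'0 : o' 0 = 0 by apply/eqP; rewrite o'P o0 mul0r.
have o'M u v : u != 0 -> v != 0 -> o' (u * v) = o' u + o' v.
  by move=> u0 v0; apply/eqP; rewrite o'P oM // mulrDl -!dvd.
have o'D u v : u != 0 -> v != 0 -> u + v != 0 ->
    Num.min (o' u) (o' v) <= o' (u + v).
  move=> u0 v0 uv0; have := oD u0 v0 uv0.
  rewrite !ge_min => /orP[] h; apply/orP; [left|right];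
  by rewrite -dvd_inj -!dvd.
have o'C c : o' (const X c) = 0 by apply/eqP; rewrite o'P oC mul0r.
have o'1 : exists u, o' u = 1.
  by exists w; apply/eqP; rewrite o'P ow mul1r.
exists (ClosedPoint o'0 o'M o'D o'C o'1), e; split=> // u /=.
by rewrite {1}dvd -mulr_natr natz.
Qed.

End Normalization.

(** * Existence of zeros, by Chevalley's extension theorem *)

Section Places.
Variables (k : closedFieldType) (X : curve k) (a : X).
Hypothesis na : nonconst a.

Let a0 : a != 0 := nonconst_neq0 na.

Definition ring_like (S : set X) : Prop :=
  (forall u v, S u -> S v -> S (u - v)) /\ (forall u v, S u -> S v -> S (u * v)).

Let R0 : set X := [set u | exists p, u = evalp (const X) p a].

(* Chevalley: a subring that is maximal among those that contain k[a] but
   not 1/a is a valuation ring. *)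
Lemma chevalley_maximal : exists O : set X,
  [/\ ring_like O, R0 `<=` O, ~ O a^-1 &
      forall S, ring_like S -> O `<=` S -> ~ S a^-1 -> S `<=` O].
Proof.
(* Adjoining [R0] to [A] makes the empty union good too, so that Zorn's lemma applies to arbitrary
   chains. *)
pose good (A : set X) := ring_like (A `|` R0) /\ ~ (A `|` R0) a^-1.
have [F Fgood Ftot|A [[Aring Aa] Amax]] := @Zorn_bigcup X good.
  have common u v : (\bigcup_(A in F) A `|` R0) u ->
      (\bigcup_(A in F) A `|` R0) v -> (R0 u /\ R0 v) \/
      exists2 A, F A & (A `|` R0) u /\ (A `|` R0) v.
    move=> [[A FA Au]|Ru] [[B FB Bv]|Rv].
    - have [AB|BA] := Ftot _ _ FA FB; right.
        by exists B => //; split; left => //; exact: AB.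
      by exists A => //; split; left => //; exact: BA.
    - by right; exists A => //; split; [left|right].
    - by right; exists B => //; split; [right|left].
    - by left.
  have sub A : F A -> (A `|` R0) `<=` (\bigcup_(A in F) A `|` R0).
    by move=> FA u [Au|Ru]; [left; exists A|right].
  split; first split.
  - move=> u v Uu Uv; have [[[p ->] [q ->]]|[A FA [Au Av]]] := common _ _ Uu Uv.
      by right; exists (p - q); rewrite evalpB.
    by apply: (sub A FA); have [[AB _] _] := Fgood _ FA; exact: AB.
  - move=> u v Uu Uv; have [[[p ->] [q ->]]|[A FA [Au Av]]] := common _ _ Uu Uv.
      by right; exists (p * q); rewrite evalpM.
    by apply: (sub A FA); have [[_ AM] _] := Fgood _ FA; exact: AM.
  - move=> [[A FA Aa]|[p pE]].
      by have [_] := Fgood _ FA; apply; left.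
    have /(evalp_neq0 na)/eqP : 'X * p - 1 != 0.
      apply/eqP => /(congr1 (fun q : {poly k} => q.[0])).
      by rewrite hornerD hornerM hornerX mul0r hornerN hornerC add0r horner0 => /eqP;
         rewrite oppr_eq0 oner_eq0.
    by apply; rewrite evalpB evalpM evalpX evalp1 -pE divff ?subrr.
exists (A `|` R0); split; [exact: Aring|by move=> u Ru; right|exact: Aa|].
move=> S Sring AS Sa; apply: contrapT => nS; apply: (Amax S).
  split; first by move=> u Au; apply: AS; left.
  by move=> SA; apply: nS => u Su; left; exact: SA.
have SE : S `|` R0 = S.
  by apply/seteqP; split=> u; [case=> // Ru; apply: AS; right|left].
by rewrite /good SE.
Qed.

Section ValuationRing.
Variable O : set X.
Hypotheses (Oring : ring_like O) (R0O : R0 `<=` O) (Oa : ~ O a^-1)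
  (Omax : forall S, ring_like S -> O `<=` S -> ~ S a^-1 -> S `<=` O).

Let OB := Oring.1.
Let OM := Oring.2.
Let OC c : O (const X c).
Proof. by apply: R0O; exists c%:P; rewrite evalpC. Qed.
Let O0 : O 0. Proof. by rewrite -(rmorph0 (const X)). Qed.
Let O1 : O 1. Proof. by rewrite -(rmorph1 (const X)). Qed.
Let ON u : O u -> O (- u). Proof. by move=> Ou; rewrite -sub0r; exact: OB. Qed.
Let OD u v : O u -> O v -> O (u + v).
Proof. by move=> Ou Ov; rewrite -[v]opprK; apply: OB => //; exact: ON. Qed.
Let OX u i : O u -> O (u ^+ i).
Proof. by move=> Ou; elim: i => [|i IH]; rewrite ?expr0 // exprS; exact: OM. Qed.
Let Oa1 : O a. Proof. by apply: R0O; exists 'X; rewrite evalpX. Qed.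
Let O_sum (I : Type) (r : seq I) (Q : pred I) (f : I -> X) :
  (forall i, Q i -> O (f i)) -> O (\sum_(i <- r | Q i) f i).
Proof. by move=> Of; apply: (big_ind O). Qed.

(** The powers of w = 1 - a y are congruent to 1 modulo [a], so inverting [w] does not bring in
    [a^-1]; by maximality [O] already contains [w^-1]. *)
Let unit_1sub y : O y -> O (1 - a * y)^-1.
Proof.
move=> Oy; set w := 1 - a * y.
have Ow : O w by apply: OB => //; exact: OM.
pose S := [set u | exists r, O (u * w ^+ r)].
have w0 : w != 0.
  apply/eqP => /eqP; rewrite subr_eq0 => /eqP ay; apply: Oa.
  by rewrite -[a^-1]mulr1 ay mulKf.
have powa r : O ((1 - w ^+ r) / a).
  elim: r => [|r IH]; first by rewrite expr0 subrr mul0r.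
  have -> : (1 - w ^+ r.+1) / a = (1 - w ^+ r) / a * w + (1 - w) / a.
    by rewrite exprS; field.
  apply: OD; first exact: OM.
  by rewrite /w opprB addrC subrK mulrC mulKf.
apply: (Omax (S := S)) => [|u Ou|[r Or]|].
- split=> u v [r Or] [s Os]; exists (r + s)%N.
    have -> : (u - v) * w ^+ (r + s) = u * w ^+ r * w ^+ s - v * w ^+ s * w ^+ r.
      by rewrite exprD; ring.
    by apply: OB; apply: OM => //; exact: OX.
  by rewrite exprD mulrACA; exact: OM.
- by exists 0%N; rewrite expr0 mulr1.
- apply: Oa; have -> : a^-1 = a^-1 * w ^+ r + (1 - w ^+ r) / a by field.
  exact: OD.
- by exists 1%N; rewrite expr1 mulVf.
Qed.

Let Ocoef (p : {poly X}) := forall i, O p`_i.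

(** O[x] is strictly larger than [O], hence contains [a^-1] by maximality. *)
Let extension_minimal x : ~ O x -> exists p : {poly X},
  [/\ Ocoef p, a^-1 = p.[x] &
      forall q, Ocoef q -> a^-1 = q.[x] -> (size p <= size q)%N].
Proof.
move=> nOx; pose S := [set u | exists2 p, Ocoef p & u = p.[x]].
have Sa : S a^-1.
  apply: contrapT => nSa; apply: nOx; apply: (Omax (S := S)) => // [|u Ou|].
  - split=> _ _ [p Op ->] [q Oq ->].
      by exists (p - q) => [i|]; rewrite ?coefB ?hornerD ?hornerN //; exact: OB.
    exists (p * q) => [i|]; rewrite ?hornerM // coefM.
    by apply: O_sum => j _; exact: OM.
  - by exists u%:P; rewrite ?hornerC // => i; rewrite coefC; case: ifP.
  - by exists 'X; rewrite ?hornerX // => i; rewrite coefX; case: (_ == _).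
pose Q n := `[< exists p, [/\ Ocoef p, a^-1 = p.[x] & size p = n] >].
have Qex : exists n, Q n.
  by have [p Op pE] := Sa; exists (size p); apply/asboolP; exists p.
case: (ex_minnP Qex) => n /asboolP[p [Op pE pn]] nmin.
exists p; split=> // q Oq qE; rewrite pn; apply: nmin; apply/asboolP.
by exists q.
Qed.

(** Multiplied by a x^n, the relation in [x^-1] expresses (1 - a q_0) x^n by lower powers of [x]. As
    1 - a q_0 is a unit, the top term of [p] can be eliminated, against minimality. *)
Let no_reduction x (p q : {poly X}) : x != 0 -> Ocoef p -> a^-1 = p.[x] ->
  (forall r, Ocoef r -> a^-1 = r.[x] -> (size p <= size r)%N) ->
  Ocoef q -> a^-1 = q.[x^-1] -> ~ (size q <= size p)%N.
Proof.
move=> x0 Op pE pmin Oq qE szqp.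
have p0 : p != 0.
  by apply/eqP => p0; move: pE; rewrite p0 horner0 => /eqP; rewrite invr_eq0 (negPf a0).
case szp: (size p) (pmin) => [|n] {}pmin.
  by move/eqP: szp; rewrite size_poly_eq0 (negPf p0).
set w := 1 - a * q`_0.
have w0 : w != 0.
  apply/eqP => /eqP; rewrite subr_eq0 => /eqP aq; apply: Oa.
  by rewrite -[a^-1]mulr1 aq mulKf.
have Ow : O w^-1 by exact: unit_1sub.
have topE : x ^+ n = \sum_(j < n) a / w * q`_(n - j) * x ^+ j.
  have qE1 : a^-1 = \sum_(i < n.+1) q`_i * x^-1 ^+ i.
    rewrite qE horner_coef; rewrite szp in szqp.
    rewrite (big_ord_widen n.+1 (fun i => q`_i * x^-1 ^+ i)) // big_mkcond.
    apply: eq_bigr => j _; case: ifPn => //.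
    by rewrite -leqNgt => /leq_sizeP/(_ j (leqnn j)) ->; rewrite mul0r.
  have : w = a * \sum_(i < n) q`_(i.+1) * x^-1 ^+ i.+1.
    by rewrite /w; rewrite big_ord_recl expr0 mulr1 in qE1;
       apply: (mulfI (invr_neq0 a0)); rewrite mulKf // mulrBr mulr1 mulKf //
       {1}qE1 addrAC subrr add0r.
  move=> wE; rewrite (reindex_inj rev_ord_inj) /=.
  under eq_bigr => i _.
    have -> : (n - (n - i.+1) = i.+1)%N by rewrite subKn.
    have -> : x ^+ (n - i.+1) = x ^+ n * x^-1 ^+ i.+1.
      by rewrite exprVn expfB_cond ?(negPf x0) //; have := ltn_ord i; lia.
    have -> : a / w * q`_i.+1 * (x ^+ n * x^-1 ^+ i.+1) =
      x ^+ n / w * a * (q`_i.+1 * x^-1 ^+ i.+1) by ring.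
    over.
  by rewrite -mulr_sumr -[x ^+ n / w * a * _]mulrA -wE divfK.
pose r := \poly_(j < n) (p`_j + p`_n * (a / w * q`_(n - j))).
have /pmin : Ocoef r.
  move=> i; rewrite coef_poly; case: ifP => // _.
  by apply: OD => //; do ![apply: OM => //].
have -> : a^-1 = r.[x].
  rewrite pE horner_coef szp big_ord_recr /= topE horner_poly mulr_sumr -big_split.
  by apply: eq_bigr => j _ /=; rewrite mulrDl !mulrA.
by move=> /(_ erefl); rewrite leqNgt ltnS size_poly.
Qed.

Let valuation_ring x : O x \/ O x^-1.
Proof.
apply: contrapT => /not_orP[nOx nOxV].
have x0 : x != 0 by apply/eqP => x0; apply: nOx; rewrite x0.
have [p [Op pE pmin]] := extension_minimal nOx.
have [q [Oq qE qmin]] := extension_minimal nOxV.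
have [le|le] := leqP (size q) (size p).
  exact: no_reduction x0 Op pE pmin Oq qE le.
apply: (no_reduction _ Oq qE qmin Op _ (ltnW le)); first by rewrite invr_eq0.
by rewrite invrK.
Qed.

Let U u := O u /\ O u^-1.

Let UM u v : U u -> U v -> U (u * v).
Proof. by move=> [? ?] [? ?]; split; rewrite ?invfM; exact: OM. Qed.
Let UV u : U u -> U u^-1. Proof. by case=> ? ?; split; rewrite ?invrK. Qed.
Let UX u i : U u -> U (u ^+ i).
Proof. by case=> ? ?; split; rewrite -?exprVn; exact: OX. Qed.

(** [p] is X^n times a polynomial with nonzero constant term, whose value at [a] is a constant times
    some 1 - a y, a unit. *)
Let U_evalp p : p != 0 -> exists n, U (evalp (const X) p a / a ^+ n).
Proof.
have [n] := ubnP (size p); elim: n => // n IH in p * => szp p0.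
have [p00|p00] := eqVneq p`_0 0.
  have pE : p = (\poly_(i < (size p).-1) p`_i.+1) * 'X.
    apply/polyP => i; rewrite coefMX coef_poly; case: i => [|i] //=.
    case: ifPn => //; rewrite -leqNgt => le.
    by apply/leq_sizeP: (leqnn i.+1) => //; rewrite -subn1 leq_subLR in le.
  set p' := (\poly_(i < _) _) in pE.
  have p'0 : p' != 0 by apply: contraNneq p0 => p'0; rewrite pE p'0 mul0r.
  have [||m Um] := IH p'.
  - by rewrite (leq_ltn_trans (size_poly _ _)) // prednK ?size_poly_gt0.
  - exact: p'0.
  exists m.+1; rewrite pE evalpM evalpX exprSr invfM mulrACA divff // mulr1.
  exact: Um.
exists 0%N; rewrite expr0 divr1.
have Uc : U (const X p`_0) by split; rewrite -?fmorphV; exact: OC.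
have c0 : const X p`_0 != 0 by rewrite fmorph_eq0.
pose s := evalp (const X) (\poly_(i < (size p).-1) p`_i.+1) a.
have -> : evalp (const X) p a = const X p`_0 * (1 - a * (- s / const X p`_0)).
  have -> : evalp (const X) p a = const X p`_0 + a * s.
    rewrite /s -[a in a * _](evalpX (const X)) -(evalpC (const X) a p`_0) -evalpM -evalpD.
    congr (evalp _ _ _); apply/polyP => i; rewrite coefD coefC coefXM coef_poly.
    case: i => [|i] /=; first by rewrite addr0.
    rewrite add0r; case: ifPn => //; rewrite -leqNgt => le.
    by apply: (leq_sizeP _ _ _ i.+1 (leqnn _)); rewrite -subn1 leq_subLR in le.
  by field.
have Os : O (- s / const X p`_0).
  by apply: OM; [apply: ON; apply: R0O; eexists|exact: Uc.2].
apply: UM => //; split; last exact: unit_1sub.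
by apply: OB => //; exact: OM.
Qed.

Let max_elem (I : finType) (Q : pred I) (f : I -> X) i0 : Q i0 ->
  (forall i, Q i -> f i != 0) ->
  exists2 i, Q i & forall j, Q j -> O (f j / f i).
Proof.
move=> Qi0 f0; suff : forall s : seq I, exists2 i, Q i &
    forall j, j \in s -> Q j -> O (f j / f i).
  move=> /(_ (enum I))[i Qi imax]; exists i => // j.
  by apply: imax; rewrite mem_enum.
elim=> [|l s [i Qi imax]]; first by exists i0.
have [nQl|Ql] := boolP (~~ Q l).
  exists i => // j; rewrite inE => /orP[/eqP ->|]; last exact: imax.
  by rewrite (negPf nQl).
rewrite negbK in Ql; have l0 := f0 _ Ql; have fi0 := f0 _ Qi.
have [li|il] := valuation_ring (f l / f i).
  by exists i => // j; rewrite inE => /orP[/eqP ->//|]; exact: imax.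
rewrite invf_div in il; exists l => // j; rewrite inE => /orP[/eqP -> _|js Qj].
  by rewrite divff.
have -> : f j / f l = (f j / f i) * (f i / f l) by field; rewrite fi0 l0.
by apply: OM => //; exact: imax.
Qed.

(** The non-units of [O]. Since [0^-1 = 0] lies in [O], zero has to be included by hand. *)
Let N u := u = 0 \/ O u /\ ~ O u^-1.

Let N_sum (I : finType) (Q : pred I) (f : I -> X) :
  (forall i, Q i -> N (f i)) -> N (\sum_(i | Q i) f i).
Proof.
move=> Nf; apply: (big_ind N) => //; first by left.
move=> {Nf} u v [->|[Ou nu]]; first by rewrite add0r.
case=> [->|[Ov nv]]; first by rewrite addr0; right.
have [uv0|uv0] := eqVneq (u + v) 0; [by left|right].
wlog uv : u v Ou Ov nu nv uv0 / O (u / v) => [wl|].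
  have [uv|vu] := valuation_ring (u / v); first exact: wl.
  by rewrite addrC; apply: wl; rewrite // 1?addrC // -invf_div.
split=> [|uvV]; first exact: OD.
have v0 : v != 0 by apply/eqP => v0; apply: nv; rewrite v0 invr0.
apply: nv; have -> : v^-1 = (1 + u / v) * (u + v)^-1 by field; rewrite v0 uv0.
by apply: OM => //; exact: OD.
Qed.

(** In an algebraic relation of [x] over k(a), a single term of least value would dominate. So two
    terms, of indices i < j, have a unit as quotient, which makes x^(j-i) a unit times a power of
    [a]. *)
Let power_unit m x : has_dim (rat_emb a) setT m -> x != 0 ->
  exists2 l, (0 < l <= m)%N & exists z : int, U (x ^+ l / a ^ z).
Proof.
move=> hm x0; have [p [[i0 pi0] pE]] := algebraic_relation x hm.
pose T i := evalp (const X) (p i) a * x ^+ i.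
have T0 i : p i != 0 -> T i != 0.
  by move=> ?; rewrite mulf_neq0 ?evalp_neq0 ?expf_neq0.
have [i pi Tmax] := @max_elem _ (fun i => p i != 0) T i0 pi0 T0.
have conclude (i1 j1 : 'I_m.+1) : (i1 < j1)%N -> p i1 != 0 -> p j1 != 0 ->
    U (T j1 / T i1) ->
    exists2 l, (0 < l <= m)%N & exists z : int, U (x ^+ l / a ^ z).
  move=> ij pi1 pj1 Uij; have [ni Ui] := U_evalp pi1; have [nj Uj] := U_evalp pj1.
  exists (j1 - i1)%N; first by rewrite subn_gt0 ij leq_subLR; have := ltn_ord j1; lia.
  exists (ni%:Z - nj%:Z).
  have := UM Uij (UM Ui (UV Uj)); congr (U _); rewrite /T.
  have -> : x ^+ j1 = x ^+ (j1 - i1) * x ^+ i1 by rewrite -exprD subnK // ltnW.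
  rewrite expfzDr // -invr_expz -!exprnP.
  by field; rewrite !expf_neq0 ?evalp_neq0.
have [[j [ji pj Oij]]|no] := pselect (exists j, [/\ j != i, p j != 0 & O (T i / T j)]).
  have Oji : O (T j / T i) by exact: Tmax.
  have Uji : U (T j / T i) by split=> //; rewrite invf_div.
  have [lt|lt|/val_inj eq] := ltngtP i j.
  - exact: conclude Uji.
  - by apply: (conclude j i lt) => //; rewrite -invf_div; exact: UV.
  - by rewrite eq eqxx in ji.
have /N_sum : forall j, j != i -> N (T j / T i).
  move=> j ji; have [pj|pj] := eqVneq (p j) 0.
    by left; rewrite /T pj evalp0 !mul0r.
  right; split; first exact: Tmax.
  by rewrite invf_div => Oij; apply: no; exists j.
rewrite -mulr_suml (_ : \sum_(_ | _) _ = - T i); last first.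
  by apply/eqP; rewrite -addr_eq0 addrC; move/eqP: pE; rewrite (bigD1 i).
rewrite mulNr divff ?T0 // => -[/eqP|[_]]; first by rewrite oppr_eq0 oner_eq0.
by rewrite invrN invr1; case; exact: ON.
Qed.

Lemma place_of_valuation_ring : exists P : closed_point X, 0 < ord P a.
Proof.
have [m hm] := finite_over na.
have Ua z : U (a ^ z) -> z = 0.
  have Uan n : ~ U (a ^+ n.+1).
    move=> [_ Oan]; apply: Oa; have -> : a^-1 = a ^+ n * (a ^+ n.+1)^-1.
      by rewrite exprS invfM mulrCA divff ?mulr1 ?expf_neq0.
    by apply: OM => //; exact: OX.
  case: z => [[|n]|n] // Uz; first by case: (Uan n).
  by case: (Uan n); rewrite -[_ ^+ _]invrK; apply: UV; rewrite NegzE -exprnN in Uz.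
have M0 : (0 < m`!)%N by rewrite fact_gt0.
(* The exponent [l] of [power_unit] varies with [x] but is at most [m], so it divides m!. The
   exponent of [a] belonging to x^(m!) is then an integer-valued valuation. *)
have ex x : exists z : int, x != 0 -> U (x ^+ m`! / a ^ z).
  have [->|x0] := eqVneq x 0; first by exists 0.
  have [l /andP[l0 lm] [z Uz]] := power_unit hm x0.
  exists (z * (m`! %/ l)%N) => _; have := UX (m`! %/ l)%N Uz.
  rewrite exprMn -exprM mulnC divnK; last by rewrite dvdn_fact // l0.
  by rewrite exprVn exprnP -exprz_exp.
have /choice[o' o'P] := ex.
pose o x := if x == 0 then 0 else o' x.
have oP x : x != 0 -> U (x ^+ m`! / a ^ (o x)) by move=> x0; rewrite /o (negPf x0); exact: o'P.
have o_uniq x z : x != 0 -> U (x ^+ m`! / a ^ z) -> o x = z.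
  move=> x0 Uz; have := UM Uz (UV (oP x x0)); rewrite invf_div.
  rewrite mulrC mulrA divfK ?expf_neq0 // => Uzo.
  have /Ua/eqP : U (a ^ (o x - z)) by rewrite expfzDr // -invr_expz.
  by rewrite subr_eq0 => /eqP.
have oM u v : u != 0 -> v != 0 -> o (u * v) = o u + o v.
  move=> u0 v0; apply: o_uniq; first by rewrite mulf_neq0.
  by rewrite exprMn expfzDr // invfM mulrACA; apply: UM; exact: oP.
have oU x : x != 0 -> U x -> o x = 0.
  by move=> x0 Ux; apply: o_uniq => //; rewrite expr0z divr1; exact: UX.
have oa : o a = m`!.
  by apply: o_uniq => //; rewrite -exprnP divff ?expf_neq0 //; split; rewrite ?invr1.
have o_ge0 x : x != 0 -> O x -> 0 <= o x.
  move=> x0 Ox; rewrite leNgt; apply/negP => ox; apply: Oa.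
  have [_] := oP x x0; rewrite invf_div.
  case: (o x) ox => // n _ On.
  have -> : a^-1 = a ^+ n * x ^+ m`! * (a ^ (Negz n) / x ^+ m`!).
    rewrite NegzE -exprnN exprS; field.
    by rewrite a0 !expf_neq0.
  by apply: OM => //; apply: OM; exact: OX.
have oD u v : u != 0 -> v != 0 -> u + v != 0 -> Num.min (o u) (o v) <= o (u + v).
  wlog uv : u v / O (u / v) => [wl u0 v0 uv0|u0 v0 uv0].
    have [uv|vu] := valuation_ring (u / v); first exact: wl.
    by rewrite minC addrC; apply: wl; rewrite // 1?addrC // -invf_div.
  rewrite ge_min; apply/orP; right.
  have -> : u + v = (1 + u / v) * v by field.
  have w0 : 1 + u / v != 0.
    by apply: contraNneq uv0 => w0; rewrite -(divfK v0 u) -[X in _ + X]mul1r -mulrDl addrC w0 mul0r.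
  by rewrite oM // lerDr o_ge0 //; exact: OD.
have oC c : o (const X c) = 0.
  have [->|c0] := eqVneq c 0; first by rewrite rmorph0 /o eqxx.
  by apply: oU; rewrite ?fmorph_eq0 //; split; rewrite -?fmorphV; exact: OC.
have o0 : o 0 = 0 by rewrite /o eqxx.
have [|P [e [e0 oE]]] := normalize_valuation o0 oM oD oC.
  by exists a; rewrite oa -lt0n.
exists P; have : 0 < o a by rewrite oa ltz_nat.
by rewrite oE pmulrn_lgt0.
Qed.

End ValuationRing.

Theorem zero_exists : exists P : closed_point X, 0 < ord P a.
Proof.
have [O [Oring R0O Oa Omax]] := chevalley_maximal.
exact: place_of_valuation_ring Oring R0O Oa Omax.
Qed.

End Places.

(** * Weak approximation and fibres *)

Section WeakApproximation.
Variables (k : fieldType) (X : curve k).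
Implicit Types (P Q : closed_point X) (s : seq (closed_point X)).

Lemma closed_point_ext P Q : ord P =1 ord Q -> P = Q.
Proof.
case: P Q => [o h1 h2 h3 h4 h5] [o' h1' h2' h3' h4' h5'] /= /funext oo'.
by case: _ / oo' in h1' h2' h3' h4' h5' *; congr ClosedPoint; exact: Prop_irrelevance.
Qed.

(** Units at [P] are units at [Q], so [ord Q] is a multiple of [ord P], and both are normalized. *)
Lemma place_maximal P Q : (forall u, vge P 0 u -> vge Q 0 u) -> P = Q.
Proof.
move=> PQ; have [w w0 w1] := ord_unif P.
have units u : u != 0 -> ord P u = 0 -> ord Q u = 0.
  move=> u0 ou; apply/eqP; rewrite eq_le -oppr_ge0 -ordV -!vgeE ?invr_eq0 //.
  by rewrite !PQ // vgeE ?invr_eq0 // ?ordV ou ?oppr0.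
have oQ u : u != 0 -> ord Q u = ord Q w * ord P u.
  move=> u0; have := units (u / w ^ (ord P u)).
  rewrite mulf_neq0 ?invr_eq0 ?expfz_neq0 // !ord_div ?expfz_neq0 //.
  rewrite !ordXz // w1 mul1r subrr => /(_ isT erefl)/eqP.
  by rewrite subr_eq0 => /eqP.
have w_ge0 : 0 <= ord Q w by rewrite -vgeE // PQ // vgeE ?w1.
have w_1 : ord Q w = 1.
  have [v v0 v1] := ord_unif Q; have := oQ v v0; rewrite v1.
  move=> wv; have : (ord Q w %| 1)%Z by apply/dvdzP; exists (ord P v); rewrite mulrC.
  by rewrite dvdz1 => /eqP e1; rewrite -(ger0_norm w_ge0) -abszE e1.
apply: closed_point_ext => u; have [->|u0] := eqVneq u 0; first by rewrite !ord_zero.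
by rewrite oQ // w_1 mul1r.
Qed.

Lemma separate_two P Q : P != Q ->
  exists u, [/\ u != 0, 0 < ord P u & ord Q u < 0].
Proof.
have one P' Q' : P' != Q' -> exists u, [/\ u != 0, 0 <= ord P' u & ord Q' u < 0].
  move=> PQ; have : ~ forall u, vge P' 0 u -> vge Q' 0 u.
    by move=> /place_maximal PQE; rewrite PQE eqxx in PQ.
  move=> /existsNP[u /not_implyP[Pu /negP]].
  rewrite /vge negb_or -ltNge => /andP[u0 Qu]; exists u; split=> //.
  by rewrite -vgeE.
move=> PQ; have [u [u0 Pu Qu]] := one P Q PQ.
have [v [v0 Qv Pv]] : exists v, [/\ v != 0, 0 <= ord Q v & ord P v < 0].
  by apply: one; rewrite eq_sym.
exists (u / v); rewrite mulf_neq0 ?invr_eq0 // !ord_div //; split=> //; lia.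
Qed.

Lemma separate_list P s : P \notin s ->
  exists u, [/\ u != 0, 0 < ord P u & forall Q, Q \in s -> ord Q u < 0].
Proof.
elim: s => [_|Q s IH].
  have [u u0 u1] := ord_unif P; by exists u; rewrite u1.
rewrite inE negb_or => /andP[PQ /IH[u [u0 Pu su]]].
have [Qu|Qu] := ltP (ord Q u) 0.
  by exists u; split=> // Q'; rewrite inE => /orP[/eqP ->//|/su].
have [v [v0 Pv Qv]] := separate_two PQ.
(* [r] exceeds every |ord u| on [s]: where [v] has a pole, v^r dominates [u], and elsewhere on [s]
   the pole of [u] survives. *)
pose r := (1 + \sum_(Q' <- s) `|ord Q' u|)%N.
have r_gt Q' : Q' \in s -> (`|ord Q' u| < r)%N.
  by move=> Q's; rewrite /r add1n ltnS (big_rem Q') //= leq_addr.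
have vr0 : v ^+ r != 0 by rewrite expf_neq0.
have dom Q' : Q' \in Q :: s -> u + v ^+ r != 0 /\ ord Q' (u + v ^+ r) < 0.
  rewrite inE => /orP[/eqP ->|Q's].
    have vr : ord Q v *+ r < 0.
      by rewrite -mulr_natr natz /r; nia.
    rewrite addrC; have [||-> ->] := @ord_dominant _ _ Q (v ^+ r) u => //.
      by rewrite vgeE // ordX //; lia.
    by rewrite ordX.
  have := su _ Q's; have := r_gt _ Q's.
  have [vQ|vQ] := leP 0 (ord Q' v).
    move=> _ uQ; have [||-> ->] := @ord_dominant _ _ Q' u (v ^+ r) => //.
    by rewrite vgeE // ordX // (le_trans _ (mulrn_wge0 _ vQ)) // lezD1.
  move=> ru uQ; rewrite addrC.
  have vr : ord Q' v *+ r < ord Q' u by rewrite -mulr_natr natz; nia.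
  have [||-> ->] := @ord_dominant _ _ Q' (v ^+ r) u => //.
    by rewrite vgeE // ordX // lezD1.
  by rewrite ordX // (lt_trans vr).
exists (u + v ^+ r); split.
- by have [] := dom Q (mem_head _ _).
- have [uv0 _] := dom Q (mem_head _ _); rewrite -lezD1 add0r.
  by rewrite -vgeE //; apply: vgeD; rewrite vgeE // ordX // /r -mulr_natr natz; nia.
- by move=> Q' /dom[].
Qed.

(** If [w] vanishes at [P] and has poles along [s], then 1/(1 + w^M) is close to 1 at [P] and close
    to 0 on [s]. *)
Lemma approx_one P s (N : nat) : P \notin s ->
  exists u, vge P N (u - 1) /\ forall Q, Q \in s -> vge Q N u.
Proof.
move=> /separate_list[w [w0 Pw sw]]; pose M := N.+1.
have wM0 : w ^+ M != 0 by rewrite expf_neq0.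
have [w1 Pw1] : 1 + w ^+ M != 0 /\ ord P (1 + w ^+ M) = 0.
  rewrite -[X in _ = X](ord_one P); apply: ord_dominant; first exact: oner_neq0.
  by rewrite ord_one add0r vgeE // ordX // -mulr_natr natz /M; nia.
exists (1 + w ^+ M)^-1; split.
  have -> : (1 + w ^+ M)^-1 - 1 = - (w ^+ M / (1 + w ^+ M)) by field.
  rewrite vgeN vgeE ?mulf_neq0 ?invr_eq0 // ord_div // Pw1 subr0 ordX //.
  by rewrite -mulr_natr natz /M; nia.
move=> Q /sw Qw; rewrite vgeE ?invr_eq0 // ordV.
have Qw' : ord Q w *+ M <= - N.+1%:Z by rewrite -mulr_natr natz /M; nia.
rewrite addrC; have [||_ ->] := @ord_dominant _ _ Q (w ^+ M) 1 => //.
  by rewrite vgeE ?oner_neq0 // ordX // ord_one; lia.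
by rewrite ordX //; lia.
Qed.

Lemma weak_approximation s (f : closed_point X -> X) (N : int) : uniq s ->
  exists u, forall P, P \in s -> vge P N (u - f P).
Proof.
(* [M] compensates the poles of every [f Q] at all points of [s]. *)
move=> us; pose M := (`|N| + \sum_(P <- s) \sum_(Q <- s) `|ord P (f Q)|)%N.
have M_ge P Q : P \in s -> Q \in s -> N <= M%:Z + ord P (f Q).
  move=> Ps Qs; have : (`|N| + `|ord P (f Q)| <= M)%N.
    by rewrite /M leq_add2l (big_rem P) //= (big_rem Q) //= -addnA leq_addr.
  lia.
have /choice[e eP] : forall P, exists e, P \in s ->
    vge P M (e - 1) /\ forall Q, Q \in s -> Q != P -> vge Q M e.
  move=> P; have : P \notin rem P s by rewrite mem_rem_uniqF.
  move=> /(approx_one M)[e [e1 es]]; exists e => Ps; split=> // Q Qs QP.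
  by apply: es; rewrite mem_rem_uniq // inE QP.
exists (\sum_(P <- s) e P * f P) => P Ps.
rewrite (bigD1_seq P) //= addrAC -[X in _ - X]mul1r -mulrBl.
apply: vgeD.
  apply: (vgeW (M_ge P P Ps Ps)); apply: vgeM; last exact: vge_ord.
  by have [] := eP P Ps.
rewrite big_seq_cond; apply: vge_sum => Q /andP[Qs QP].
apply: (vgeW (M_ge P Q Ps Qs)); apply: vgeM; last exact: vge_ord.
by have [_] := eP Q Qs; apply; rewrite // eq_sym.
Qed.

Lemma weak_approximation_ord s (n : closed_point X -> int) : uniq s ->
  exists u, u != 0 /\ forall P, P \in s -> ord P u = n P.
Proof.
move=> us; have /choice[w wP] : forall P, exists w, w != 0 /\ ord P w = n P.
  move=> P; have [v v0 v1] := ord_unif P; exists (v ^ n P).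
  by rewrite expfz_neq0 // ordXz // v1 mul1r.
pose N := (\sum_(P <- s) `|n P|).+1.
have [u uP] := @weak_approximation s w N us.
have uE P : P \in s -> u != 0 /\ ord P u = n P.
  move=> Ps; have [w0 ow] := wP P; rewrite -(subrK (w P) u) addrC -ow.
  apply: ord_dominant => //; apply: vgeW (uP P Ps); rewrite ow /N.
  have : (`|n P| <= \sum_(P <- s) `|n P|)%N by rewrite (big_rem P) //= leq_addr.
  lia.
case: s us uE {uP N} => [_ _|P s us uE].
  by exists 1; rewrite oner_neq0.
by exists u; split=> [|Q /uE[]//]; have [] := uE P (mem_head _ _).
Qed.

End WeakApproximation.

Section Fibers.
Variables (k : closedFieldType) (X : curve k).
Implicit Types (P Q : closed_point X) (s t u : X) (p : {poly k}).

Lemma ord_evalp_factor t p : nonconst t -> p != 0 ->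
  exists2 rs : seq k, size rs = (size p).-1 &
    forall P, ord P (evalp (const X) p t) = \sum_(r <- rs) ord P (t - const X r).
Proof.
move=> nt p0; have [rs pE] := closed_field_poly_normal p.
exists rs; first by rewrite pE size_scale ?lead_coef_eq0 // size_prod_XsubC.
move=> P; rewrite pE evalpZ ordM.
- rewrite ord_const add0r evalp_prod ord_prod => [|r _].
    by apply: eq_bigr => r _; rewrite evalpXsubC.
  by rewrite evalpXsubC nonconst_subC.
- by rewrite fmorph_eq0 lead_coef_eq0.
- rewrite evalp_neq0 // prodf_seq_neq0; apply/allP => r _ /=.
  by rewrite polyXsubC_eq0.
Qed.

(* s is a local parameter at a point of P^1, seen in k(t); the zeros of s are
   the points of X above it. *)
Definition local_param t s : Prop := [/\ nonconst s, s \in adjoin_pred t &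
  forall a : ratK t, a != 0 -> exists n : int,
    forall P, 0 < ord P s -> ord P (rat_emb t a) = ord P s * n].

Lemma ord_evalp_zero t c p : nonconst t -> p != 0 -> exists n : nat,
  forall P, 0 < ord P (t - const X c) ->
    ord P (evalp (const X) p t) = ord P (t - const X c) * n.
Proof.
move=> nt p0; have [rs _ rsE] := ord_evalp_factor nt p0.
exists (count (pred1 c) rs) => P Pc; rewrite rsE.
elim: rs {rsE} => [|r rs IH]; first by rewrite big_nil mulr0.
rewrite big_cons IH /= PoszD mulrDr; congr (_ + _).
have [->|rc] := eqVneq r c; first by rewrite mulr1.
rewrite mulr0; have -> : t - const X r = const X (c - r) + (t - const X c).
  by rewrite rmorphB; ring.
rewrite -[RHS](ord_const P (c - r)); apply: (proj2 (ord_dominant _ _)).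
  by rewrite fmorph_eq0 subr_eq0 eq_sym.
by rewrite ord_const add0r vgeE ?nonconst_subC.
Qed.

Lemma ord_evalp_pole t p P : nonconst t -> p != 0 -> ord P t < 0 ->
  ord P (evalp (const X) p t) = ord P t * (size p).-1.
Proof.
move=> nt p0 Pt; have [rs <- ->] := ord_evalp_factor nt p0.
elim: rs => [|r rs IH]; first by rewrite big_nil mulr0.
rewrite big_cons IH /= -add1n PoszD mulrDr mulr1; congr (_ + _).
have [||] := @ord_dominant _ _ P t (- const X r) => //.
  exact: nonconst_neq0.
by rewrite vgeN; apply: vgeW (vge_const P r); lia.
Qed.

Lemma nonconstB t c : nonconst t -> nonconst (t - const X c).
Proof.
by move=> nt [d _ tE]; apply: nt; exists (d + c) => //; rewrite rmorphD tE subrK.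
Qed.

Lemma nonconstV t : nonconst t -> nonconst t^-1.
Proof.
by move=> nt [d _ tE]; apply: nt; exists d^-1 => //; rewrite fmorphV tE invrK.
Qed.

Lemma local_paramB t c : nonconst t -> local_param t (t - const X c).
Proof.
move=> nt; split; first exact: nonconstB.
  by rewrite -evalpXsubC adjoin_evalp.
move=> a a0; have [p [q [q0 aE]]] := ratP a.
have p0 : evalp (const X) p t != 0.
  by apply: contraNneq a0 => p0; rewrite -(fmorph_eq0 (rat_emb t)) aE p0 mul0r.
have nz r : evalp (const X) r t != 0 -> r != 0.
  by apply: contraNneq => ->; rewrite evalp0.
have [m pm] := ord_evalp_zero c nt (nz _ p0).
have [m' qm] := ord_evalp_zero c nt (nz _ q0).
exists (m%:Z - m'%:Z) => P Pc.
by rewrite aE ord_div // pm // qm // mulrBr.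
Qed.

Lemma local_param_id t : nonconst t -> local_param t t.
Proof. by move=> nt; rewrite -{2}[t]subr0 -(rmorph0 (const X)); exact: local_paramB. Qed.

Lemma local_paramV t : nonconst t -> local_param t t^-1.
Proof.
move=> nt; split; first exact: nonconstV.
  apply/adjoin_predP; exists 1, 'X.
  by rewrite evalp1 evalpX div1r nonconst_neq0.
move=> a a0; have [p [q [q0 aE]]] := ratP a.
have p0 : evalp (const X) p t != 0.
  by apply: contraNneq a0 => p0; rewrite -(fmorph_eq0 (rat_emb t)) aE p0 mul0r.
have nz r : evalp (const X) r t != 0 -> r != 0.
  by apply: contraNneq => ->; rewrite evalp0.
exists ((size q).-1%:Z - (size p).-1%:Z) => P; rewrite ordV oppr_gt0 => Pt.
rewrite aE ord_div // !ord_evalp_pole // ?nz //; ring.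
Qed.

(** The inequality between ramification indices and degree. For 0 <= j < e_i, with e_i the order of
    [s] at P_i, take a function of order j at P_i and of order e_l at each other P_l; these
    functions are independent over k(t). *)
Lemma fiber_bound t s m (S : seq (closed_point X)) :
  local_param t s -> has_dim (rat_emb t) setT m -> uniq S ->
  (forall P, P \in S -> 0 < ord P s) ->
  (\sum_(P <- S) `|ord P s| <= m)%N.
Proof.
move=> [ns _ sK] hm uS S0.
pose Pt (i : 'I_(size S)) := tnth (in_tuple S) i.
have PtS i : Pt i \in S by apply: mem_tnth.
have Pt_inj i l : l != i -> Pt l != Pt i.
  apply: contraNneq => /eqP; rewrite /Pt !(tnth_nth (Pt i)) nth_uniq //.
have -> : (\sum_(P <- S) `|ord P s| = \sum_i `|ord (Pt i) s|)%N.
  by rewrite big_tnth.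
pose J i := 'I_(`|ord (Pt i) s|%N).
have J_inj (a b : {i & J i}) :
    tag a = tag b -> val (tagged a) = val (tagged b) -> a = b.
  case: a b => [i j] [l j'] /= il; case: l / il in j' *.
  by move=> /val_inj ->.
have /choice[w wP] : forall ij : {i & J i}, exists w : X,
    [/\ w != 0, ord (Pt (tag ij)) w = val (tagged ij) &
        forall l, l != tag ij -> ord (Pt l) w = ord (Pt l) s].
  move=> [i j] /=.
  have [w [w0 wP]] := weak_approximation_ord
    (fun P => if P == Pt i then (val j)%:Z else ord P s) uS.
  exists w; rewrite wP // eqxx; split=> // l li.
  by rewrite wP // (negPf (Pt_inj _ _ li)).
have -> : (\sum_i `|ord (Pt i) s| = #|{: {i & J i}}|)%N.
  by rewrite card_tagged sumnE big_map big_enum; apply: eq_bigr => i _; rewrite card_ord.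
apply: (has_dim_free (b := w) hm) => // c cE ij0; apply/eqP; apply: contraT => c0.
have /choice[n nP] : forall ij, exists n : int, c ij != 0 ->
    forall P, 0 < ord P s -> ord P (rat_emb t (c ij)) = ord P s * n.
  move=> ij; have [->|cij] := eqVneq (c ij) 0; first by exists 0.
  by have [n nP] := sK _ cij; exists n.
(* [i1] has a coefficient of least valuation. At its point [Pt i] only the terms attached to [i] can
   have least order, since the functions attached to other points vanish there to the full order of
   [s]. *)
have [i1 ci1 min1] := @Order.TotalTheory.arg_minP _ _ _ ij0 (fun ij => c ij != 0) n c0.
pose i := tag i1; have e0 : 0 < ord (Pt i) s by apply: S0.
have [i2 /andP[ci2 /eqP ii2] min2] := @Order.TotalTheory.arg_minP _ _ _ i1
  (fun ij => (c ij != 0) && (tag ij == i))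
  (fun ij => ord (Pt i) s * n ij + (val (tagged ij))%:Z)
  (introT andP (conj ci1 (eqxx _))).
pose T ij := rat_emb t (c ij) * w ij.
have T0 ij : c ij != 0 -> T ij != 0.
  by move=> cij; have [w0 _ _] := wP ij; rewrite mulf_neq0 ?fmorph_eq0.
have oT ij : c ij != 0 -> ord (Pt i) (T ij) = ord (Pt i) s * n ij + ord (Pt i) (w ij).
  by move=> cij; have [w0 _ _] := wP ij; rewrite ordM ?fmorph_eq0 // nP.
have oT2 : ord (Pt i) (T i2) = ord (Pt i) s * n i2 + (val (tagged i2))%:Z.
  by rewrite oT // -ii2; have [_ -> _] := wP i2.
have [||] := @vge_sum_lt _ _ (Pt i) _ T i2; last by rewrite cE eqxx.
  exact: T0.
move=> ij neq; have [cij|cij] := eqVneq (c ij) 0.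
  by rewrite /T cij rmorph0 mul0r vge0.
rewrite vgeE ?T0 // oT2 oT // lezD1.
(* Terms attached to the same point have orders e n + j with 0 <= j < e, so equal orders force equal
   j and thus the same index. *)
have [eq|neqi] := eqVneq (tag ij) i.
  have -> : ord (Pt i) (w ij) = val (tagged ij) by rewrite -eq; have [_ -> _] := wP ij.
  rewrite lt_neqAle min2 ?cij ?eq ?eqxx // andbT; apply: contraNneq neq => E.
  have b1 : (val (tagged ij) < `|ord (Pt i) s|)%N by rewrite -eq; exact: ltn_ord.
  have b2 : (val (tagged i2) < `|ord (Pt i) s|)%N by rewrite -ii2; exact: ltn_ord.
  have Ev : val (tagged ij) = val (tagged i2).
    move: E b1 b2 e0; move: (ord _ _) (n ij) (n i2) (val _) (val _) => a b d x y.
    move=> E xa ya a0; suff bd : b = d by move: E; rewrite bd; lia.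
    apply/eqP; rewrite eq_le; apply/andP; split; rewrite leNgt; apply/negP => lt.
      have : 0 <= a * (b - d - 1) by apply: mulr_ge0; lia.
      by rewrite !mulrBr; lia.
    have : 0 <= a * (d - b - 1) by apply: mulr_ge0; lia.
    by rewrite !mulrBr; lia.
  by apply/eqP/J_inj; rewrite ?eq.
have -> : ord (Pt i) (w ij) = ord (Pt i) s.
  by have [_ _ ->] := wP ij; rewrite // eq_sym.
have b1 := min2 i1; rewrite ci1 eqxx in b1; have {}b1 := b1 isT.
apply: (le_lt_trans b1 _).
have b2 : (val (tagged i1) < `|ord (Pt i) s|)%N by exact: ltn_ord.
have b3 := min1 _ cij.
move: b2 b3 e0; move: (ord _ _) (n _) (n _) (val _) => a b d x.
nia.
Qed.

Lemma finite_of_bound (T : eqType) (A : T -> Prop) (m : nat) :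
  (forall S : seq T, uniq S -> (forall x, x \in S -> A x) -> (size S <= m)%N) ->
  exists2 S : seq T, uniq S & forall x, x \in S <-> A x.
Proof.
move=> bound; pose P n := `[< exists S : seq T,
  [/\ uniq S, forall x, x \in S -> A x & size S = n] >].
have P0 : exists n, P n by exists 0%N; apply/asboolP; exists [::].
have Pm n : P n -> (n <= m)%N by move=> /asboolP[S [uS SA <-]]; exact: bound.
case: (ex_maxnP P0 Pm) => n /asboolP[S [uS SA szS]] max.
exists S => // x; split=> [|Ax]; first exact: SA.
apply: contraT => xS; suff /max : P n.+1 by rewrite ltnn.
apply/asboolP; exists (x :: S); rewrite /= xS uS szS; split=> // y.
by rewrite inE => /orP[/eqP ->//|/SA].
Qed.

Lemma finite_zeros s : nonconst s ->
  exists2 S : seq (closed_point X), uniq S & forall P, (P \in S) = (0 < ord P s).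
Proof.
move=> ns; have [m hm] := finite_over ns.
have [S uS|S uS SP] := @finite_of_bound _ (fun P => 0 < ord P s) m.
  move=> S0; apply: leq_trans (fiber_bound (local_param_id ns) hm uS S0).
  rewrite -sum1_size big_seq [leqRHS]big_seq; apply: leq_sum => P /S0.
  by lia.
by exists S => // P; apply/idP/idP => [/(iffLR (SP P))|/(iffRL (SP P))].
Qed.

Lemma divisor_exists u : u != 0 -> exists D : divisor X, is_div u D.
Proof.
move=> u0; have [[c _ uc]|nu] := pselect (range (const X) u).
  by exists 0 => P; rewrite coeff0 -uc ord_const.
have [S uS SP] := finite_zeros nu.
have [S' uS' S'P] := finite_zeros (nonconstV nu).
exists (\sum_(P <- S ++ S') << ord P u *g P >>) => P.
rewrite raddf_sum /=.
have SS' : uniq (S ++ S').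
  rewrite cat_uniq uS uS' andbT /=; apply/hasPn => Q; rewrite S'P ordV /= SP.
  by rewrite -leNgt oppr_gt0 => /ltW.
have [PS|PS] := boolP (P \in S ++ S').
  rewrite (bigD1_seq P) //= coeffU eqxx mulr1 big1 ?addr0 // => Q /negPf QP.
  by rewrite coeffU QP mulr0.
rewrite big_seq big1 => [|Q QS]; last first.
  by rewrite coeffU; case: eqP => [QP|]; rewrite ?mulr0 //; rewrite -QP QS in PS.
move: PS; rewrite mem_cat SP S'P ordV oppr_gt0 negb_or -!leNgt.
by move=> /le_anti ->.
Qed.

End Fibers.

Section Divisors.
Variables (k : closedFieldType) (X : curve k).
Implicit Types (P Q : closed_point X) (u t : X) (D E : divisor X).

(** The value 0 at u = 0 matches the convention [ord P 0 = 0], so that [coeff_dvs] holds for every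
    [u]. *)
Definition dvs u : divisor X :=
  if pselect (u != 0) is left u0 then sval (cid (divisor_exists u0)) else 0.

Lemma coeff_dvs u P : coeff P (dvs u) = ord P u.
Proof.
rewrite /dvs; case: pselect => [u0|]; first by case: cid => D /= ->.
by move=> /negP; rewrite negbK => /eqP ->; rewrite ord_zero coeff0.
Qed.

(** Accordingly [zeros u^-1] is the divisor of poles of [u]. *)
Definition zeros u : divisor X := fgpos (dvs u).

Lemma coeff_zeros u P : coeff P (zeros u) = Num.max 0 (ord P u).
Proof. by rewrite coeff_fgposE coeff_dvs. Qed.

Lemma divisor_eqP D E : (forall P, coeff P D = coeff P E) -> D = E.
Proof. by move=> DE; apply/eqP/freeg_eqP. Qed.

Lemma dvs_zeros u : dvs u = zeros u - zeros u^-1.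
Proof.
by apply: divisor_eqP => P; rewrite coeffB !coeff_zeros coeff_dvs ordV; lia.
Qed.

Lemma zeros_seq u (S : seq (closed_point X)) : uniq S ->
  (forall P, (P \in S) = (0 < ord P u)) ->
  zeros u = \sum_(P <- S) << `|ord P u|%N%:Z *g P >>.
Proof.
move=> uS SP; apply: divisor_eqP => P; rewrite coeff_zeros raddf_sum /=.
have [PS|PS] := boolP (P \in S).
  rewrite (bigD1_seq P) //= coeffU eqxx mulr1 big1 ?addr0 => [|Q /negPf QP].
    by move: PS; rewrite SP; lia.
  by rewrite coeffU QP mulr0.
rewrite big_seq big1 => [|Q QS]; last first.
  by rewrite coeffU; case: eqP => [QP|]; rewrite ?mulr0 //; rewrite -QP QS in PS.
by move: PS; rewrite SP; lia.
Qed.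

Lemma deg_zeros_le t s m : local_param t s -> has_dim (rat_emb t) setT m ->
  deg (zeros s) <= m%:Z.
Proof.
move=> ps hm; have [ns _ _] := ps; have [S uS SP] := finite_zeros ns.
rewrite (zeros_seq uS SP) raddf_sum /=.
under eq_bigr => P _ do rewrite degU.
have := @fiber_bound _ X t s m S ps hm uS.
rewrite -(big_morph Posz PoszD (erefl _)) lez_nat; apply=> P.
by rewrite SP.
Qed.

End Divisors.

(** * Riemann-Roch spaces *)

Section Sections.
Variables (k : closedFieldType) (X : curve k).
Implicit Types (P Q : closed_point X) (u t : X) (D E : divisor X).

Lemma sectionsP D u : sections D u <-> forall P, vge P (- coeff P D) u.
Proof.
split=> [[->|Du] P|Du]; first exact: vge0.
  by apply/orP; right; have := Du P; lia.
have [->|u0] := eqVneq u 0; [by left|right=> P].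
by have := Du P; rewrite vgeE //; lia.
Qed.

Lemma sections_lsub D : lsub (const X) (sections D).
Proof.
split=> [|u v /sectionsP Du /sectionsP Dv|c u /sectionsP Du]; first by left.
  by apply/sectionsP => P; apply: vgeD.
by apply/sectionsP => P; apply: vgeZ.
Qed.

Lemma sections_le D E : (forall P, coeff P D <= coeff P E) ->
  sections D `<=` sections E.
Proof.
move=> DE u /sectionsP Du; apply/sectionsP => P; apply: vgeW (Du P).
by rewrite lerN2.
Qed.

Lemma coeff_pt P Q : coeff P (<< Q >> : divisor X) = (Q == P)%:R.
Proof. by rewrite coeffU mul1r. Qed.

(** A section of D + P that is not one of D has exact order - coeff P D - 1 at [P], and two of those
    have proportional leading terms because the residue field is k. *)
Lemma sections_addpt D P m : has_dim (const X) (sections D) m ->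
  exists2 m', has_dim (const X) (sections (D + << P >>)) m' & (m <= m' <= m.+1)%N.
Proof.
move=> hm; apply: has_dim_codim1 hm _; try exact: sections_lsub.
  by apply: sections_le => Q; rewrite coeffD coeff_pt lerDl ler0n.
have at_P u : sections (D + << P >>) u -> vge P (- coeff P D) u -> sections D u.
  move=> /sectionsP Du uP; apply/sectionsP => Q; have [->//|QP] := eqVneq Q P.
  by have := Du Q; rewrite coeffD coeff_pt eq_sym (negPf QP) addr0.
have ge_P u : sections (D + << P >>) u -> vge P (- coeff P D - 1) u.
  by move=> /sectionsP/(_ P); rewrite coeffD coeff_pt eqxx opprD.
move=> w w' Dw Dw' nDw'.
have w'0 : w' != 0 by apply/eqP => w'0; apply: nDw'; rewrite w'0; left.
have nw' : ~~ vge P (- coeff P D) w' by apply/negP => ?; apply: nDw'; exact: at_P.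
have ow' : ord P w' = - coeff P D - 1.
  by apply: ord_eqP => //; rewrite ?ge_P // subrK.
have [wP|nw] := boolP (vge P (- coeff P D) w).
  by exists 0; rewrite rmorph0 mul0r subr0; exact: at_P.
have w0 : w != 0 by apply: contraNneq nw => ->; rewrite vge0.
have ow : ord P w = - coeff P D - 1.
  by apply: ord_eqP => //; rewrite ?ge_P // subrK.
have [c _ cP] := residue_ratio w0 w'0 (etrans ow (esym ow')).
exists c; apply: at_P; last by rewrite ow' subrK in cP.
by apply: (lsub_sub (sections_lsub _)) => //; have [_ _] := sections_lsub (D + << P >>); apply.
Qed.

(** A nonconstant [u] has a pole, namely a zero of [u^-1]. *)
Lemma sections0_const u : sections 0 u -> range (const X) u.
Proof.
move=> /sectionsP uP; apply: contrapT => nu.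
have [P] := zero_exists (nonconstV nu); have := uP P.
rewrite coeff0 oppr0 vgeE ?nonconst_neq0 // ordV; lia.
Qed.

Lemma sections0_dim : has_dim (const X) (sections 0) 1.
Proof.
exists (fun=> 1); split=> [_|c|u /sections0_const[c _ <-]].
- by apply/sectionsP => P; rewrite coeff0 oppr0 vge1.
- rewrite big_ord1 mulr1 => /eqP; rewrite fmorph_eq0 => /eqP c0 i.
  by rewrite ord1.
- by exists (fun=> c); rewrite big_ord1 mulr1.
Qed.

Lemma divisor_ind (Q : divisor X -> Prop) : Q 0 ->
  (forall D P, Q D -> Q (D + << P >>)) -> (forall D P, Q D -> Q (D - << P >>)) ->
  forall D, Q D.
Proof.
move=> Q0 Qadd Qsub; apply: freeg_ind_dom0 => // c P D _ _ QD.
have mulS n : (<< n.+1%:Z *g P >> : divisor X) = << n%:Z *g P >> + << P >>.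
  by rewrite freegUD -addn1 PoszD.
have Qn n : Q (<< n%:Z *g P >> + D) /\ Q (- << n%:Z *g P >> + D).
  elim: n => [|n [IH1 IH2]]; first by rewrite freegU0 oppr0 add0r.
  by rewrite mulS opprD ![_ + _ + D]addrAC; split; [exact: Qadd|exact: Qsub].
case: c => n; first by have [] := Qn n.
by have [_] := Qn n.+1; rewrite freegUN NegzE.
Qed.

Lemma sections_finite D : exists m, has_dim (const X) (sections D) m.
Proof.
elim/divisor_ind: D => [|D P [m hm]|D P [m hm]].
- by exists 1%N; exact: sections0_dim.
- by have [m' hm' _] := sections_addpt P hm; exists m'.
- have sub : sections (D - << P >>) `<=` sections D.
    by apply: sections_le => Q; rewrite coeffB coeff_pt gerBl ler0n.
  by have [m' _ hm'] := has_dim_sub sub hm; exists m'.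
Qed.

Definition ell D : nat := sval (cid (sections_finite D)).

Lemma ell_dim D : has_dim (const X) (sections D) (ell D).
Proof. exact: svalP (cid (sections_finite D)). Qed.

Lemma ell_eq D m : has_dim (const X) (sections D) m -> ell D = m.
Proof. exact: has_dim_uniq (ell_dim D). Qed.

Lemma ell0 : ell 0 = 1%N.
Proof. exact/ell_eq/sections0_dim. Qed.

Lemma ell_addpt D P : (ell D <= ell (D + << P >>)%R <= (ell D).+1)%N.
Proof. by have [m /ell_eq ->] := sections_addpt P (ell_dim D). Qed.

Lemma ell_gt0 D : (0 < ell D)%N <-> exists2 u, u != 0 & sections D u.
Proof.
have [b [Db fb gb]] := ell_dim D; split=> [D0|[u u0 Du]].
  exists (b (Ordinal D0)) => //; apply/eqP => b0.
  have bE : \sum_i const X (i == Ordinal D0)%:R * b i = 0.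
    rewrite (bigD1 (Ordinal D0)) //= b0 mulr0 add0r big1 // => i /negPf ->.
    by rewrite rmorph0 mul0r.
  by have /eqP := fb _ bE (Ordinal D0); rewrite eqxx oner_eq0.
rewrite lt0n; apply: contra_neq u0 => D0; have [c ->] := gb _ Du.
by apply: big1 => i _; have := ltn_ord i; rewrite {2}D0.
Qed.

Lemma sections_dvs D v u : v != 0 -> sections (D + dvs v) u <-> sections D (u * v).
Proof.
move=> v0; split=> /sectionsP uP; apply/sectionsP => P; have := uP P.
  by rewrite coeffD coeff_dvs -[- coeff P D](subrK (ord P v)) vgeMr // opprD.
by rewrite coeffD coeff_dvs -[- coeff P D](subrK (ord P v)) vgeMr // opprD.
Qed.

Lemma ell_dvs D v : v != 0 -> ell (D + dvs v) = ell D.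
Proof.
move=> v0; apply: ell_eq; have [b [Db fb gb]] := ell_dim D.
exists (fun i => b i / v); split=> [i|c|u Du].
- by apply/sections_dvs => //; rewrite divfK.
- under eq_bigr => i _ do rewrite mulrA.
  rewrite -mulr_suml => /eqP; rewrite mulf_eq0 invr_eq0 (negPf v0) orbF => /eqP.
  exact: fb.
- have [c uv] := gb _ (iffLR (sections_dvs _ _ v0) Du).
  exists c; apply: (mulIf v0); rewrite uv mulr_suml.
  by apply: eq_bigr => i _; rewrite -mulrA divfK.
Qed.

(** Otherwise u, t u, ..., t^N u would be N + 1 independent sections of [D]. This bounds the
    successive minima from below. *)
Lemma sections_vanish t D (N : nat) u : nonconst t -> (ell D <= N)%N ->
  sections (D - N%:Z *: zeros t^-1) u -> u = 0.
Proof.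
move=> nt DN /sectionsP uP; apply/eqP; apply: contraT => u0.
have : lfree (const X) (fun i : 'I_N.+1 => t ^+ i * u).
  move=> c; under eq_bigr => i _ do rewrite mulrA.
  rewrite -mulr_suml => /eqP; rewrite mulf_eq0 (negPf u0) orbF => cE i.
  pose p := \poly_(j < N.+1) c (inord j).
  have : evalp (const X) p t == 0.
    rewrite evalp_poly; move: cE; congr (_ == 0).
    by apply: eq_bigr => j _; rewrite inord_val.
  have [p0 _|p0 pt0] := eqVneq p 0; last by have := evalp_neq0 nt p0; rewrite pt0.
  by have := congr1 (fun q : {poly k} => q`_i) p0; rewrite coef_poly ltn_ord inord_val coef0.
move=> fr; suff /(has_dim_free (ell_dim D))/(_ fr) :
    forall i : 'I_N.+1, sections D (t ^+ i * u) by rewrite card_ord ltnNge DN.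
move=> i.
apply/sectionsP => P; have := uP P; rewrite coeffB coeffZ coeff_zeros.
have t0 := nonconst_neq0 nt.
rewrite !vgeE ?mulf_neq0 ?expf_neq0 // ordM ?expf_neq0 // ordX // ordV.
have := ltn_ord i; rewrite ltnS -mulr_natr natz.
move: (ord P t) (coeff P D) (ord P u) => a d b iN.
have [a0|a0] := leP 0 a; nia.
Qed.

End Sections.

(** * Reduced bases over k(t) *)

Section ReducedBasis.
Variables (k : closedFieldType) (X : curve k) (t : X) (m : nat) (D : divisor X).
Implicit Types (p q : {poly k}) (u v : X) (P : closed_point X) (N d : int).
Hypotheses (nt : nonconst t) (hm : has_dim (rat_emb t) setT m).

Let t0 : t != 0 := nonconst_neq0 nt.
Local Notation ev p := (evalp (const X) p t).

(** Sections of O(D) over the part of X where [t] is finite. The poles of [t] are left to [inf_reg],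
    where [ord P t] is negative, so that a positive [N] permits [N] times the polar divisor in
    addition. *)
Definition fin_reg (u : X) : Prop :=
  forall P : closed_point X, 0 <= ord P t -> vge P (- coeff P D) u.

Definition inf_reg (N : int) (u : X) : Prop :=
  forall P : closed_point X, ord P t < 0 -> vge P (- coeff P D + N * ord P t) u.

Definition twist (N : int) : divisor X := D + N *: zeros t^-1.

Lemma sections_twist N u : sections (twist N) u <-> fin_reg u /\ inf_reg N u.
Proof.
have coefE P : coeff P (twist N) = coeff P D + N * Num.max 0 (- ord P t).
  by rewrite coeffD coeffZ coeff_zeros ordV.
split=> [/sectionsP uP|[uf ui]].
  split=> P Pt; have := uP P; rewrite coefE; apply: vgeW.
    by rewrite max_l ?mulr0 ?addr0 // oppr_le0.
  by rewrite max_r ?mulrN ?opprB 1?addrC // oppr_ge0 ltW.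
apply/sectionsP => P; rewrite coefE; have [Pt|Pt] := leP 0 (ord P t).
  by rewrite max_l ?oppr_le0 // mulr0 addr0; exact: uf.
rewrite max_r ?oppr_ge0 ?ltW // mulrN opprB addrC; exact: ui.
Qed.

Lemma fin_regD u v : fin_reg u -> fin_reg v -> fin_reg (u + v).
Proof. by move=> fu fv P Pt; apply: vgeD; [exact: fu|exact: fv]. Qed.

Lemma fin_regN u : fin_reg u -> fin_reg (- u).
Proof. by move=> fu P Pt; rewrite vgeN; exact: fu. Qed.

Lemma fin_reg_sum (I : Type) (r : seq I) (Q : pred I) (f : I -> X) :
  (forall i, Q i -> fin_reg (f i)) -> fin_reg (\sum_(i <- r | Q i) f i).
Proof. by move=> ff P Pt; apply: vge_sum => i Qi; exact: ff. Qed.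

Lemma fin_regM p u : fin_reg u -> fin_reg (ev p * u).
Proof.
move=> fu P Pt; rewrite -[- _]add0r; apply: vgeM; last exact: fu.
by apply: vge_evalp; rewrite vgeE.
Qed.

Lemma inf_regD N u v : inf_reg N u -> inf_reg N v -> inf_reg N (u + v).
Proof. by move=> fu fv P Pt; apply: vgeD; [exact: fu|exact: fv]. Qed.

Lemma inf_regN N u : inf_reg N u -> inf_reg N (- u).
Proof. by move=> fu P Pt; rewrite vgeN; exact: fu. Qed.

Lemma inf_reg_sum N (I : Type) (r : seq I) (Q : pred I) (f : I -> X) :
  (forall i, Q i -> inf_reg N (f i)) -> inf_reg N (\sum_(i <- r | Q i) f i).
Proof. by move=> ff P Pt; apply: vge_sum => i Qi; exact: ff. Qed.

Lemma inf_regW N N' u : N <= N' -> inf_reg N u -> inf_reg N' u.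
Proof. by move=> NN iu P Pt; apply: vgeW (iu P Pt); rewrite lerD2l ler_nM2r. Qed.

Lemma inf_regM d N a u : (forall P, ord P t < 0 -> vge P (d * ord P t) a) ->
  inf_reg N u -> inf_reg (d + N) (a * u).
Proof.
move=> ad iu P Pt; rewrite mulrDl addrCA; apply: vgeM; [exact: ad|exact: iu].
Qed.

Lemma vge_evalp_pole p P (d : int) : ord P t < 0 -> (size p)%:Z <= d + 1 ->
  vge P (d * ord P t) (ev p).
Proof.
move=> Pt pd; have [->|p0] := eqVneq p 0; first by rewrite evalp0 vge0.
rewrite vgeE ?evalp_neq0 // ord_evalp_pole // mulrC ler_nM2l //.
by move: p0; rewrite -size_poly_gt0; lia.
Qed.

Let spn (b : nat -> X) i := lspan (rat_emb t) (fun j : 'I_i => b j).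

(** Each [b j] lies outside the k(t)-span of its predecessors, and [delta j] is the least twist in
    which such an element exists. *)
Let minima_inv r (b : nat -> X) (delta : nat -> int) :=
  [/\ lfree (rat_emb t) (fun j : 'I_r => b j),
      forall j, (j < r)%N -> sections (twist (delta j)) (b j) &
      forall j N u, (j < r)%N -> sections (twist N) u -> ~ spn b j u ->
        delta j <= N].

Let spn_le (b : nat -> X) i j u : (i <= j)%N -> spn b i u -> spn b j u.
Proof.
move=> ij [c ->]; apply: lsub_sum => [|l]; first exact: lsub_span.
exact: (mem_lspan _ _ (widen_ord ij l)).
Qed.

Let spn0 b i : spn b i 0.
Proof. by have [h _ _] := lsub_span (rat_emb t) (fun j : 'I_i => b j). Qed.

Let spn_notin (b : nat -> X) (c : 'I_m -> ratK t) i :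
  lfree (rat_emb t) (fun j : 'I_m => b j) -> c i != 0 ->
  ~ spn b i (\sum_(j < m) rat_emb t (c j) * b j).
Proof.
move=> fb ci [d dE]; case/eqP: ci.
pose dn l := if insub l is Some l' then d l' else 0.
have := fb (fun j => c j - (if (j < i)%N then dn j else 0)) _ i.
rewrite ltnn subr0; apply.
under eq_bigr => j _ do rewrite rmorphB mulrBl.
rewrite sumrB dE; apply/eqP; rewrite subr_eq0; apply/eqP.
transitivity (\sum_(l < i) rat_emb t (dn l) * b l).
  by apply: eq_bigr => l _; rewrite /dn valK.
rewrite (big_ord_widen m (fun l => rat_emb t (dn l) * b l)); last exact: ltnW.
rewrite [LHS]big_mkcond; apply: eq_bigr => j _; case: ifP => // _.
by rewrite rmorph0 mul0r.
Qed.

(** The finitely many bad points P are each cured by a power of t - t(P). *)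
Lemma fin_reg_denominator u : exists p, ev p != 0 /\ fin_reg (ev p * u).
Proof.
have [->|u0] := eqVneq u 0.
  exists 1; rewrite evalp1 mulr0 oner_neq0; split=> // P _.
  exact: vge0.
pose S := [seq P <- dom (dvs u) ++ dom D | 0 <= ord P t].
have /choice[c cP] : forall P, exists c, 0 <= ord P t -> vge P 1 (t - const X c).
  move=> P; have [Pt|Pt] := leP 0 (ord P t); last by exists 0.
  by have [|c cP] := @residue_exists _ _ P t; [rewrite vgeE|exists c].
pose M P := `|(coeff P D + ord P u)%R|%N.
pose p := \prod_(P <- S) ('X - (c P)%:P) ^+ M P.
have evp : ev p = \prod_(P <- S) (t - const X (c P)) ^+ M P.
  rewrite evalp_prod; apply: eq_bigr => P _; elim: (M P) => [|n IH].
    by rewrite !expr0 evalp1.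
  by rewrite !exprS evalpM IH evalpXsubC.
have p0 : ev p != 0.
  rewrite evp prodf_seq_neq0; apply/allP => P _ /=.
  by rewrite expf_neq0 ?nonconst_subC.
suff fu : fin_reg (ev p * u) by exists p.
move=> P Pt; have [PS|PS] := boolP (P \in S); last first.
    have : ord P u = 0 /\ coeff P D = 0.
      move: PS; rewrite mem_filter Pt mem_cat negb_or !mem_dom !negbK coeff_dvs.
      by case/andP => /eqP -> /eqP ->.
    move=> [ou ->]; rewrite -[- 0]add0r; apply: vgeM; last by rewrite vgeE // ou.
    by apply: vge_evalp; rewrite vgeE.
  rewrite evp (big_rem P) //= -mulrA.
  have -> : - coeff P D = (M P)%:Z + (0 + (- coeff P D - (M P)%:Z)) by lia.
  apply: vgeM.
    rewrite vgeE ?expf_neq0 ?nonconst_subC // ordX ?nonconst_subC //.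
    have := cP P Pt; rewrite vgeE ?nonconst_subC // -mulr_natr natz.
    move: (ord _ _) => a; nia.
  apply: vgeM; last by rewrite vgeE // /M; lia.
  apply: (big_ind (fun v => vge P 0 v)) => [|v w v_ge w_ge|Q _].
  - exact: vge1.
  - by rewrite -[0]addr0; apply: vgeM.
  - by apply: vgeX; apply: vgeB; [rewrite vgeE|exact: vge_const].
Qed.

Lemma fin_reg_twist u : fin_reg u -> exists N, sections (twist N) u.
Proof.
move=> fu; have [->|u0] := eqVneq u 0; first by exists 0; left.
have [S' _ S'P] := finite_zeros (nonconstV nt).
pose N := (\sum_(P <- S') `|(coeff P D + ord P u)%R|)%N.
exists N; apply/sections_twist; split=> // P Pt.
rewrite vgeE //.
have : P \in S' by rewrite S'P ordV oppr_gt0.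
move=> PS'; have : (`|(coeff P D + ord P u)%R| <= N)%N.
  by rewrite /N (big_rem P) //= leq_addr.
move: (ord P u) (coeff P D) (ord P t) Pt => a d e; nia.
Qed.

Let minima_exist r : (r <= m)%N -> exists b delta, minima_inv r b delta.
Proof.
elim: r => [_|r IH rm].
  by exists (fun=> 0), (fun=> 0); split=> [c _ []//|//|//].
have [b [delta [fb bD bmin]]] := IH (ltnW rm).
have [u nu] : exists u, ~ spn b r u.
  apply: contrapT => /forallNP full; move: rm; rewrite ltnNge => /negP; apply.
  have hr : has_dim (rat_emb t) setT r.
    by exists (fun j : 'I_r => b j); split=> [||u _] //; exact: (contrapT (full u)).
  by rewrite (has_dim_uniq hm hr).
have u0 : u != 0 by apply/eqP => u0; apply: nu; rewrite u0; exact: spn0.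
have [p [p0 /fin_reg_twist[N1 uN1]]] := fin_reg_denominator u.
have npu : ~ spn b r (ev p * u).
  move=> spu; apply: nu; have -> : u = rat_emb t (rat_poly t p)^-1 * (ev p * u).
    by rewrite fmorphV rat_polyE mulKf.
  by have [_ _ h] := lsub_span (rat_emb t) (fun j : 'I_r => b j); exact: h.
(* By [sections_vanish] every admissible twist exceeds - ell D; the shift by [ell D] turns the
   search for a least twist into a minimum over natural numbers. *)
pose Q n := `[< exists2 v, sections (twist (n%:Z - (ell D)%:Z)) v & ~ spn b r v >].
have low N v : sections (twist N) v -> ~ spn b r v -> - (ell D)%:Z < N.
  move=> vN nv; rewrite ltNge; apply/negP => N_le; apply: nv.
  have NE : N = - (`|N|%N)%:Z by lia.
  have -> : v = 0.
    apply: (@sections_vanish _ X t D `|N|%N) => //; first by lia.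
    by rewrite -scaleNr -NE.
  exact: spn0.
have QE N v : sections (twist N) v -> ~ spn b r v -> Q `|(N + (ell D)%:Z)%R|%N.
  move=> vN nv; apply/asboolP; exists v => //.
  have lo := low N v vN nv.
  by rewrite (_ : _ - _ = N) //; lia.
have Qex : exists n, Q n by exists `|(N1 + (ell D)%:Z)%R|%N; exact: QE uN1 npu.
case: (ex_minnP Qex) => n /asboolP[v vn nv] nmin.
exists (fun j => if j == r then v else b j).
exists (fun j => if j == r then n%:Z - (ell D)%:Z else delta j).
have spnE j w : (j <= r)%N -> spn (fun i => if i == r then v else b i) j w <-> spn b j w.
  move=> jr; suff E (i : 'I_j) : (if (i : nat) == r then v else b i) = b i.
    split=> -[c ->]; exists c; apply: eq_bigr => i _; by rewrite E.
  by rewrite ltn_eqF // (leq_trans (ltn_ord i)).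
split.
- move=> c; rewrite big_ord_recr /= eqxx => cE.
  have {}cE : \sum_(i < r) rat_emb t (c (widen_ord (leqnSn r) i)) * b i +
      rat_emb t (c ord_max) * v = 0.
    rewrite -[RHS]cE; congr (_ + _); apply: eq_bigr => i _ /=.
    by rewrite ltn_eqF.
  have [c0|c0] := eqVneq (c ord_max) 0; last first.
    case: nv; exists (fun i => - c (widen_ord (leqnSn r) i) / c ord_max).
    have ec0 : rat_emb t (c ord_max) != 0 by rewrite fmorph_eq0.
    apply: (mulfI ec0); move/eqP: cE; rewrite addrC addr_eq0 => /eqP ->.
    rewrite mulr_sumr -sumrN; apply: eq_bigr => i _.
    by rewrite rmorphM rmorphN fmorphV; field.
  move: cE; rewrite c0 rmorph0 mul0r addr0 => /fb cE j.
  have [jr|jr] := eqVneq (val j) r.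
    by rewrite -c0; congr (c _); apply: val_inj.
  have lt : (j < r)%N by rewrite ltn_neqAle jr -ltnS ltn_ord.
  by rewrite -(cE (Ordinal lt)); congr (c _); apply: val_inj.
- move=> j; rewrite ltnS leq_eqVlt => /orP[/eqP ->|jr]; first by rewrite eqxx.
  by rewrite ltn_eqF //; exact: bD.
- move=> j N w; rewrite ltnS => jr wN /(spnE j w jr) nw.
  move: jr; rewrite leq_eqVlt => /orP[/eqP jr|jr].
    rewrite jr eqxx in nw *; have := nmin _ (QE N w wN nw).
    by have := low N w wN nw; lia.
  by rewrite ltn_eqF //; exact: bmin wN nw.
Qed.

(* Successive minima of the filtration by pole order along t = oo. *)
Lemma successive_minima : exists (b : 'I_m -> X) (delta : 'I_m -> int),
  [/\ lfree (rat_emb t) b,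
      forall j, sections (twist (delta j)) (b j),
      forall i j : 'I_m, (i <= j)%N -> delta i <= delta j &
      forall N (c : 'I_m -> ratK t) i, c i != 0 ->
        (forall j : 'I_m, (i < j)%N -> c j = 0) ->
        sections (twist N) (\sum_j rat_emb t (c j) * b j) -> delta i <= N].
Proof.
have [b [delta [fb bD bmin]]] := minima_exist (leqnn m).
exists (fun j => b j), (fun j => delta j); split=> [//|j|i j ij|N c i ci cj cN].
- exact: bD.
- apply: (bmin i _ (b j)) => //; first exact: bD.
  move=> /(spn_le ij); have -> : b j = \sum_(l < m) rat_emb t (l == j)%:R * b l.
    rewrite (bigD1 j) //= eqxx rmorph1 mul1r big1 ?addr0 // => l /negPf ->.
    by rewrite rmorph0 mul0r.
  by apply: spn_notin; rewrite // eqxx oner_eq0.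
- by apply: (bmin i N _ _ cN) => //; exact: spn_notin.
Qed.

End ReducedBasis.

Section ReducedExpansion.
Variables (k : closedFieldType) (X : curve k) (t : X) (m : nat) (D : divisor X).
Implicit Types (p q : {poly k}) (u v : X) (P : closed_point X) (N d : int).
Hypotheses (nt : nonconst t) (hm : has_dim (rat_emb t) setT m).

Let t0 : t != 0 := nonconst_neq0 nt.
Local Notation ev p := (evalp (const X) p t).

Section Basis.
Variables (b : 'I_m -> X) (delta : 'I_m -> int).
Hypotheses (fb : lfree (rat_emb t) b)
  (bD : forall j, sections (twist t D (delta j)) (b j))
  (delta_mono : forall i j : 'I_m, (i <= j)%N -> delta i <= delta j)
  (bmin : forall N (c : 'I_m -> ratK t) i, c i != 0 ->
     (forall j : 'I_m, (i < j)%N -> c j = 0) ->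
     sections (twist t D N) (\sum_j rat_emb t (c j) * b j) -> delta i <= N).

Let last_nonzero (Q : pred 'I_m) : (exists i, Q i) ->
  exists2 i, Q i & forall j : 'I_m, (i < j)%N -> ~~ Q j.
Proof.
move=> [i0 Qi0]; have [i Qi imax] := @arg_maxnP _ i0 Q val Qi0.
exists i => // j; rewrite ltnNge; apply: contra; exact: imax.
Qed.

Let term_reg p j N : (p != 0 -> (size p)%:Z + delta j <= N + 1) ->
  fin_reg t D (ev p * b j) /\ inf_reg t D N (ev p * b j).
Proof.
move=> pN; have /sections_twist[bf bi] := bD j; split; first exact: fin_regM.
have [->|p0] := eqVneq p 0.
  by move=> P _; rewrite evalp0 mul0r vge0.
rewrite -(subrK (delta j) N); apply: inf_regM => // P Pt.
by apply: vge_evalp_pole => //; have := pN p0; lia.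
Qed.

(** If the bound N + 1 failed, the leading terms of the offending p_j would add up to a function
    regular at infinity with twist N. Dividing by t^M, with M the degree of the last offending p_i,
    leaves a combination of twist delta_i - 1 whose last coefficient is a nonzero constant, against
    minimality. Monotonicity of [delta] keeps the other coefficients polynomial. *)
Let reduced_step (p : 'I_m -> {poly k}) N :
  sections (twist t D N) (\sum_i ev (p i) * b i) ->
  (forall i, p i != 0 -> (size (p i))%:Z + delta i <= N + 2) ->
  forall i, p i != 0 -> (size (p i))%:Z + delta i <= N + 1.
Proof.
move=> pN p_le; apply: contrapT => /existsNP[i0 /not_implyP[pi0 /negP i0_big]].
pose Q i := (p i != 0) && ~~ ((size (p i))%:Z + delta i <= N + 1).
have [|i /andP[pi i_big] imax] := @last_nonzero Q.
  by exists i0; rewrite /Q pi0.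
have QE j : Q j -> (size (p j))%:Z + delta j = N + 2.
  by move=> /andP[pj]; have := p_le j pj; lia.
have iE : (size (p i))%:Z + delta i = N + 2 by apply: QE; rewrite /Q pi.
pose M := (size (p i)).-1.
have pi_gt0 : (0 < size (p i))%N by rewrite size_poly_gt0.
pose alpha j := if Q j then lead_coef (p j) else 0.
pose low j := p j - alpha j *: 'X^((size (p j)).-1).
have low_le j : low j != 0 -> (size (low j))%:Z + delta j <= N + 1.
  rewrite /low /alpha; have [Qj|nQj] := boolP (Q j); last first.
    rewrite scale0r subr0 => pj; move: nQj.
    by rewrite /Q pj /= negbK.
  move=> lj; have := QE j Qj; have szp : (0 < size (p j))%N.
    by rewrite size_poly_gt0; case/andP: Qj.
  suff : (size (p j - lead_coef (p j) *: 'X^((size (p j)).-1))%R < size (p j))%N by lia.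
  rewrite -[X in (_ < X)%N](prednK szp) ltnS; apply/leq_sizeP => l.
  rewrite leq_eqVlt => /orP[/eqP <-|lt].
    by rewrite coefB coefZ coefXn eqxx mulr1 subrr.
  rewrite coefB coefZ coefXn gtn_eqF // mulr0 subr0 nth_default //.
  by rewrite -(prednK szp).
pose Z := \sum_j ev (alpha j *: 'X^((size (p j)).-1)) * b j.
have ZE : Z = \sum_i ev (p i) * b i - \sum_j ev (low j) * b j.
  rewrite -sumrB; apply: eq_bigr => j _; rewrite -mulrBl -evalpB /low.
  by rewrite opprB addrCA subrr addr0.
have Zi : inf_reg t D N Z.
  rewrite ZE; apply: inf_regD.
    by move/sections_twist: pN => [].
  apply: inf_regN; apply: inf_reg_sum => j _.
  by have [] := @term_reg (low j) j N (low_le j).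
have alpha0 (j : 'I_m) : (i < j)%N -> alpha j = 0.
  by move=> /imax; rewrite /alpha => /negPf ->.
have alpha_exp j : alpha j != 0 -> (M <= (size (p j)).-1)%N.
  rewrite /alpha; have [Qj|_] := boolP (Q j); rewrite ?eqxx // => _.
  have ji : (j <= i)%N by rewrite leqNgt; apply/negP => /imax; rewrite Qj.
  by have := delta_mono ji; have := QE j Qj; rewrite /M; lia.
pose c j := rat_poly t (alpha j *: 'X^((size (p j)).-1 - M)).
have cE : t ^+ M * (\sum_j rat_emb t (c j) * b j) = Z.
  rewrite mulr_sumr; apply: eq_bigr => j _; rewrite rat_polyE mulrA; congr (_ * _).
  have [->|aj] := eqVneq (alpha j) 0; first by rewrite !scale0r !evalp0 mulr0.
  by rewrite !evalpZ !evalpXn mulrCA -exprD subnKC // alpha_exp.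
have ci : c i != 0.
  rewrite -(fmorph_eq0 (rat_emb t)) rat_polyE subnn expr0 evalp_neq0 //.
  rewrite scaler_eq0 oner_eq0 orbF /alpha /Q pi i_big /=.
  by rewrite lead_coef_eq0.
suff : delta i <= delta i - 1 by lia.
apply: (bmin ci) => [j /alpha0 aj|].
  by rewrite /c aj scale0r; apply/eqP; rewrite -(fmorph_eq0 (rat_emb t)) rat_polyE evalp0.
apply/sections_twist; split.
  apply: fin_reg_sum => j _; rewrite rat_polyE; apply: fin_regM => //.
  by have /sections_twist[] := bD j.
have -> : \sum_j rat_emb t (c j) * b j = t ^- M * Z.
  by rewrite -cE mulKf ?expf_neq0.
have -> : delta i - 1 = - M%:Z + N by rewrite /M; lia.
apply: inf_regM => // P Pt; rewrite vgeE ?invr_eq0 ?expf_neq0 //.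
by rewrite ordV ordX // -mulr_natr natz mulNr mulrC.
Qed.

Let reduced (p : 'I_m -> {poly k}) N :
  sections (twist t D N) (\sum_i ev (p i) * b i) ->
  forall i, p i != 0 -> (size (p i))%:Z + delta i <= N + 1.
Proof.
move=> pN; pose B := (\sum_i `|((size (p i))%:Z + delta i - N - 1)%R|)%N.
have B_ge i : p i != 0 -> (size (p i))%:Z + delta i <= N + B%:Z + 1.
  move=> _; have : (`|((size (p i))%:Z + delta i - N - 1)%R| <= B)%N.
    by rewrite /B (bigD1 i) //= leq_addr.
  lia.
elim: B B_ge => [|B IH] B_ge; first by move=> i /B_ge; rewrite addr0.
apply: IH; apply: reduced_step.
  move: pN => /sections_twist[pf pi]; apply/sections_twist; split=> //.
  by apply: inf_regW pi; rewrite lerDl.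
by move=> i /B_ge; lia.
Qed.

(** Roots c of the denominator [q] are removed one at a time. If some p_i(c) is nonzero, then sum
    p_i(c) b_i divided by t - c is still regular at finite points and gains one twist at infinity,
    against the minimality of [delta] at the last such i. *)
Let generate n q (p : 'I_m -> {poly k}) u : (size q <= n)%N -> q != 0 ->
  fin_reg t D u -> ev q * u = \sum_i ev (p i) * b i ->
  exists r : 'I_m -> {poly k}, u = \sum_i ev (r i) * b i.
Proof.
elim: n q p u => [|n IH] q p u qn q0 uf quE.
  by move: qn q0; rewrite leqn0 size_poly_eq0 => ->.
have [q1|q1] := eqVneq (size q) 1%N.
  have /size_poly1P[c c0 qc] : size q == 1%N by rewrite q1.
  exists (fun i => c^-1 *: p i).
  under eq_bigr => i _ do rewrite evalpZ -mulrA.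
  rewrite -mulr_sumr -[\sum_i _]quE qc evalpC fmorphV mulKf //.
  by rewrite fmorph_eq0.
have /closed_rootP[c /factor_theorem[q' qE]] : size q != 1%N by [].
have q'0 : q' != 0 by apply: contraNneq q0 => q'0; rewrite qE q'0 mul0r.
have /choice[p' pE] : forall i, exists r, p i = r * ('X - c%:P) + (p i).[c]%:P.
  move=> i; have : root (p i - (p i).[c]%:P) c.
    by rewrite rootE hornerD hornerN hornerC subrr.
  by move=> /factor_theorem[p' p'E]; exists p'; rewrite -p'E subrK.
pose alpha i := (p i).[c].
pose y := ev q' * u - \sum_i ev (p' i) * b i.
have tc0 : t - const X c != 0 by exact: nonconst_subC.
have yE : (t - const X c) * y = \sum_i const X (alpha i) * b i.
  rewrite /y mulrBr mulrA -evalpXsubC -evalpM mulrC.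
  rewrite [('X - _) * _]mulrC -qE mulrC quE mulr_sumr -sumrB.
  apply: eq_bigr => i _; rewrite {1}pE evalpD evalpM evalpC /alpha; ring.
have yf : fin_reg t D y.
  apply: fin_regD; first exact: fin_regM.
  apply: fin_regN; apply: fin_reg_sum => i _; apply: fin_regM => //.
  by have /sections_twist[] := bD i.
have [[i1 ai1]|no] := pselect (exists i, alpha i != 0); last first.
  have y0 : y = 0.
    apply: (mulfI tc0); rewrite yE mulr0 big1 // => i _.
    have [->|ai] := eqVneq (alpha i) 0; first by rewrite rmorph0 mul0r.
    by case: no; exists i.
  apply: (IH q' p' u) => //.
    rewrite -ltnS (leq_trans _ qn) // qE size_mul ?polyXsubC_eq0 // size_XsubC addn2.
    by rewrite ltnSn.
  by apply/eqP; rewrite -subr_eq0 -/y y0.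
have [|i ai imax] := @last_nonzero (fun i => alpha i != 0); first by exists i1.
pose c' j := rat_poly t (alpha j)%:P / rat_poly t ('X - c%:P).
have c'E j : rat_emb t (c' j) = const X (alpha j) / (t - const X c).
  by rewrite fmorph_div !rat_polyE evalpC evalpXsubC.
have c'i : c' i != 0.
  by rewrite -(fmorph_eq0 (rat_emb t)) c'E mulf_neq0 ?invr_eq0 ?fmorph_eq0.
have ycE : y = \sum_j rat_emb t (c' j) * b j.
  apply: (mulfI tc0); rewrite yE mulr_sumr; apply: eq_bigr => j _.
  by rewrite c'E mulrA mulrCA divff ?mulr1.
suff : delta i <= delta i - 1 by lia.
apply: (bmin c'i) => [j /imax|].
  rewrite negbK => /eqP aj; apply/eqP.
  by rewrite -(fmorph_eq0 (rat_emb t)) c'E aj rmorph0 mul0r.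
rewrite -ycE; apply/sections_twist; split=> //.
have -> : y = (t - const X c)^-1 * \sum_i const X (alpha i) * b i.
  by rewrite -yE mulKf.
have -> : delta i - 1 = -1 + delta i by rewrite addrC.
apply: inf_regM => [P Pt|].
  rewrite vgeE ?invr_eq0 // ordV mulN1r lerN2.
  have [||_ ->//] := @ord_dominant _ _ P t (- const X c) => //.
  by rewrite vgeN; apply: vgeW (vge_const P c); lia.
apply: inf_reg_sum => j _; have [->|aj] := eqVneq (alpha j) 0.
  by move=> P _; rewrite rmorph0 mul0r vge0.
have ji : (j <= i)%N by rewrite leqNgt; apply/negP => /imax; rewrite aj.
have /sections_twist[_ bji] := bD j.
move=> P Pt; apply: vgeZ; exact: (inf_regW (delta_mono ji) bji).
Qed.

Lemma reduced_expansion N u : sections (twist t D N) u <->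
  exists2 p : 'I_m -> {poly k}, u = \sum_i ev (p i) * b i &
    forall i, p i != 0 -> (size (p i))%:Z + delta i <= N + 1.
Proof.
split=> [uN|[p -> pN]]; last first.
  apply/sections_twist; split; [apply: fin_reg_sum|apply: inf_reg_sum] => i _;
  by have [] := term_reg (pN i).
have : lspan (rat_emb t) b u.
  apply: contrapT => nu; have := has_dim_free hm (fun=> I) (lfree_extend fb nu).
  by rewrite card_option card_ord ltnn.
move=> [c uE]; have [q [p [q0 pE]]] := rat_denominator c.
have qn0 : q != 0 by apply: contraNneq q0 => ->; rewrite evalp0.
have /sections_twist[uf _] := uN.
have [|p' p'E] := @generate (size q) q p u (leqnn _) qn0 uf.
  rewrite uE mulr_sumr; apply: eq_bigr => i _.
  by rewrite -pE mulrA; congr (_ * _); exact: mulrC.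
exists p' => //; apply: reduced; by rewrite -p'E.
Qed.

End Basis.

(** As [size p] is deg p + 1, the condition reads deg p_i + delta_i <= N: poles at infinity never
    cancel between different [b i]. *)
Theorem reduced_basis : exists (b : 'I_m -> X) (delta : 'I_m -> int),
  lfree (rat_emb t) b /\ forall N u, sections (twist t D N) u <->
    exists2 p : 'I_m -> {poly k}, u = \sum_i evalp (const X) (p i) t * b i &
      forall i, p i != 0 -> (size (p i))%:Z + delta i <= N + 1.
Proof.
have [b [delta [fb bD mono bmin]]] := successive_minima D nt hm.
by exists b, delta; split=> // N u; exact: reduced_expansion.
Qed.

End ReducedExpansion.

(** * Traces and the codifferent *)

Section MatrixTraces.
Variable K : fieldType.

Lemma rank_factorization n (A : 'M[K]_n) :
  exists (C : 'M_(n, \rank A)) (R : 'M_(\rank A, n)) (C' : 'M_(\rank A, n))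
    (R' : 'M_(n, \rank A)),
    [/\ A = C *m R, C' *m C = 1%:M & R *m R' = 1%:M].
Proof.
have [L LC] : exists L, L *m col_base A = 1%:M by exact/row_fullP/col_base_full.
have [R RR] : exists R, row_base A *m R = 1%:M by exact/row_freeP/row_base_free.
by exists (col_base A), (row_base A), L, R; rewrite mulmx_base.
Qed.

(** For a rank factorization A = C R, idempotency forces R C = 1. *)
Lemma mxtrace_idempotent n (A : 'M[K]_n) : A *m A = A -> \tr A = (\rank A)%:R.
Proof.
have [C [R [C' [R' [AE CC RR]]]]] := rank_factorization A.
move: (\rank A) C R C' R' AE CC RR => r C R C' R' -> CC RR AA.
suff RC : R *m C = 1%:M by rewrite mxtrace_mulC RC mxtrace1.
have /= := congr1 (fun B => C' *m B *m R') AA.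
by rewrite !mulmxA CC !mul1mx -!mulmxA RR mulmx1.
Qed.

(** With a rank factorization A = C R, tr A = tr (R C), and R C has smaller nilpotency order because
    A^(i+1) = C (R C)^i R. *)
Lemma mxtrace_nilpotent N n (A : 'M[K]_n) : A ^+ N = 0 -> \tr A = 0.
Proof.
elim: N n A => [|N IH] n A AN.
  by rewrite -[A]mul1r -(expr0 A) AN mul0r mxtrace0.
have [C [R [C' [R' [AE CC RR]]]]] := rank_factorization A.
move: (\rank A) C R C' R' AE CC RR => r C R C' R' AE CC RR.
rewrite AE mxtrace_mulC; apply: (IH _ (R *m C)).
have powE i : A ^+ i.+1 = C *m (R *m C) ^+ i *m R.
  elim: i => [|i IHi]; first by rewrite expr1 expr0 mulmx1 AE.
  by rewrite exprS IHi {1}AE [in RHS]exprS -!mulmxE !mulmxA.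
have : C' *m (A ^+ N.+1) *m R' = 0 by rewrite AN mulmx0 mul0mx.
by rewrite powE !mulmxA CC mul1mx -mulmxA RR mulmx1.
Qed.

End MatrixTraces.

Section Trace.
Variables (K F : fieldType) (e : {rmorphism K -> F}) (m : nat).
Hypothesis hm : has_dim e setT m.
Implicit Types (b c : 'I_m -> F) (u v : F).

Lemma lfree_span b u : lfree e b -> lspan e b u.
Proof.
move=> fb; apply: contrapT => nu.
have := has_dim_free hm (fun=> I) (lfree_extend fb nu).
by rewrite card_option card_ord ltnn.
Qed.

Definition coord b u : 'I_m -> K :=
  if pselect (lspan e b u) is left bu then sval (cid bu) else fun=> 0.

Lemma coordE b u : lfree e b -> u = \sum_i e (coord b u i) * b i.
Proof.
move=> fb; rewrite /coord; case: pselect => [bu|/(_ (lfree_span u fb))//].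
by case: cid.
Qed.

Lemma coord_uniq b u (a : 'I_m -> K) : lfree e b ->
  u = \sum_i e (a i) * b i -> coord b u =1 a.
Proof.
move=> fb uE i; apply/eqP; rewrite -subr_eq0; apply/eqP.
apply: (fb (fun i => coord b u i - a i)).
under eq_bigr => j _ do rewrite rmorphB mulrBl.
by rewrite sumrB -coordE // -uE subrr.
Qed.

Definition mulmat b u : 'M[K]_m :=
  locked (\matrix_(i, j) coord b (u * b i) j).

Lemma mulmat_coord b u i j : mulmat b u i j = coord b (u * b i) j.
Proof. by rewrite /mulmat -lock mxE. Qed.

Lemma mulmat_eq b u (A : 'M[K]_m) : lfree e b ->
  (forall i, u * b i = \sum_j e (A i j) * b j) -> mulmat b u = A.
Proof.
by move=> fb uA; apply/matrixP => i j; rewrite mulmat_coord (coord_uniq fb (uA i)).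
Qed.

Lemma mulmatE b u i : lfree e b -> u * b i = \sum_j e (mulmat b u i j) * b j.
Proof.
move=> fb; rewrite {1}(coordE (u * b i) fb); apply: eq_bigr => j _.
by rewrite mulmat_coord.
Qed.

Lemma mulmatM b u v : lfree e b -> mulmat b (u * v) = mulmat b u *m mulmat b v.
Proof.
move=> fb; apply: mulmat_eq => // i.
rewrite mulrAC (mulmatE u i fb) mulr_suml.
under eq_bigr => j _ do rewrite -mulrA [b j * v]mulrC (mulmatE v j fb) mulr_sumr.
rewrite exchange_big /=; apply: eq_bigr => j _.
rewrite mxE rmorph_sum mulr_suml; apply: eq_bigr => l _.
by rewrite rmorphM mulrA.
Qed.

Lemma mulmatD b u v : lfree e b -> mulmat b (u + v) = mulmat b u + mulmat b v.
Proof.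
move=> fb; apply: mulmat_eq => // i; rewrite mulrDl !(mulmatE _ i fb) -big_split.
by apply: eq_bigr => j _; rewrite mxE rmorphD mulrDl.
Qed.

Lemma mulmatZ b a u : lfree e b -> mulmat b (e a * u) = a *: mulmat b u.
Proof.
move=> fb; apply: mulmat_eq => // i; rewrite -mulrA (mulmatE _ i fb) mulr_sumr.
by apply: eq_bigr => j _; rewrite mxE rmorphM mulrA.
Qed.

Lemma mulmat1 b : lfree e b -> mulmat b 1 = 1%:M.
Proof.
move=> fb; apply: mulmat_eq => // i; rewrite mul1r (bigD1 i) //= mxE eqxx.
rewrite rmorph1 mul1r big1 ?addr0 // => j /negPf ji.
by rewrite mxE eq_sym ji rmorph0 mul0r.
Qed.

(** Independence of the basis matters because finite points and t = oo call for different local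
    bases. *)
Lemma mxtrace_basis b c u : lfree e b -> lfree e c ->
  \tr (mulmat b u) = \tr (mulmat c u).
Proof.
move=> fb fc; pose S := \matrix_(i, j) coord b (c i) j.
pose S' := \matrix_(i, j) coord c (b i) j.
have SE i : c i = \sum_j e (S i j) * b j.
  by rewrite {1}(coordE (c i) fb); apply: eq_bigr => j _; rewrite mxE.
have S'E i : b i = \sum_j e (S' i j) * c j.
  by rewrite {1}(coordE (b i) fc); apply: eq_bigr => j _; rewrite mxE.
have inj (A B : 'M[K]_m) :
    (forall i, \sum_j e (A i j) * b j = \sum_j e (B i j) * b j) -> A = B.
  move=> AB; apply/matrixP => i j; have := coord_uniq fb (erefl (\sum_j e (A i j) * b j)).
  by move=> <-; rewrite AB; apply: coord_uniq.
have mulE (A B : 'M[K]_m) i : \sum_j e ((A *m B) i j) * b j =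
    \sum_j e (A i j) * \sum_l e (B j l) * b l.
  under [RHS]eq_bigr => j _ do rewrite mulr_sumr.
  rewrite [RHS]exchange_big /=; apply: eq_bigr => j _.
  rewrite mxE rmorph_sum mulr_suml; apply: eq_bigr => l _.
  by rewrite rmorphM mulrA.
have S'S : S' *m S = 1%:M.
  apply: inj => i; rewrite mulE; under eq_bigr => j _ do rewrite -SE.
  rewrite -S'E (bigD1 i) //= mxE eqxx rmorph1 mul1r big1 ?addr0 // => j /negPf ji.
  by rewrite mxE eq_sym ji rmorph0 mul0r.
have MS : mulmat c u *m S = S *m mulmat b u.
  apply: inj => i; rewrite !mulE.
  under eq_bigr => j _ do rewrite -SE.
  under [RHS]eq_bigr => j _ do rewrite -mulmatE // mulrCA.
  by rewrite -mulmatE // -mulr_sumr -SE.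
rewrite -[mulmat c u]mulmx1 -(mulmx1C S'S) mulmxA MS mxtrace_mulC mulmxA S'S.
by rewrite mul1mx.
Qed.

Definition trace u : K := \tr (mulmat (sval (cid hm)) u).

Lemma traceE b u : lfree e b -> trace u = \tr (mulmat b u).
Proof.
by move=> fb; apply: mxtrace_basis => //; case: (cid hm) => c [].
Qed.

Let basis_free : exists b, lfree e b.
Proof. by case: hm => b [_ fb _]; exists b. Qed.

Lemma traceD u v : trace (u + v) = trace u + trace v.
Proof.
by have [b fb] := basis_free; rewrite !(traceE _ fb) mulmatD // mxtraceD.
Qed.

Lemma traceZ a u : trace (e a * u) = a * trace u.
Proof.
by have [b fb] := basis_free; rewrite !(traceE _ fb) mulmatZ // mxtraceZ.
Qed.

Lemma trace0 : trace 0 = 0.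
Proof. by rewrite -[X in trace X](mul0r 0) -(rmorph0 e) traceZ mul0r. Qed.

Lemma trace_sum (I : Type) (r : seq I) (Q : pred I) (f : I -> F) :
  trace (\sum_(i <- r | Q i) f i) = \sum_(i <- r | Q i) trace (f i).
Proof. exact: (big_morph trace traceD trace0). Qed.

Lemma trace1 : trace 1 = m%:R.
Proof.
by have [b fb] := basis_free; rewrite !(traceE _ fb) mulmat1 // mxtrace1.
Qed.

Section DualBasis.
Hypothesis m_neq0 : (m%:R : K) != 0.

(* Tr (w * w^-1) = m is nonzero. *)
Lemma trace_nondegenerate b w : lfree e b ->
  (forall i, trace (w * b i) = 0) -> w = 0.
Proof.
move=> fb wb; apply/eqP; apply: contraT => w0.
have : trace (w * w^-1) = 0.
  rewrite (coordE w^-1 fb) mulr_sumr trace_sum big1 // => i _.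
  by rewrite mulrCA traceZ wb mulr0.
by rewrite divff // trace1 => /eqP; rewrite (negPf m_neq0).
Qed.

Lemma dual_basis b : lfree e b -> exists c, [/\ lfree e c,
  forall i j, trace (b i * c j) = (i == j)%:R &
  forall u, u = \sum_i e (trace (u * b i)) * c i].
Proof.
move=> fb; pose G := \matrix_(i, j) trace (b i * b j).
have Gunit : G \in unitmx.
  rewrite -row_free_unit -kermx_eq0; apply/rowV0P => v /sub_kermxP vG.
  have : \sum_i e (v 0 i) * b i = 0.
    apply: (trace_nondegenerate fb) => j.
    have := congr1 (fun A : 'rV_m => A 0 j) vG; rewrite !mxE => <-.
    rewrite mulr_suml trace_sum; apply: eq_bigr => i _.
    by rewrite -mulrA traceZ mxE.
  by move=> /fb v0; apply/rowP => i; rewrite v0 mxE.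
pose c j := \sum_l e (invmx G l j) * b l.
have bc i j : trace (b i * c j) = (i == j)%:R.
  rewrite /c mulr_sumr trace_sum.
  transitivity ((G *m invmx G) i j); last by rewrite mulmxV // mxE.
  rewrite mxE; apply: eq_bigr => l _.
  by rewrite mulrCA traceZ mxE mulrC.
have cE (a : 'I_m -> K) i : trace ((\sum_j e (a j) * c j) * b i) = a i.
  rewrite mulr_suml trace_sum (bigD1 i) //= big1 => [|j ji].
    by rewrite addr0 -mulrA traceZ mulrC [c i * _]mulrC bc eqxx mul1r.
  by rewrite -mulrA traceZ [c j * _]mulrC bc eq_sym (negPf ji) mulr0.
exists c; split=> // [a a0 i|u]; first by rewrite -cE a0 mul0r trace0.
apply/eqP; rewrite -subr_eq0; apply/eqP/(trace_nondegenerate fb) => i.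
by rewrite mulrBl traceD -mulN1r -(rmorph1 e) -rmorphN traceZ cE mulN1r subrr.
Qed.

End DualBasis.
End Trace.

Section Values.
Variables (k : closedFieldType) (X : curve k) (P : closed_point X).
Implicit Types (u v : X).

(** The residue of [u] at [P], with value 0 outside the local ring. *)
Definition val_at u : k :=
  if pselect (exists c, vge P 1 (u - const X c)) is left h then sval (cid h) else 0.

Lemma val_atP u : vge P 0 u -> vge P 1 (u - const X (val_at u)).
Proof.
move=> /residue_exists uc; rewrite /val_at; case: pselect => // h.
by case: cid.
Qed.

Lemma val_at_eq u c : vge P 1 (u - const X c) -> val_at u = c.
Proof.
move=> uc; have u0 : vge P 0 u.
  rewrite -(subrK (const X c) u); apply: vgeD; last exact: vge_const.
  exact: vgeW uc.
have : vge P 1 (const X (val_at u - c)).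
  have -> : const X (val_at u - c) = (u - const X c) - (u - const X (val_at u)).
    by rewrite rmorphB; ring.
  by apply: vgeB => //; exact: val_atP.
by rewrite /vge ord_const fmorph_eq0 orbF subr_eq0 => /eqP.
Qed.

Lemma val_at_const c : val_at (const X c) = c.
Proof. by apply: val_at_eq; rewrite subrr vge0. Qed.

Lemma val_at_pos u : vge P 1 u -> val_at u = 0.
Proof. by move=> u1; apply: val_at_eq; rewrite rmorph0 subr0. Qed.

Lemma val_at_eq0 u : vge P 0 u -> val_at u = 0 -> vge P 1 u.
Proof. by move=> /val_atP + v0; rewrite v0 rmorph0 subr0. Qed.

Lemma val_atD u v : vge P 0 u -> vge P 0 v -> val_at (u + v) = val_at u + val_at v.
Proof.
move=> u0 v0; apply: val_at_eq; rewrite rmorphD opprD addrACA.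
by apply: vgeD; exact: val_atP.
Qed.

Lemma val_atM u v : vge P 0 u -> vge P 0 v -> val_at (u * v) = val_at u * val_at v.
Proof.
move=> u0 v0; apply: val_at_eq; rewrite rmorphM.
have -> : u * v - const X (val_at u) * const X (val_at v) =
  (u - const X (val_at u)) * v + const X (val_at u) * (v - const X (val_at v)).
  by ring.
apply: vgeD; last by apply: vgeZ; exact: val_atP.
by rewrite -[1]addr0; apply: vgeM => //; exact: val_atP.
Qed.

Lemma val_at_sum (I : Type) (r : seq I) (f : I -> X) :
  (forall i, vge P 0 (f i)) ->
  val_at (\sum_(i <- r) f i) = \sum_(i <- r) val_at (f i).
Proof.
move=> f0; elim: r => [|i r IH].
  by rewrite !big_nil val_at_pos // vge0.
by rewrite !big_cons val_atD ?IH //; exact: vge_sum.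
Qed.

End Values.

(** * The codifferent above one point of P^1 *)

Section LocalDuality.
Variables (k : closedFieldType) (X : curve k) (t s : X) (m : nat).
Hypotheses (char0 : [pchar k] =i pred0) (hm : has_dim (rat_emb t) setT m)
  (ps : local_param t s).
Implicit Types (P Q : closed_point X) (u v : X) (a : ratK t).

Local Notation e := (rat_emb t).
Local Notation Tr u := (e (trace hm u)).

(** The semilocal ring of the fibre s = 0; [beta] below is a basis of it over the local ring of
    P^1. *)
Definition reg u : Prop := forall P, 0 < ord P s -> vge P 0 u.

Variable beta : 'I_m -> X.
Hypotheses (fbeta : lfree e beta) (beta_reg : forall i, reg (beta i))
  (reg_expand : forall u, reg u ->
     exists2 a : 'I_m -> ratK t, u = \sum_i e (a i) * beta i & forall i, reg (e (a i))).

Let ns : nonconst s. Proof. by case: ps. Qed.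
Let s0 : s != 0 := nonconst_neq0 ns.

Let sK : exists a, e a = s.
Proof.
have [_ /asboolP st _] := ps.
by move: st; rewrite -range_rat_emb => -[a _ <-]; exists a.
Qed.

Let regM u v : reg u -> reg v -> reg (u * v).
Proof. by move=> ru rv P Ps; rewrite -[0]addr0; apply: vgeM; [exact: ru|exact: rv]. Qed.

Let regX u n : reg u -> reg (u ^+ n).
Proof. by move=> ru P Ps; apply: vgeX; exact: ru. Qed.

Let reg_sum (I : finType) (f : I -> X) : (forall i, reg (f i)) -> reg (\sum_i f i).
Proof. by move=> rf P Ps; apply: vge_sum => i _; exact: rf. Qed.

(** On k(t) the orders at the zeros P of [s] are [ord P s] times one common integer, so vanishing at
    one point of the fibre means divisibility by [s]. *)
Let K_pos a P : 0 < ord P s -> vge P 1 (e a) -> reg (e a / s).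
Proof.
move=> Ps aP Q Qs; have [->|a0] := eqVneq a 0.
  by rewrite rmorph0 mul0r vge0.
have ea0 : e a != 0 by rewrite fmorph_eq0.
have [_ _ /(_ _ a0)[n nP]] := ps.
move: aP; rewrite !vgeE ?mulf_neq0 ?invr_eq0 // ord_div // !nP //.
move: (ord P s) (ord Q s) Ps Qs => x y x0 y0 xn.
have n1 : 1 <= n.
  rewrite leNgt; apply/negP => n0.
  have : x * n <= 0 by apply: mulr_ge0_le0; lia.
  lia.
have : 0 <= y * (n - 1) by apply: mulr_ge0; lia.
by rewrite mulrBr mulr1.
Qed.

Let coord_reg u i : reg u -> reg (e (coord e beta u i)).
Proof.
by move=> /reg_expand[a uE ra]; rewrite (coord_uniq hm fbeta uE).
Qed.

Let entry_reg u i j : reg u -> reg (e (mulmat e beta u i j)).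
Proof. by move=> ru; rewrite mulmat_coord; apply: coord_reg; exact: regM. Qed.

Variable P0 : closed_point X.
Hypothesis P0s : 0 < ord P0 s.

(** Multiplication by [u] on the fibre algebra, that is, modulo [s]; the entries lie in k(t) and
    [P0] only serves to evaluate them. *)
Let red u : 'M[k]_m := \matrix_(i, j) val_at P0 (e (mulmat e beta u i j)).

Let redM u v : reg u -> reg v -> red (u * v) = red u *m red v.
Proof.
move=> ru rv; apply/matrixP => i j; rewrite !mxE mulmatM // mxE rmorph_sum.
rewrite val_at_sum => [|l].
  apply: eq_bigr => l _; rewrite rmorphM val_atM ?mxE //; exact: entry_reg.
by rewrite rmorphM; apply: regM => //; exact: entry_reg.
Qed.

Let redX u n : reg u -> red (u ^+ n) = red u ^+ n.
Proof.
move=> ru; elim: n => [|n IH].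
  apply/matrixP => i j; rewrite !expr0 !mxE mulmat1 // !mxE rmorph_nat.
  by rewrite -(rmorph_nat (const X)) val_at_const.
by rewrite !exprS redM ?IH //; exact: regX.
Qed.

Let red_s v : reg v -> red (s * v) = 0.
Proof.
move=> rv; apply/matrixP => i j; rewrite !mxE; have [a aE] := sK.
rewrite -aE mulmatZ // mxE rmorphM aE; apply: val_at_pos.
by rewrite -[1]addr0; apply: vgeM; [rewrite vgeE|exact: entry_reg].
Qed.

Let red_trace u : reg u -> val_at P0 (Tr u) = \tr (red u).
Proof.
move=> ru; rewrite (traceE _ _ fbeta) rmorph_sum val_at_sum => [|i].
  by apply: eq_bigr => i _; rewrite mxE.
exact: entry_reg.
Qed.

Let trace_reg u : reg u -> reg (Tr u).
Proof.
by move=> ru; rewrite (traceE _ _ fbeta) rmorph_sum; apply: reg_sum => i; exact: entry_reg.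
Qed.

Let ord_bound : exists n : nat, forall P, 0 < ord P s -> ord P s <= n%:Z.
Proof.
have [S _ SP] := finite_zeros ns; exists (\sum_(P <- S) `|ord P s|)%N => P Ps.
have PS : P \in S by rewrite SP.
have : (`|ord P s| <= \sum_(P <- S) `|ord P s|)%N by rewrite (big_rem P) //= leq_addr.
lia.
Qed.

Let divs_reg u n : (forall P, 0 < ord P s -> ord P s <= n%:Z) ->
  (forall P, 0 < ord P s -> vge P n u) -> exists2 v, reg v & u = s * v.
Proof.
move=> sn un; exists (u / s); last by rewrite mulrC divfK.
move=> P Ps; rewrite -(vgeMr _ _ _ s0) divfK // add0r.
by apply: vgeW (un P Ps); exact: sn.
Qed.

(* The trace of an element of the Jacobson radical is a non-unit, since it
   reduces to the trace of a nilpotent matrix. *)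
Lemma trace_codifferent u : (forall P, 0 < ord P s -> vge P (1 - ord P s) u) ->
  reg (Tr u).
Proof.
move=> u_ge; pose w := s * u.
have w1 P : 0 < ord P s -> vge P 1 w.
  move=> Ps; rewrite /w mulrC -[1](subrK (ord P s)) vgeMr //; exact: u_ge.
have rw : reg w by move=> P Ps; apply: vgeW (w1 P Ps).
have [n sn] := ord_bound.
have [v rv wE] : exists2 v, reg v & w ^+ n = s * v.
  apply: (divs_reg sn) => P Ps; have [->|w0] := eqVneq w 0.
    case: n sn => [sn|n _]; last by rewrite expr0n vge0.
    by have := sn P Ps; lia.
  have := w1 P Ps; rewrite !vgeE ?expf_neq0 // ordX // -mulr_natr natz; nia.
have : \tr (red w) = 0.
  by apply: (@mxtrace_nilpotent _ n); rewrite -redX // wE red_s.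
(* Tr w = s Tr u vanishes at [P0], hence is divisible by [s]. *)
rewrite -red_trace // => /(val_at_eq0 (trace_reg rw P0s)).
move=> /(K_pos P0s); rewrite /w; have [a aE] := sK.
by rewrite -[in s * u]aE traceZ rmorphM aE [s * _]mulrC mulfK.
Qed.

(* The trace of an element that is 1 at one place and 0 at the other ones
   reduces to the trace of a nonzero idempotent, which is nonzero in
   characteristic 0. *)
Lemma codifferent_trace (d : closed_point X -> int) u :
  (forall v, (forall P, 0 < ord P s -> vge P (- d P) v) -> vge P0 0 (Tr (u * v))) ->
  forall P, 0 < ord P s -> vge P (1 - ord P s + d P) u.
Proof.
move=> uv P Ps; apply: contraT => nu.
have u0 : u != 0 by apply: contraNneq nu => ->; rewrite vge0.
rewrite vgeE // -ltNge in nu.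
have [n sn] := ord_bound.
have [S uS SP] := finite_zeros ns.
(* [N] is so large that the errors of [eps] are divisible by [s] and that eps / (s u) is an
   admissible test function. *)
pose N := (n + \sum_(Q <- S) `|(ord Q s + ord Q u - d Q)%R|)%N.
have N_ge Q : 0 < ord Q s -> ord Q s <= N%:Z /\ ord Q s + ord Q u - d Q <= N%:Z.
  move=> Qs; split; first by have := sn Q Qs; rewrite /N; lia.
  have QS : Q \in S by rewrite SP.
  have : (`|(ord Q s + ord Q u - d Q)%R| <= N)%N.
    by rewrite /N (big_rem Q) //= addnCA leq_addr.
  lia.
have [eps [eps1 eps0]] : exists eps, vge P N (eps - 1) /\
    forall Q, Q \in rem P S -> vge Q N eps.
  by apply: approx_one; rewrite mem_rem_uniqF.
have eps_other Q : 0 < ord Q s -> Q != P -> vge Q N eps.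
  by move=> Qs QP; apply: eps0; rewrite mem_rem_uniq // inE QP SP.
have N1 : 1 <= N%:Z by have [] := N_ge P Ps; lia.
have epsP : vge P 0 eps.
  rewrite -(subrK 1 eps); apply: vgeD; last exact: vge1.
  by apply: vgeW eps1.
have reps : reg eps.
  move=> Q Qs; have [->//|QP] := eqVneq Q P.
  by apply: vgeW (eps_other Q Qs QP).
have eps_idem : red eps *m red eps = red eps.
  rewrite -redM //; have [v rv vE] : exists2 v, reg v & eps * (eps - 1) = s * v.
    apply: (@divs_reg _ N) => [Q Qs|Q Qs]; first by have [] := N_ge Q Qs.
    have [->|QP] := eqVneq Q P; first by rewrite -[N%:Z]add0r; apply: vgeM.
    rewrite -[N%:Z]addr0; apply: vgeM; first exact: eps_other.
    by apply: vgeB; [exact: reps|exact: vge1].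
  have -> : eps * eps = eps + s * v by rewrite -vE; ring.
  apply/matrixP => i j; have := congr1 (fun A : 'M_m => A i j) (red_s rv).
  rewrite !mxE mulmatD // mxE rmorphD => svE.
  have rsv : reg (s * v) by apply: regM => // Q Qs; rewrite vgeE // ltW.
  rewrite val_atD ?svE ?addr0 //; apply: entry_reg => //.
(* For v = eps / (s u) one has u v = eps / s, so the regularity of Tr (u v) makes Tr eps vanish at
   [P0]. At [P] itself, the order of [v] is allowed precisely because the bound on [u] is assumed to
   fail. *)
have tr0 : \tr (red eps) = 0.
  rewrite -red_trace //.
  have := uv (eps / (s * u)).
  have -> : u * (eps / (s * u)) = eps / s by field; rewrite s0 u0.
  have [a aE] := sK.
  have -> : eps / s = e a^-1 * eps by rewrite fmorphV aE mulrC.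
  rewrite traceZ rmorphM fmorphV aE => H; apply: val_at_pos.
  have {}H : vge P0 0 (s^-1 * e (trace hm eps)).
    apply: H => Q Qs; have -> : - d Q = (ord Q s + ord Q u - d Q) + - (ord Q s + ord Q u).
      by ring.
    apply: vgeM; last by rewrite vgeE ?invr_eq0 ?mulf_neq0 // ordV ordM.
    have [QP|QP] := eqVneq Q P.
      by apply: vgeW (reps Q Qs); rewrite QP; lia.
    by apply: vgeW (eps_other Q Qs QP); have [] := N_ge Q Qs.
  have : vge P0 (0 + ord P0 s) (s^-1 * e (trace hm eps) * s) by rewrite vgeMr.
  by rewrite add0r mulrAC mulVf // mul1r; apply: vgeW.
have red0 : red eps = 0.
  apply/eqP; rewrite -mxrank_eq0 -(iffLR (pcharf0P _) char0) -mxtrace_idempotent //.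
  exact/eqP.
have entry i j : reg (e (mulmat e beta eps i j) / s).
  apply: (K_pos P0s); apply: val_at_eq0; first exact: entry_reg.
  by have := congr1 (fun A : 'M_m => A i j) red0; rewrite !mxE.
(* Expanding 1 in the basis transfers divisibility by [s] from the matrix of [eps] to [eps] itself,
   which contradicts eps = 1 at [P]. *)
have [|a aE ra] := reg_expand (u := 1); first by move=> Q _; exact: vge1.
have : reg (eps / s).
  rewrite -[eps]mulr1 aE mulr_sumr mulr_suml; apply: reg_sum => i.
  rewrite mulrCA (mulmatE hm eps i fbeta) -mulrA; apply: regM => //.
  rewrite mulr_suml; apply: reg_sum => j; rewrite mulrAC; exact: regM.
move=> /(_ P Ps); rewrite -(vgeMr _ _ _ s0) divfK // add0r => epss.
have : vge P 1 (eps - (eps - 1)).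
  by apply: vgeB; [apply: vgeW epss; lia|apply: vgeW eps1].
by rewrite opprB addrCA subrr addr0 vgeE ?oner_neq0 // ord_one.
Qed.

End LocalDuality.

(** * Reduced bases give local bases at every point of P^1 *)

Section SerreDuality.
Variables (k : closedFieldType) (X : curve k) (t : X) (m : nat).
Hypotheses (char0 : [pchar k] =i pred0) (nt : nonconst t)
  (hm : has_dim (rat_emb t) setT m).
Implicit Types (P Q : closed_point X) (u v : X) (p q : {poly k}) (D : divisor X)
  (N d : int) (c : k) (a : ratK t).
Local Notation ev p := (evalp (const X) p t).
Local Notation e := (rat_emb t).

Let t0 : t != 0 := nonconst_neq0 nt.

(* The direct image of O(D) under t : X -> P^1 is the sum of the O(-delta_i). *)
Definition is_reduced D (b : 'I_m -> X) (delta : 'I_m -> int) : Prop :=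
  lfree e b /\ forall N u, sections (twist t D N) u <->
    exists2 p : 'I_m -> {poly k}, u = \sum_i ev (p i) * b i &
      forall i, p i != 0 -> (size (p i))%:Z + delta i <= N + 1.

Lemma is_reduced_twist D b delta N : is_reduced D b delta ->
  is_reduced (twist t D N) b (fun i => delta i - N).
Proof.
move=> [fb bP]; split=> // N' u.
have -> : twist t (twist t D N) N' = twist t D (N + N').
  by rewrite /twist scalerDl addrA.
rewrite bP; split=> -[p uE pN]; exists p => // i /pN; lia.
Qed.

Lemma ord_subC_fin P c : 0 < ord P (t - const X c) -> 0 <= ord P t.
Proof.
move=> Pc; rewrite -vgeE // -(subrK (const X c) t); apply: vgeD; last exact: vge_const.
by rewrite vgeE ?nonconst_subC // ltW.
Qed.

Lemma ord_evalp_unit P c q : 0 < ord P (t - const X c) -> q.[c] != 0 ->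
  ev q != 0 /\ ord P (ev q) = 0.
Proof.
move=> Pc qc; have Pt := ord_subC_fin Pc.
have : root (q - q.[c]%:P) c by rewrite rootE hornerD hornerN hornerC subrr.
move=> /factor_theorem[r rE].
have -> : ev q = const X q.[c] + ev r * (t - const X c).
  by rewrite -evalpXsubC -evalpM -rE evalpB evalpC addrC subrK.
rewrite -[X in _ /\ _ = X](ord_const P q.[c]); apply: ord_dominant.
  by rewrite fmorph_eq0.
rewrite ord_const; apply: vgeM; first by apply: vge_evalp; rewrite vgeE.
by rewrite vgeE ?nonconst_subC.
Qed.

(** From a denominator valid at all finite points, the factor (X - c)^n may be dropped, since above
    t = c there is nothing to clear. *)
Lemma clear_poles D c v :
  (forall P, 0 < ord P (t - const X c) -> vge P (- coeff P D) v) ->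
  exists q, q.[c] != 0 /\ fin_reg t D (ev q * v).
Proof.
move=> vc; have [p [p0 pv]] := fin_reg_denominator D nt v.
have pn0 : p != 0 by apply: contraNneq p0 => ->; rewrite evalp0.
have [n [q qc pE]] := multiplicity_XsubC p c.
rewrite pn0 /= in qc; exists q; split=> // P Pt.
have [Pc|Pc] := ltP 0 (ord P (t - const X c)).
  rewrite -[- _]add0r; apply: vgeM; last exact: vc.
  by apply: vge_evalp; rewrite vgeE.
have Pc0 : ord P (t - const X c) = 0.
  apply: le_anti; rewrite Pc -vgeE ?nonconst_subC //; apply: vgeB.
    by rewrite vgeE.
  exact: vge_const.
have wE : ev (('X - c%:P) ^+ n) = (t - const X c) ^+ n.
  elim: n {pE} => [|n IH]; first by rewrite !expr0 evalp1.
  by rewrite !exprS evalpM IH evalpXsubC.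
have tc0 : (t - const X c) ^+ n != 0 by rewrite expf_neq0 ?nonconst_subC.
have oW : ord P ((t - const X c) ^+ n) = 0.
  by rewrite ordX ?nonconst_subC // Pc0 mul0rn.
have := pv P Pt; rewrite pE evalpM wE mulrAC => h.
by rewrite -(vgeMr _ _ _ tc0) oW addr0.
Qed.

Section Expansions.
Variables (D : divisor X) (b : 'I_m -> X) (delta : 'I_m -> int).
Hypothesis bR : is_reduced D b delta.

Lemma local_expansion_fin c v :
  (forall P, 0 < ord P (t - const X c) -> vge P (- coeff P D) v) ->
  exists2 a : 'I_m -> ratK t, v = \sum_i e (a i) * b i &
    forall i P, 0 < ord P (t - const X c) -> vge P 0 (e (a i)).
Proof.
have [fb bP] := bR; move=> /clear_poles[q [qc /(fin_reg_twist nt)[N /bP[p pE _]]]].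
have qn0 : q != 0 by apply: contraNneq qc => ->; rewrite horner0.
have q0 := evalp_neq0 nt qn0.
exists (fun i => rat_poly t (p i) / rat_poly t q) => [|i P Pc].
  apply: (mulfI q0); rewrite pE mulr_sumr; apply: eq_bigr => i _.
  by rewrite fmorph_div !rat_polyE mulrA mulrCA divff // mulr1.
rewrite fmorph_div !rat_polyE; have [_ qP] := ord_evalp_unit Pc qc.
have tP : vge P 0 t by rewrite vgeE // (ord_subC_fin Pc).
by have := vgeM (vge_evalp (p i) tP) (vge_ord P (ev q)^-1); rewrite ordV qP oppr0.
Qed.

Lemma local_expansion_inf v :
  (forall P, ord P t < 0 -> vge P (- coeff P D) v) ->
  exists2 a : 'I_m -> ratK t, v = \sum_i e (a i) * b i &
    forall i P, ord P t < 0 -> vge P (- delta i * ord P t) (e (a i)).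
Proof.
have [fb bP] := bR => vD; have [q [q0 qf]] := fin_reg_denominator D nt v.
have qn0 : q != 0 by apply: contraNneq q0 => ->; rewrite evalp0.
have szq : (0 < size q)%N by rewrite size_poly_gt0.
have : sections (twist t D (size q).-1) (ev q * v).
  apply/sections_twist; split=> // P Pt; rewrite addrC; apply: vgeM; last exact: vD.
  by apply: vge_evalp_pole => //; rewrite -PoszD addn1 prednK.
move=> /bP[p pE psz]; exists (fun i => rat_poly t (p i) / rat_poly t q) => [|i P Pt].
  apply: (mulfI q0); rewrite pE mulr_sumr; apply: eq_bigr => i _.
  by rewrite fmorph_div !rat_polyE mulrA mulrCA divff // mulr1.
rewrite fmorph_div !rat_polyE; have [->|pi0] := eqVneq (p i) 0.
  by rewrite evalp0 mul0r vge0.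
rewrite vgeE ?mulf_neq0 ?invr_eq0 ?evalp_neq0 //.
rewrite ord_div ?evalp_neq0 // !ord_evalp_pole // -mulrBr mulrC ler_nM2l //.
by have := psz i pi0; move: pi0; rewrite -size_poly_gt0; lia.
Qed.

End Expansions.

(** A root c of the denominator must also be one of the numerator, since X has a point above t =
    c. *)
Lemma regular_poly a : (forall P, 0 <= ord P t -> vge P 0 (e a)) ->
  exists p, e a = ev p.
Proof.
move=> areg; have [p [q [q0 aE]]] := ratP a.
have [n] := ubnP (size q); elim: n p q q0 aE => // n IH p q q0 aE qn.
have qn0 : q != 0 by apply: contraNneq q0 => ->; rewrite evalp0.
have [q1|q1] := eqVneq (size q) 1%N.
  have /size_poly1P[c c0 qc] : size q == 1%N by rewrite q1.
  by exists (c^-1 *: p); rewrite aE qc evalpC evalpZ fmorphV mulrC.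
have /closed_rootP[c qc] : size q != 1%N by [].
have [P Pc] := zero_exists (nonconstB (c := c) nt).
have Pt := ord_subC_fin Pc.
have [q' qE] := factor_theorem _ _ qc.
have pc : p.[c] == 0.
  apply: contraT => pc; have [p0 pP] := ord_evalp_unit Pc pc.
  have := areg P Pt; rewrite aE vgeE ?mulf_neq0 ?invr_eq0 // ord_div // pP.
  rewrite qE evalpM evalpXsubC ordM; last 2 first.
  - by apply: contraNneq q0; rewrite qE evalpM => ->; rewrite mul0r.
  - exact: nonconst_subC.
  rewrite sub0r oppr_ge0 => H.
  have : 0 <= ord P (ev q').
    by rewrite -vgeE ?vge_evalp ?vgeE //; apply: contraNneq q0; rewrite qE evalpM => ->; rewrite mul0r.
  by lia.
have [p' pE] := factor_theorem _ _ pc.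
have q'0 : ev q' != 0 by apply: contraNneq q0; rewrite qE evalpM => ->; rewrite mul0r.
apply: (IH p' q') => //.
  rewrite aE pE qE !evalpM evalpXsubC; field.
  by rewrite q'0 nonconst_subC.
move: qn; rewrite qE size_mul ?polyXsubC_eq0 ?size_XsubC ?addn2 //.
by apply: contraNneq q0 => q'_0; rewrite qE q'_0 mul0r evalp0.
Qed.

Lemma pole_exists : exists P, ord P t < 0.
Proof.
by have [P] := zero_exists (nonconstV nt); rewrite ordV oppr_gt0; exists P.
Qed.

Lemma degree_bound p d : p != 0 ->
  (forall P, ord P t < 0 -> vge P (d * ord P t) (ev p)) -> (size p)%:Z <= d + 1.
Proof.
move=> p0 pd; have [P Pt] := pole_exists; have := pd P Pt.
rewrite vgeE ?evalp_neq0 // ord_evalp_pole // mulrC ler_nM2l //.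
by move: p0; rewrite -size_poly_gt0; lia.
Qed.

Section LocalBases.
Variables (b : 'I_m -> X) (delta : 'I_m -> int).
Hypothesis bR : is_reduced 0 b delta.

Let b_reg j : fin_reg t 0 (b j) /\ inf_reg t 0 (delta j) (b j).
Proof.
apply/sections_twist/bR.2; exists (fun i => (i == j)%:R).
  rewrite (bigD1 j) //= eqxx evalp1 mul1r big1 ?addr0 // => i /negPf ->.
  by rewrite evalp0 mul0r.
by move=> i; have [->|_] := eqVneq i j; rewrite ?eqxx // size_poly1 addrC.
Qed.

Lemma local_basis_fin c : exists2 beta : 'I_m -> X, lfree e beta &
  (forall i, reg (t - const X c) (beta i)) /\
  forall u, reg (t - const X c) u ->
    exists2 a : 'I_m -> ratK t, u = \sum_i e (a i) * beta i &
      forall i, reg (t - const X c) (e (a i)).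
Proof.
exists b; first exact: bR.1; split=> [i P Pc|u ru].
  by have [/(_ P (ord_subC_fin Pc))] := b_reg i; rewrite coeff0 oppr0.
have [|a uE aP] := local_expansion_fin bR (c := c) (v := u).
  by move=> P Pc; rewrite coeff0 oppr0; exact: ru.
by exists a => // i P Pc; exact: aP.
Qed.

(** The poles of [b i] above t = oo are at most delta_i times the polar divisor of [t], and t^(-
    delta_i) absorbs them. *)
Lemma local_basis_inf : exists2 beta : 'I_m -> X, lfree e beta &
  (forall i, reg t^-1 (beta i)) /\
  forall u, reg t^-1 u ->
    exists2 a : 'I_m -> ratK t, u = \sum_i e (a i) * beta i &
      forall i, reg t^-1 (e (a i)).
Proof.
pose T : ratK t := rat_poly t 'X.
have TE : e T = t by rewrite rat_polyE evalpX.
have TzE z : e (T ^ z) = t ^ z by rewrite fmorphXz TE.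
have T0 : T != 0 by rewrite -(fmorph_eq0 e) TE.
exists (fun i => t ^ (- delta i) * b i); last split=> [i P|u ru].
- move=> c; under eq_bigr => i _ do rewrite -TzE mulrA -rmorphM.
  move=> /bR.1 cE i; have /eqP := cE i.
  by rewrite mulf_eq0 expfz_eq0 (negPf T0) andbF orbF => /eqP.
- rewrite ordV oppr_gt0 => Pt; have [_ /(_ P Pt)] := b_reg i.
  rewrite coeff0 oppr0 add0r => bi.
  have -> : 0 = ord P t * - delta i + delta i * ord P t by ring.
  by apply: vgeM => //; rewrite vgeE ?expfz_neq0 // ordXz.
- have [|a uE aP] := local_expansion_inf bR (v := u).
    by move=> P Pt; rewrite coeff0 oppr0; apply: ru; rewrite ordV oppr_gt0.
  exists (fun i => a i * T ^ (delta i)) => [|i P].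
    rewrite uE; apply: eq_bigr => i _; rewrite rmorphM TzE mulrA -[_ * _ * t ^ _]mulrA.
    by rewrite -expfzDr // subrr expr0z mulr1.
  rewrite ordV oppr_gt0 => Pt; rewrite rmorphM TzE.
  have -> : 0 = - delta i * ord P t + ord P t * delta i by ring.
  by apply: vgeM; [exact: aP|rewrite vgeE ?expfz_neq0 // ordXz].
Qed.

End LocalBases.
End SerreDuality.

(** * Riemann-Roch *)

(** This is h^0(P^1, O(z - 1)), the dimension of the space of polynomials of size at most z. *)
Definition posn (z : int) : nat := if z is Posz n then n else 0%N.

Section PolynomialSpan.
Variables (k : closedFieldType) (X : curve k) (t : X) (m : nat).
Hypothesis nt : nonconst t.
Local Notation ev p := (evalp (const X) p t).

Lemma poly_span_dim (b : 'I_m -> X) (r : 'I_m -> nat) (V : set X) :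
  lfree (rat_emb t) b ->
  (forall u, V u <-> exists2 p : 'I_m -> {poly k}, u = \sum_i ev (p i) * b i &
     forall i, (size (p i) <= r i)%N) ->
  has_dim (const X) V (\sum_i r i)%N.
Proof.
move=> fb VP; pose J i := 'I_(r i).
have -> : (\sum_i r i = #|{: {i & J i}}|)%N.
  by rewrite card_tagged sumnE big_map big_enum; apply: eq_bigr => i _; rewrite card_ord.
pose w (ij : {i & J i}) := t ^+ (val (tagged ij)) * b (tag ij).
pose pp (c : {i & J i} -> k) i : {poly k} :=
  \poly_(l < r i) (if insub l is Some j then c (Tagged J (j : J i)) else 0).
have sumE c : \sum_ij const X (c ij) * w ij = \sum_i ev (pp c i) * b i.
  transitivity (\sum_i \sum_(j : J i) const X (c (Tagged J j)) * w (Tagged J j)).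
    by rewrite sig_big_dep /=; apply: eq_bigr => -[i j] _.
  apply: eq_bigr => i _; rewrite evalp_poly mulr_suml; apply: eq_bigr => j _.
  by rewrite valK /w /= mulrA.
apply: (has_dim_basis (b := w)) => [[i j]|c cE [i j]|u /VP[p uE psz]].
- apply/VP; exists (fun l => if l == i then 'X^(val j) else 0).
    rewrite (bigD1 i) //= eqxx evalpXn big1 ?addr0 // => l /negPf ->.
    by rewrite evalp0 mul0r.
  by move=> l; case: eqP => [->|_]; rewrite ?size_poly0 // size_polyXn ltn_ord.
- move: cE; rewrite sumE.
  under eq_bigr => l _ do rewrite -rat_polyE.
  move=> /fb /(_ i) pi0; have pi : pp c i = 0.
    apply/eqP; apply: contraT => /(evalp_neq0 nt).
    by rewrite -rat_polyE pi0 rmorph0 eqxx.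
  have := congr1 (fun q : {poly k} => q`_j) pi.
  by rewrite coef_poly ltn_ord valK coef0.
- exists (fun ij : {i & J i} => (p (tag ij))`_(nat_of_ord (tagged ij))).
  rewrite sumE uE; apply: eq_bigr => i _; congr (evalp _ _ _ * _).
  apply/polyP => l; rewrite coef_poly; case: ltnP => [li|li].
    by rewrite insubT.
  by rewrite nth_default // (leq_trans (psz i)).
Qed.

End PolynomialSpan.

(** * Global duality for t : X -> P^1 *)

Section Duality.
Variables (k : closedFieldType) (X : curve k) (t : X) (m : nat) (Kt : divisor X).
Hypotheses (char0 : [pchar k] =i pred0) (nt : nonconst t)
  (hm : has_dim (rat_emb t) setT m).
(* Kt is the divisor of dt. *)
Hypotheses (Kt_fin : forall P c, 0 < ord P (t - const X c) ->
     coeff P Kt = ord P (t - const X c) - 1)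
  (Kt_inf : forall P, ord P t < 0 -> coeff P Kt = ord P t - 1).
Implicit Types (P Q : closed_point X) (u v : X) (p q : {poly k}) (D E : divisor X)
  (N d : int) (c : k) (a : ratK t).
Local Notation ev p := (evalp (const X) p t).
Local Notation e := (rat_emb t).

Let t0 : t != 0 := nonconst_neq0 nt.

Lemma dim_neq0 : (m%:R : ratK t) != 0.
Proof.
rewrite -(fmorph_eq0 e) rmorph_nat -(rmorph_nat (const X)) fmorph_eq0.
rewrite (iffLR (pcharf0P _) char0); apply/negP => /eqP m0.
have [b [_ _ gb]] := hm; have [c] := gb 1 I.
rewrite big1 => [/eqP|i _]; first by rewrite oner_eq0.
by have := ltn_ord i; rewrite {2}m0.
Qed.

Lemma finite_point P : 0 <= ord P t -> exists c, 0 < ord P (t - const X c).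
Proof.
move=> Pt; have [|c cP] := @residue_exists _ _ P t; first by rewrite vgeE.
by exists c; rewrite vgeE ?nonconst_subC // in cP.
Qed.

(** The coordinates of [u] in the dual basis are the Tr (u b_i), and [u] is a section of Kt - D iff
    they are polynomials of degree at most delta_i - 2. This is the dual of O(- delta_i) twisted by
    the canonical sheaf O(-2) of P^1. *)
Lemma sections_dual D b delta : is_reduced t D b delta ->
  exists2 b' : 'I_m -> X, lfree e b' & forall u, sections (Kt - D) u <->
    exists2 p : 'I_m -> {poly k}, u = \sum_i ev (p i) * b' i &
      forall i, p i != 0 -> (size (p i))%:Z <= delta i - 1.
Proof.
move=> bR; have [fb bP] := bR.
have [b' [fb' bb' b'E]] := dual_basis hm dim_neq0 fb.
have b_reg j : fin_reg t D (b j) /\ inf_reg t D (delta j) (b j).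
  apply/sections_twist/bP; exists (fun i => (i == j)%:R).
    rewrite (bigD1 j) //= eqxx evalp1 mul1r big1 ?addr0 // => i /negPf ->.
    by rewrite evalp0 mul0r.
  by move=> i; have [->|_] := eqVneq i j; rewrite ?eqxx // size_poly1 addrC.
have [b0 [delta0 b0R]] : exists (b0 : 'I_m -> X) delta0, is_reduced t 0 b0 delta0.
  exact: (reduced_basis 0 nt hm).
exists b' => // u; split=> [/sectionsP uK|[p uE psz]].
  have tr_poly i : exists p, e (trace hm (u * b i)) = ev p.
    apply: (regular_poly nt) => P Pt; have [c Pc] := finite_point Pt.
    have [beta fbeta [beta_reg expand]] := local_basis_fin nt b0R c.
    apply: (trace_codifferent hm (local_paramB c nt) fbeta beta_reg expand Pc) => // Q Qc.
    have -> : 1 - ord Q (t - const X c) = - coeff Q (Kt - D) + - coeff Q D.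
      by rewrite coeffB (Kt_fin (c := c)) //; ring.
    apply: vgeM; first exact: uK.
    by have [bf _] := b_reg i; apply: bf; exact: ord_subC_fin Qc.
  have /choice[p pE] := tr_poly.
  exists p => [|i pi0]; first by rewrite {1}(b'E u); apply: eq_bigr => i _; rewrite pE.
  (* The 2 is the double pole of dt at infinity on P^1: above t = oo, it is Kt plus twice the polar
     divisor that is the ramification divisor. *)
  have -> : delta i - 1 = (delta i - 2) + 1 by ring.
  apply: (degree_bound nt) => // P Pt; rewrite -pE.
  have [beta fbeta [beta_reg expand]] := local_basis_inf nt b0R.
  have Ps : 0 < ord P t^-1 by rewrite ordV oppr_gt0.
  have TzE z : e ((rat_poly t 'X) ^ z) = t ^ z by rewrite fmorphXz rat_polyE evalpX.
  have : vge P 0 (e (trace hm (e ((rat_poly t 'X) ^ (2 - delta i)) * (u * b i)))).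
    apply: (trace_codifferent hm (local_paramV nt) fbeta beta_reg expand Ps) => // Q.
    rewrite ordV oppr_gt0 => Qt; rewrite TzE.
    have -> : 1 - - ord Q t = ord Q t * (2 - delta i) +
        (- coeff Q (Kt - D) + (- coeff Q D + delta i * ord Q t)).
      by rewrite coeffB Kt_inf //; ring.
    apply: vgeM; first by rewrite vgeE ?expfz_neq0 // ordXz.
    by apply: vgeM; [exact: uK|have [_ bi] := b_reg i; exact: bi].
  rewrite traceZ rmorphM TzE mulrC -(vgeMr P 0 _ (_ : t ^ (delta i - 2) != 0)) ?expfz_neq0 //.
  rewrite -mulrA -expfzDr // (_ : _ - _ + _ = 0) ?expr0z ?mulr1; last by ring.
  by rewrite add0r ordXz // mulrC.
apply/sectionsP => P; have [Pt|Pt] := leP 0 (ord P t).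
  have [c Pc] := finite_point Pt.
  have [beta fbeta [beta_reg expand]] := local_basis_fin nt b0R c.
  have -> : - coeff P (Kt - D) = 1 - ord P (t - const X c) + coeff P D.
    by rewrite coeffB (Kt_fin (c := c)) //; ring.
  apply: (codifferent_trace char0 (hm := hm) (local_paramB c nt) fbeta beta_reg expand Pc
    (d := fun P => coeff P D)) => // v vD.
  have [a vE aP] := local_expansion_fin nt bR vD.
  rewrite vE mulr_sumr trace_sum rmorph_sum; apply: vge_sum => i _.
  rewrite mulrCA traceZ rmorphM -[0]addr0; apply: vgeM; first exact: aP.
  rewrite uE mulr_suml trace_sum rmorph_sum; apply: vge_sum => j _.
  rewrite -mulrA -rat_polyE traceZ mulrC [b' j * _]mulrC bb' rmorphM rat_polyE.
  rewrite rmorph_nat -(rmorph_nat (const X)); apply: vgeZ.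
  by apply: vge_evalp; rewrite vgeE.
have [beta fbeta [beta_reg expand]] := local_basis_inf nt b0R.
have Ps : 0 < ord P t^-1 by rewrite ordV oppr_gt0.
(* Multiplication by t^2 turns the condition imposed by Kt at infinity into that of the inverse
   different. *)
have tt0 : t ^+ 2 != 0 by rewrite expf_neq0.
rewrite -(vgeMr _ _ _ tt0) ordX //.
have -> : - coeff P (Kt - D) + ord P t *+ 2 = 1 - ord P t^-1 + coeff P D.
  by rewrite coeffB Kt_inf // ordV mulr2n; ring.
apply: (codifferent_trace char0 (hm := hm) (local_paramV nt) fbeta beta_reg expand Ps
  (d := fun P => coeff P D)) => // v vD.
have [|a vE aP] := local_expansion_inf nt bR (v := v).
  by move=> Q Qt; apply: vD; rewrite ordV oppr_gt0.
rewrite vE mulr_sumr trace_sum rmorph_sum; apply: vge_sum => i _.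
rewrite mulrCA traceZ rmorphM.
have -> : 0 = - delta i * ord P t + (delta i * ord P t) by ring.
apply: vgeM; first exact: aP.
rewrite uE -mulrA mulr_suml trace_sum rmorph_sum; apply: vge_sum => j _.
have -> : ev (p j) * b' j * (t ^+ 2 * b i) = e (rat_poly t (p j * 'X^2)) * (b i * b' j).
  by rewrite rat_polyE evalpM evalpXn; ring.
rewrite traceZ bb' rmorphM rat_polyE rmorph_nat -(rmorph_nat (const X)).
rewrite [X in vge _ _ X]mulrC.
have [ij|ij] := eqVneq i j; last by rewrite /= rmorph0 mul0r vge0.
apply: vgeZ; rewrite -ij evalpM evalpXn.
have -> : delta i * ord P t = (delta i - 2) * ord P t + ord P t *+ 2 by rewrite mulr2n; ring.
apply: vgeM; last by rewrite vgeE // ordX.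
have [->|pi0] := eqVneq (p i) 0; first by rewrite evalp0 vge0.
by apply: vge_evalp_pole => //; have := psz i pi0; lia.
Qed.

End Duality.

Section RiemannRochAt.
Variables (k : closedFieldType) (X : curve k) (t : X) (m : nat) (Kt : divisor X).
Hypotheses (char0 : [pchar k] =i pred0) (nt : nonconst t)
  (hm : has_dim (rat_emb t) setT m).
Hypotheses (Kt_fin : forall P c, 0 < ord P (t - const X c) ->
     coeff P Kt = ord P (t - const X c) - 1)
  (Kt_inf : forall P, ord P t < 0 -> coeff P Kt = ord P t - 1).
Implicit Types (P Q : closed_point X) (u v : X) (p q : {poly k}) (D E : divisor X)
  (N d : int).
Local Notation ev p := (evalp (const X) p t).

Lemma size_posn p z : (size p <= posn z)%N <-> (p != 0 -> (size p)%:Z <= z).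
Proof.
have [->|p0] := eqVneq p 0; first by rewrite size_poly0.
have : (0 < size p)%N by rewrite size_poly_gt0.
by case: z => n /=; split=> [|/(_ isT)]; lia.
Qed.

Lemma posn_le0 z : z <= 0 -> posn z = 0%N.
Proof. by case: z => [[|n]|n]. Qed.

Lemma ell_reduced D b delta : is_reduced t D b delta ->
  ell D = (\sum_(i < m) posn (1 - delta i))%N.
Proof.
move=> [fb bP]; apply: ell_eq; apply: (poly_span_dim nt fb) => u.
have <- : twist t D 0 = D by rewrite /twist scale0r addr0.
rewrite bP; split=> -[p uE pN]; exists p => // i.
  by apply/size_posn => pi0; have := pN i pi0; lia.
by move=> pi0; have := iffLR (size_posn _ _) (pN i) pi0; lia.
Qed.

Lemma ell_dual D b delta : is_reduced t D b delta ->
  ell (Kt - D) = (\sum_(i < m) posn (delta i - 1))%N.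
Proof.
move=> /(sections_dual char0 nt hm Kt_fin Kt_inf)[b' fb' b'P].
apply: ell_eq; apply: (poly_span_dim nt fb') => u; rewrite b'P.
split=> -[p uE pN]; exists p => // i.
  exact: (iffRL (size_posn _ _) (pN i)).
exact: (iffLR (size_posn _ _) (pN i)).
Qed.

Definition chi D : int := (ell D)%:Z - (ell (Kt - D))%:Z.

(** The identity max(z, 0) - max(- z, 0) = z is applied to each z = 1 - delta_i. *)
Lemma chi_reduced D b delta : is_reduced t D b delta ->
  chi D = \sum_(i < m) (1 - delta i).
Proof.
move=> bR; rewrite /chi (ell_reduced bR) (ell_dual bR).
rewrite !(big_morph Posz PoszD (erefl _)) -sumrB; apply: eq_bigr => i _.
by move: (delta i) => z; rewrite -[z - 1]opprB; case: (1 - z) => [[|n]|n] /=; lia.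
Qed.

Lemma reduced_exists D : exists (b : 'I_m -> X) delta, is_reduced t D b delta.
Proof. exact: (reduced_basis D nt hm). Qed.

Lemma chi_twist D N : chi (twist t D N) = chi D + N * m%:Z.
Proof.
have [b [delta bR]] := reduced_exists D.
rewrite (chi_reduced bR) (chi_reduced (is_reduced_twist nt N bR)).
under eq_bigr => i _ do rewrite opprB addrCA [N + _]addrC.
by rewrite big_split sumr_const card_ord -mulr_natr natz.
Qed.

Lemma dual_vanish D : exists N0 : nat, forall N : nat, (N0 <= N)%N ->
  ell (Kt - twist t D N) = 0%N.
Proof.
have [b [delta bR]] := reduced_exists D.
exists (\sum_i `|delta i|)%N => N N_ge.
rewrite (ell_dual (is_reduced_twist nt N bR)); apply: big1 => i _.
have : (`|delta i| <= N)%N.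
  by apply: leq_trans N_ge; rewrite (bigD1 i) //= leq_addr.
by move=> dN; apply: posn_le0; lia.
Qed.

(** After a large twist the dual terms vanish and [chi] is [ell], which grows by at most 1;
    [chi_twist] carries this back to [D]. *)
Lemma chi_addpt_le D P : chi (D + << P >>) <= chi D + 1.
Proof.
have [N1 N1P] := dual_vanish D; have [N2 N2P] := dual_vanish (D + << P >>).
pose N := maxn N1 N2.
have := chi_twist (D + << P >>) N; have := chi_twist D N; rewrite {1 3}/chi.
rewrite N1P ?leq_maxl // N2P ?leq_maxr // !subr0.
have -> : twist t (D + << P >>) N = twist t D N + << P >> by rewrite /twist addrAC.
by have /andP[_] := ell_addpt (twist t D N) P; lia.
Qed.

Lemma chi_effective_le D E : (forall P, 0 <= coeff P E) ->
  chi (D + E) <= chi D + deg E.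
Proof.
have point n P D' : chi (D' + << n%:Z *g P >>) <= chi D' + n%:Z.
  elim: n => [|n IH]; first by rewrite freegU0 !addr0.
  have -> : (<< n.+1%:Z *g P >> : divisor X) = << n%:Z *g P >> + << P >>.
    by rewrite freegUD -addn1 PoszD.
  by rewrite addrA (le_trans (chi_addpt_le _ _)) // -addn1 PoszD addrA lerD2r.
move=> E0; rewrite -(freeg_sumE E) raddf_sum /=.
elim: (dom E) D => [|P s IH] D; first by rewrite !big_nil !addr0.
rewrite !big_cons !addrA (le_trans (IH _)) // lerD2r degU.
by have := point `|coeff P E|%N P D; rewrite gez0_abs.
Qed.

Lemma chi_dvs D v : v != 0 -> chi (D + dvs v) = chi D.
Proof.
move=> v0; rewrite /chi ell_dvs //; congr (_ - (_)%:Z).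
have -> : Kt - (D + dvs v) = Kt - D + dvs v^-1.
  by rewrite opprD addrA; congr (_ + _); apply: divisor_eqP => P;
     rewrite coeffN !coeff_dvs ordV.
by rewrite ell_dvs ?invr_eq0.
Qed.

(** [zeros s] is a fibre of [t], linearly equivalent to the polar one, for which [chi_twist]
    applies. *)
Lemma chi_local_param D s : local_param t s -> zeros s^-1 = zeros t^-1 \/ s = t^-1 ->
  chi (D + zeros s) = chi D + m%:Z.
Proof.
move=> [ns _ _] sE; have twist1 : twist t D 1 = D + zeros t^-1 by rewrite /twist scale1r.
have twist1E := chi_twist D 1; rewrite mul1r twist1 in twist1E.
case: sE => [sE|->] //; rewrite -twist1E -sE -(@chi_dvs (D + zeros s^-1) s) ?nonconst_neq0 //.
by rewrite dvs_zeros [zeros s - _]addrC addrA addrK.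
Qed.

Lemma zeros_polesB c : zeros (t - const X c)^-1 = zeros t^-1.
Proof.
apply: divisor_eqP => P; rewrite !coeff_zeros !ordV.
have [Pt|Pt] := ltP (ord P t) 0.
  have [||_ ->//] := @ord_dominant _ _ P t (- const X c).
    exact: nonconst_neq0.
  by rewrite vgeN; apply: vgeW (vge_const P c); lia.
have : 0 <= ord P (t - const X c).
  rewrite -vgeE ?nonconst_subC //; apply: vgeB; last exact: vge_const.
  by rewrite vgeE // nonconst_neq0.
lia.
Qed.

Lemma param_at P : exists2 s, local_param t s &
  0 < ord P s /\ (zeros s^-1 = zeros t^-1 \/ s = t^-1).
Proof.
have [Pt|Pt] := leP 0 (ord P t).
  have [c Pc] := finite_point nt Pt; exists (t - const X c); first exact: local_paramB.
  by split=> //; left; exact: zeros_polesB.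
exists t^-1; first exact: local_paramV.
by split; [rewrite ordV oppr_gt0|right].
Qed.

(* Summing over the fibre of t through P, chi grows by exactly m, whereas the
   fibre has at most m points, each of which contributes at most 1. *)
Lemma chi_addpt D P : chi (D + << P >>) = chi D + 1.
Proof.
apply: le_anti; rewrite chi_addpt_le /=.
have [s ps [Ps sE]] := param_at P; have [ns _ _] := ps.
have := chi_local_param D ps sE; have := deg_zeros_le ps hm.
have := @chi_effective_le (D + << P >>) (zeros s - << P >>).
have -> : D + << P >> + (zeros s - << P >>) = D + zeros s by rewrite [zeros s - _]addrC addrA addrK.
rewrite degB degU => H; have : forall Q, 0 <= coeff Q (zeros s - << P >>).
  move=> Q; rewrite coeffB coeff_zeros coeff_pt.
  by have [<-|_] := eqVneq P Q; lia.
move=> /H; move: (chi _) (chi _) (chi _) (deg _) => a b d f.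
lia.
Qed.

Lemma chi_deg D : chi D = deg D + chi 0.
Proof.
elim/divisor_ind: D => [|D P IH|D P IH]; first by rewrite deg0 add0r.
  by rewrite chi_addpt IH degD degU addrAC.
have := chi_addpt (D - << P >>) P; rewrite subrK IH degB degU; lia.
Qed.

(** [chi] is invariant under linear equivalence and differs from the degree by a constant. *)
Lemma deg_dvs_at v : v != 0 -> deg (dvs v) = 0.
Proof.
by move=> v0; have := chi_dvs 0 v0; rewrite add0r chi_deg; lia.
Qed.

End RiemannRochAt.

(** * Orders of derivatives and the divisor of dt *)

Section TruncatedExpansions.
Variables (k : closedFieldType) (X : curve k) (P : closed_point X) (u : X).
Hypothesis u1 : ord P u = 1.

Lemma truncated_expansion n v : vge P 0 v -> exists p w, vge P 0 w /\
  v = evalp (const X) p u + u ^+ n * w.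
Proof.
have u0 : u != 0 by apply/eqP => u0; move: u1; rewrite u0 ord_zero.
move=> v_ge; elim: n => [|n [p [w [w_ge vE]]]].
  by exists 0, v; rewrite evalp0 add0r expr0 mul1r.
have [c wc] := residue_exists w_ge.
exists (p + c *: 'X^n), ((w - const X c) / u); split.
  by rewrite -(vgeMr _ _ _ u0) divfK // u1.
rewrite vE evalpD evalpZ evalpXn exprSr; field.
exact: u0.
Qed.

End TruncatedExpansions.

Section Derivations.
Variables (k : closedFieldType) (X : curve k).
Hypothesis char0 : [pchar k] =i pred0.
Implicit Types (P : closed_point X) (u v w t : X).

Section Derivation.
Variable d : X -> X.
Hypothesis dP : derivation d.
Let dD : forall u v, d (u + v) = d u + d v. Proof. by case: dP. Qed.
Let dM : forall u v, d (u * v) = u * d v + v * d u. Proof. by case: dP. Qed.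
Let dC : forall c, d (const X c) = 0. Proof. by case: dP. Qed.

Lemma derivation0 : d 0 = 0.
Proof. by rewrite -[X in d X](rmorph0 (const X)) dC. Qed.

Lemma derivation_sum (I : Type) (r : seq I) (f : I -> X) :
  d (\sum_(i <- r) f i) = \sum_(i <- r) d (f i).
Proof. exact: (big_morph d dD derivation0). Qed.

Lemma derivation_evalp p u :
  d (evalp (const X) p u) = evalp (const X) p^`() u * d u.
Proof.
elim/poly_ind: p => [|p c IH]; first by rewrite deriv0 !evalp0 mul0r derivation0.
rewrite derivD derivC addr0 derivM derivX mulr1 !evalpD !evalpM evalpC evalpX.
by rewrite dD dC addr0 dM IH; ring.
Qed.

Lemma derivationV v : v != 0 -> d v = - (v ^+ 2 * d v^-1).
Proof.
move=> v0; have : d (v * v^-1) = 0 by rewrite divff // -(rmorph1 (const X)) dC.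
rewrite dM addrC => /eqP; rewrite addr_eq0 => /eqP vE.
by rewrite -[LHS](mulKf v0) mulrCA vE mulrN expr2 mulrA.
Qed.

Section Uniformizer.
Variables (P : closed_point X) (u : X).
Hypotheses (u1 : ord P u = 1) (du : d u = 1).

Let nu : nonconst u. Proof. by apply: (@ord_nonconst _ _ P); rewrite u1. Qed.
Let u0 : u != 0 := nonconst_neq0 nu.
Let Pu : 0 < ord P u. Proof. by rewrite u1. Qed.

(* A bounded pole order suffices: it propagates to arbitrarily long truncated
   power series expansions v = c0 + c1 u + .. + u^N w. *)
Lemma derivation_of_bounded (N : nat) :
  (forall v, vge P 0 v -> vge P (- N%:Z) (d v)) ->
  forall v, vge P 0 v -> vge P 0 (d v).
Proof.
move=> bound v v_ge; have [p [w [w_ge ->]]] := truncated_expansion u1 N.+1 v_ge.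
have u_ge : vge P 0 u by rewrite vgeE // u1.
rewrite dD; apply: vgeD.
  by rewrite derivation_evalp du mulr1; apply: vge_evalp.
rewrite dM; apply: vgeD.
  have -> : 0 = N.+1%:Z + (- N%:Z - 1) by lia.
  apply: vgeM; first by rewrite vgeE ?expf_neq0 // ordX // u1 natz.
  by apply: vgeW (bound w w_ge); lia.
have -> : u ^+ N.+1 = evalp (const X) 'X^(N.+1) u by rewrite evalpXn.
rewrite derivation_evalp du mulr1 -[0]addr0; apply: vgeM => //.
exact: vge_evalp.
Qed.

Let derivation_div x y : y != 0 -> d (x / y) = (d x * y - x * d y) / y ^+ 2.
Proof.
move=> y0; have := derivationV y0; rewrite dM => ->; field.
exact: y0.
Qed.

Let ord_unit_evalp q : q.[0] != 0 -> evalp (const X) q u != 0 /\ ord P (evalp (const X) q u) = 0.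
Proof.
by apply: (ord_evalp_unit nu (c := 0)); rewrite rmorph0 subr0.
Qed.

Let derivation_rat (a : ratK u) : vge P 0 (rat_emb u a) -> vge P 0 (d (rat_emb u a)).
Proof.
have u_ge : vge P 0 u by rewrite vgeE // u1.
have [->|a0] := eqVneq a 0; first by rewrite rmorph0 derivation0 // vge0.
have [p [q [q0 aE]]] := ratP a.
have p0 : evalp (const X) p u != 0.
  by apply: contraNneq a0 => p0; rewrite -(fmorph_eq0 (rat_emb u)) aE p0 mul0r.
have nz r : evalp (const X) r u != 0 -> r != 0.
  by apply: contraNneq => ->; rewrite evalp0.
have [l [p' p'0 pE]] := multiplicity_XsubC p 0.
have [n [q' q'0 qE]] := multiplicity_XsubC q 0.
rewrite (nz _ p0) /= in p'0; rewrite (nz _ q0) /= in q'0.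
rewrite subr0 in pE qE.
have [p'u op'] := ord_unit_evalp p'0; have [q'u oq'] := ord_unit_evalp q'0.
have evX i : evalp (const X) ('X ^+ i) u = u ^+ i by rewrite evalpXn.
rewrite aE pE qE !evalpM !evX => a_ge.
have ln : (n <= l)%N.
  move: a_ge; rewrite vgeE; last by rewrite !mulf_neq0 ?invr_eq0 ?mulf_neq0 ?expf_neq0.
  rewrite ord_div ?mulf_neq0 ?expf_neq0 // !ordM ?expf_neq0 // op' oq' !ordX //.
  by rewrite u1 !natz !add0r subr_ge0 lez_nat.
have -> : evalp (const X) p' u * u ^+ l / (evalp (const X) q' u * u ^+ n) =
    evalp (const X) (p' * 'X^(l - n)) u / evalp (const X) q' u.
  rewrite evalpM evalpXn -{1}(subnK ln) exprD; field.
  by rewrite q'u expf_neq0.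
rewrite derivation_div // !derivation_evalp // du !mulr1 -[0]addr0; apply: vgeM.
  by apply: vgeB; rewrite -[0]addr0; apply: vgeM; apply: vge_evalp.
by rewrite vgeE ?invr_eq0 ?expf_neq0 // ordV ordX // oq' mul0rn oppr0.
Qed.

(** Over rational functions in [u], on which [d] is ordinary differentiation, the semilocal ring
    above u = 0 has a finite basis [beta]. So [d] has bounded poles at [P] on that ring, and this is
    what [derivation_of_bounded] asks for. *)
Lemma derivation_reg v : vge P 0 v -> vge P 0 (d v).
Proof.
have [m hm] := finite_over nu.
have [b [delta bR]] := reduced_basis 0 nu hm.
have [beta _ [beta_reg expand]] := local_basis_fin nu bR 0.
rewrite rmorph0 subr0 in beta_reg expand.
pose N := (\sum_i `|ord P (d (beta i))|)%N.
have reg_bound w : reg u w -> vge P (- N%:Z) (d w).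
  move=> /expand[a -> a_reg]; rewrite derivation_sum //; apply: vge_sum => i _.
  rewrite dM; apply: vgeD.
    have oN : - N%:Z <= 0 + ord P (d (beta i)).
      have : (`|ord P (d (beta i))| <= N)%N by rewrite /N (bigD1 i) //= leq_addr.
      by lia.
    apply: vgeW oN _; apply: vgeM; [exact: a_reg|exact: vge_ord].
  have N0 : - N%:Z <= 0 + 0 by lia.
  apply: vgeW N0 _; apply: vgeM; first exact: beta_reg.
  by apply: derivation_rat; exact: a_reg.
apply: (@derivation_of_bounded N) => {}v v_ge.
have [S uS SP] := finite_zeros nu.
pose M := (\sum_(Q <- S) `|ord Q v|).+1.
(* [y] is a unit at [P] and kills the poles of [v] at the other zeros of [u], so that y v lies in
   the semilocal ring. *)
have [y [y1 yS]] : exists y, vge P M (y - 1) /\ forall Q, Q \in rem P S -> vge Q M y.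
  by apply: approx_one; rewrite mem_rem_uniqF.
have [y0 oy] : y != 0 /\ ord P y = 0.
  rewrite -(subrK 1 y) addrC -[X in _ /\ _ = X](ord_one P); apply: ord_dominant.
    exact: oner_neq0.
  by rewrite ord_one; apply: vgeW y1; rewrite /M; lia.
have yP : vge P 0 y by rewrite vgeE // oy.
have yQ Q : 0 < ord Q u -> Q != P -> vge Q M y.
  by move=> Qu QP; apply: yS; rewrite mem_rem_uniq // inE QP SP.
have ry : reg u y.
  by move=> Q Qu; have [->//|QP] := eqVneq Q P; apply: vgeW (yQ Q Qu QP).
have ryv : reg u (y * v).
  move=> Q Qu; have [->|QP] := eqVneq Q P; first by rewrite -[0]addr0; apply: vgeM.
  have Mv : 0 <= M%:Z + ord Q v.
    have QS : Q \in S by rewrite SP.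
    have : (`|ord Q v| < M)%N by rewrite /M ltnS (big_rem Q) //= leq_addr.
    by lia.
  by apply: vgeW Mv _; apply: vgeM; [exact: yQ|exact: vge_ord].
have -> : v = y * v / y by rewrite mulrC mulKf.
rewrite derivation_div //.
have yv_ge : vge P 0 (y * v) by rewrite -[0]addr0; apply: vgeM.
have -> : - N%:Z = - N%:Z + 0 by rewrite addr0.
apply: vgeM; last first.
  by rewrite vgeE ?invr_eq0 ?expf_neq0 // ordV ordX // oy mul0rn oppr0.
apply: vgeB.
  by rewrite -[- _]addr0; apply: vgeM => //; exact: reg_bound.
by rewrite -[- _]add0r; apply: vgeM => //; exact: reg_bound.
Qed.

Lemma ord_derivation v : v != 0 -> ord P v != 0 -> d v != 0 /\ ord P (d v) = ord P v - 1.
Proof.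
have pos n w : w != 0 -> ord P w = n.+1%:Z -> d w != 0 /\ ord P (d w) = n%:Z.
  move=> w0 wn; pose y := w / u ^+ n.+1.
  have un0 i : u ^+ i != 0 by rewrite expf_neq0.
  have y0 : y != 0 by rewrite mulf_neq0 ?invr_eq0.
  have oy : ord P y = 0 by rewrite ord_div // wn ordX // u1 natz subrr.
  (* The first term dominates, n + 1 being nonzero in characteristic 0; this is where ramification
     is tame. *)
  have -> : d w = const X n.+1%:R * (u ^+ n * y) + u ^+ n.+1 * d y.
    rewrite -[w](divfK (un0 n.+1)) -/y [y * _]mulrC dM.
    have -> : d (u ^+ n.+1) = const X n.+1%:R * u ^+ n.
      rewrite -(evalpXn (const X)) derivation_evalp // derivXn du mulr1.
      by rewrite -scaler_nat evalpZ evalpXn.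
    by ring.
  have n0 : const X n.+1%:R != 0.
    by rewrite fmorph_eq0 (iffLR (pcharf0P _) char0).
  have oL : ord P (const X n.+1%:R * (u ^+ n * y)) = n%:Z.
    rewrite ordM //; last by rewrite mulf_neq0.
    by rewrite ord_const ordM // oy ordX // u1 natz add0r addr0.
  rewrite -[X in _ /\ _ = X]oL; apply: ord_dominant.
    by apply: mulf_neq0 => //; exact: mulf_neq0.
  rewrite oL -[n%:Z + 1]addr0; apply: vgeM.
    by rewrite vgeE // ordX // u1 natz -PoszD addn1.
  by apply: derivation_reg; rewrite vgeE // oy.
move=> v0; case vn: (ord P v) => [[|n]|n] // _.
  by have [-> ->] := pos n v v0 vn; split=> //; lia.
have [||dv0 odv] := pos n v^-1; rewrite ?invr_eq0 // ?ordV ?vn //.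
rewrite derivationV // oppr_eq0 ordN mulf_neq0 ?expf_neq0 // ordM ?expf_neq0 // odv ordX //.
by rewrite vn; split=> //; lia.
Qed.

End Uniformizer.
End Derivation.

(** Removing div f from the divisor of f dt leaves that of dt, with the orders required of [Kt] by
    the duality. *)
Lemma canonical_coeff D f t : f != 0 -> nonconst t ->
  (forall P, exists u d, [/\ ord P u = 1, derivation d, d u = 1 &
     coeff P D = ord P (f * d t)]) ->
  (forall P c, 0 < ord P (t - const X c) ->
     coeff P (D - dvs f) = ord P (t - const X c) - 1) /\
  (forall P, ord P t < 0 -> coeff P (D - dvs f) = ord P t - 1).
Proof.
move=> f0 nt DP; split=> [P c Pc|P Pt]; have [u [d [u1 dd du DE]]] := DP P.
  have dtc : d (t - const X c) = d t.
    by have [dD _ dC] := dd; rewrite dD -rmorphN dC addr0.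
  have [||dt0 odt] := ord_derivation dd u1 du (v := t - const X c).
  - exact: nonconst_subC.
  - by rewrite gt_eqF.
  rewrite dtc in dt0 odt.
  by rewrite coeffB coeff_dvs DE ordM // odt; ring.
have [||dt0 odt] := ord_derivation dd u1 du (v := t); first exact: nonconst_neq0.
  by rewrite lt_eqF.
by rewrite coeffB coeff_dvs DE ordM // odt; ring.
Qed.

End Derivations.

(** * Divisor classes, and Riemann-Roch for canonical divisors *)

Section Classes.
Variables (k : closedFieldType) (X : curve k).
Implicit Types (D E : divisor X) (L : Pic X) (v : X).

Lemma divclassD D E : divclass (D + E) = divclass D + divclass E.
Proof. by rewrite /divclass !piE. Qed.

Lemma divclassN D : divclass (- D) = - divclass D.
Proof. by rewrite /divclass !piE. Qed.

Lemma divclassB D E : divclass (D - E) = divclass D - divclass E.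
Proof. by rewrite divclassD divclassN. Qed.

Lemma divclass_eq D E : divclass D = divclass E <->
  exists2 v, v != 0 & D = E + dvs v.
Proof.
have -> : divclass D = divclass E <-> D - E \in principal X.
  by rewrite Quotient.idealrBE; split=> [DE|/eqP//]; apply/eqP.
split=> [/asboolP[v [v0 vD]]|[v v0 ->]].
  exists v => //; rewrite -(subrK E D) addrC; congr (_ + _).
  by apply: divisor_eqP => P; rewrite vD coeff_dvs.
rewrite addrAC subrr add0r; apply/asboolP; exists v; split=> // P.
exact: coeff_dvs.
Qed.

Lemma ell_divclass D E : divclass D = divclass E -> ell D = ell E.
Proof. by move=> /divclass_eq[v v0 ->]; rewrite ell_dvs. Qed.

Lemma h0_ell L n : h0 L n <-> exists2 D, divclass D = L & ell D = n.
Proof.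
split=> [[D [DL /dim_over_has_dim/ell_eq Dn]]|[D DL <-]]; first by exists D.
exists D; split=> //; apply: has_dim_dim_over; first exact: sections_lsub.
exact: ell_dim.
Qed.

End Classes.

Section RiemannRoch.
Variables (k : closedFieldType) (X : curve k).
Hypothesis char0 : [pchar k] =i pred0.
Implicit Types (P : closed_point X) (D E : divisor X) (v : X).

Lemma canonical_riemann_roch D0 : canonical_divisor D0 ->
  (exists chi0, forall D, (ell D)%:Z - (ell (D0 - D))%:Z = deg D + chi0) /\
  forall v, v != 0 -> deg (dvs v : divisor X) = 0.
Proof.
move=> [f [t [f0 nt D0P]]]; have [m hm] := finite_over nt.
have [Kt_fin Kt_inf] := canonical_coeff char0 f0 nt D0P.
split; last by move=> v; exact: (deg_dvs_at char0 nt hm Kt_fin Kt_inf).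
exists (chi (D0 - dvs f) 0) => D.
have <- := chi_deg char0 nt hm Kt_fin Kt_inf D; rewrite /chi.
congr (_ - (_)%:Z); rewrite -(ell_dvs (D0 - dvs f - D) f0).
by congr ell; rewrite addrAC subrK.
Qed.

Section Canonical.
Variables (D0 : divisor X) (n : nat).
Hypotheses (cD0 : canonical_divisor D0) (gX : genus X n).

Lemma deg_dvs v : v != 0 -> deg (dvs v : divisor X) = 0.
Proof. by have [_] := canonical_riemann_roch cD0; apply. Qed.

Lemma ell_neg D : deg D < 0 -> ell D = 0%N.
Proof.
move=> D_lt; apply/eqP; rewrite -leqn0 leqNgt; apply/negP => /ell_gt0[u u0 /sectionsP uD].
have : 0 <= deg (D + dvs u).
  rewrite -(freeg_sumE (D + dvs u)) raddf_sum /=; apply: sumr_ge0 => P _.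
  by rewrite degU coeffD coeff_dvs; have := uD P; rewrite vgeE //; lia.
by rewrite degD deg_dvs // addr0 leNgt D_lt.
Qed.

(** [genus] may be witnessed by a canonical divisor [D1] other than [D0]. The constant of [D1] is
    read off at the divisor 0, and it agrees with that of [D0] on a divisor [E] of degree so large
    that both dual terms vanish. *)
Theorem riemann_roch D : (ell D)%:Z - (ell (D0 - D))%:Z = deg D + 1 - n%:Z.
Proof.
have [[chi0 chi0P] _] := canonical_riemann_roch cD0.
have [K1 [[D1 [cD1 D1K]] /h0_ell[D2 D2K D2n]]] := gX.
have [[chi1 chi1P] _] := canonical_riemann_roch cD1.
have {D2K D2n} D1n : ell D1 = n by rewrite -D2n; apply: ell_divclass; rewrite D1K.
have chi1E : chi1 = 1 - n%:Z.
  by have := chi1P 0; rewrite subr0 ell0 D1n deg0 add0r => <-.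
have [P _] : exists P : closed_point X, True.
  have [f [t [_ nt _]]] := cD0.
  by have [P _] := zero_exists nt; exists P.
pose N := (`|deg D0| + `|deg D1|).+1.
pose E : divisor X := << N%:Z *g P >>.
have E0 : ell (D0 - E) = 0%N by apply: ell_neg; rewrite degB degU /N; lia.
have E1 : ell (D1 - E) = 0%N by apply: ell_neg; rewrite degB degU /N; lia.
have := chi0P E; have := chi1P E; rewrite E0 E1 chi1E => -> /addrI chi0E.
by rewrite chi0P -chi0E addrA.
Qed.

Lemma ell_canonical : ell D0 = n.
Proof.
by have := riemann_roch 0; rewrite subr0 ell0 deg0 add0r; lia.
Qed.

Lemma deg_canonical : deg D0 = 2 * n%:Z - 2.
Proof.
by have := riemann_roch D0; rewrite subrr ell0 ell_canonical; lia.
Qed.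

(** [Pic_deg] and [h0] may pick different divisors of the class; [ell] depends on the class only. *)
Lemma W_ell r (L : Pic X) : W X r L <->
  exists D, [/\ divclass D = L, deg D = r%:Z & (0 < ell D)%N].
Proof.
split=> [[[D [DL Dr]] [m [/h0_ell[E EL <-] Em]]]|[D [DL Dr D0l]]].
  by exists D; split=> //; rewrite (ell_divclass (etrans DL (esym EL))).
split; first by exists D.
by exists (ell D); split=> //; apply/h0_ell; exists D.
Qed.

End Canonical.
End RiemannRoch.

(** * Morphisms and inertia *)

Section Morphisms.
Variables (k : closedFieldType) (X Y : curve k) (phi : morphism X Y).
Implicit Types (P : closed_point X) (Q : closed_point Y).
Local Notation h := (pull phi).

Lemma pull_nonconst v : nonconst v -> nonconst (h v).
Proof.
move=> nv [c _ vc]; apply: nv; exists c => //; apply: (fmorph_inj h).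
by rewrite pull_const.
Qed.

Lemma pull_evalp p v : h (evalp (const Y) p v) = evalp (const X) p (h v).
Proof.
rewrite !evalpE rmorph_sum; apply: eq_bigr => i _.
by rewrite rmorphM rmorphXn pull_const.
Qed.

(** The order at [P] is restricted to k(Y) and normalized. It is nontrivial there: if the pullback
    of z has order 0, that of z - c vanishes at [P] for the residue c. *)
Lemma image_exists P : exists Q, maps phi P Q.
Proof.
have [z tz _] := function_fieldP Y.
have nz := transcendental_nonconst tz.
pose o v := ord P (h v).
have o0 : o 0 = 0 by rewrite /o rmorph0 ord_zero.
have oM u v : u != 0 -> v != 0 -> o (u * v) = o u + o v.
  by move=> u0 v0; rewrite /o rmorphM ordM ?fmorph_eq0.
have oD u v : u != 0 -> v != 0 -> u + v != 0 -> Num.min (o u) (o v) <= o (u + v).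
  move=> u0 v0 uv0; rewrite /o rmorphD; apply: ordD; rewrite ?fmorph_eq0 //.
  by rewrite -rmorphD fmorph_eq0.
have oC c : o (const Y c) = 0 by rewrite /o pull_const ord_const.
have [|Q [e [e0 oE]]] := normalize_valuation o0 oM oD oC.
  have [oz|oz] := eqVneq (o z) 0; last by exists z.
  have [|c zc] := @residue_exists _ _ P (h z).
    by rewrite vgeE ?nonconst_neq0 ?[ord _ _]oz //; exact: pull_nonconst.
  exists (z - const Y c); rewrite /o rmorphB pull_const.
  move: zc; rewrite vgeE; last exact/nonconst_subC/pull_nonconst.
  by move: (ord _ _) => i; lia.
by exists Q, e.
Qed.

(** By Riemann-Roch, n + 1 poles at [Q] suffice for a nonconstant [u] without other poles; a zero of
    the pullback of [u^-1] then lies above [Q]. *)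
Lemma preimage_exists Q (D0 : divisor Y) n : [pchar k] =i pred0 ->
  canonical_divisor D0 -> genus Y n -> exists P, maps phi P Q.
Proof.
move=> char0 cD0 gY; pose D : divisor Y := << n.+1%:Z *g Q >>.
have ellD : (1 < ell D)%N.
  have := riemann_roch char0 cD0 gY D; rewrite {3}/D degU.
  by move: (ell D) (ell _) => a b; lia.
have [u uD nu] : exists2 u, sections D u & nonconst u.
  apply: contrapT => no; move: ellD; rewrite ltnNge => /negP; apply.
  apply: (has_dim_leq (ell_dim D) (sections0_dim Y)) => u uD.
  have [[c _ <-]|nu] := pselect (range (const Y) u); last by case: no; exists u.
  by apply/sectionsP => P; rewrite coeff0 oppr0 vge_const.
have nv := nonconstV nu; have [P Pv] := zero_exists (pull_nonconst nv).
exists P; have [Q' [e [e0 eP]]] := image_exists P.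
suff -> : Q = Q' by exists e.
move: Pv; rewrite eP pmulrn_lgt0 // ordV oppr_gt0 => Q'u.
move/sectionsP/(_ Q'): uD; rewrite /D coeffU.
case: eqP => // _; rewrite mulr0 oppr0 vgeE; first by rewrite leNgt Q'u.
exact: nonconst_neq0.
Qed.

Lemma rat_pull v (a : ratK v) : exists a' : ratK (h v), rat_emb (h v) a' = h (rat_emb v a).
Proof.
have [p [q [q0 ->]]] := ratP a; exists (rat_poly _ p / rat_poly _ q).
by rewrite !fmorph_div !rat_polyE !pull_evalp.
Qed.

Lemma rat_unpull v (a : ratK (h v)) : exists a' : ratK v, h (rat_emb v a') = rat_emb (h v) a.
Proof.
have [p [q [q0 ->]]] := ratP a; exists (rat_poly _ p / rat_poly _ q).
by rewrite !fmorph_div !rat_polyE !pull_evalp.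
Qed.

Lemma dim_tower v n d N : has_dim (rat_emb v) setT n -> has_dim h setT d ->
  has_dim (rat_emb (h v)) setT N -> (N <= n * d)%N.
Proof.
move=> [a [_ _ ga]] [b [_ _ gb]] [c [_ fc _]].
rewrite -[N]card_ord -[n]card_ord -[d]card_ord -card_prod.
apply: (steinitz fc (c := fun ij : 'I_n * 'I_d => h (a ij.1) * b ij.2)) => l.
have [y ->] := gb (c l) I.
have /choice[r rE] : forall j, exists r : 'I_n -> ratK (h v),
    h (y j) = \sum_i rat_emb (h v) (r i) * h (a i).
  move=> j; have [x ->] := ga (y j) I; have /choice[r rE] := fun i => rat_pull (x i).
  by exists r; rewrite rmorph_sum; apply: eq_bigr => i _; rewrite rmorphM rE.
exists (fun ij => r ij.2 ij.1).
rewrite -(pair_bigA _ (fun i j => rat_emb (h v) (r j i) * (h (a i) * b j))) /=.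
rewrite exchange_big /=; apply: eq_bigr => j _; rewrite rE mulr_suml.
by apply: eq_bigr => i _; rewrite mulrA.
Qed.

Lemma dim_tower2 v n N w : has_dim (rat_emb v) setT n ->
  has_dim (rat_emb (h v)) setT N ->
  (forall x y, h x + h y * w = 0 -> y = 0) -> (2 * n <= N)%N.
Proof.
move=> [a [_ fa _]] hN hw.
rewrite -card_bool -[n]card_ord -card_prod.
pose b (bi : bool * 'I_n) := h (a bi.2) * (if bi.1 then w else 1).
apply: (has_dim_free (b := b) hN) => // c.
have /choice[r rE] : forall bi, exists r : ratK v, h (rat_emb v r) = rat_emb (h v) (c bi).
  by move=> bi; exact: rat_unpull.
pose y x := \sum_i rat_emb v (r (x, i)) * a i.
have -> : \sum_bi rat_emb (h v) (c bi) * b bi = h (y false) + h (y true) * w.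
  rewrite (eq_bigr (fun bi => h (rat_emb v (r (bi.1, bi.2)) * a bi.2) * (if bi.1 then w else 1))).
    rewrite -(pair_bigA _ (fun x i => h (rat_emb v (r (x, i)) * a i) * (if x then w else 1))).
    rewrite big_bool /= addrC -!mulr_suml mulr1 -!rmorph_sum.
    by [].
  by move=> [x i] _; rewrite rmorphM rE mulrA.
move=> yw; have y1 := hw _ _ yw.
have y0 : y false = 0.
  by apply: (fmorph_inj h); rewrite rmorph0; move: yw; rewrite y1 rmorph0 mul0r addr0.
have rc x i : c (x, i) = 0.
  have rx : r (x, i) = 0 by case: x; [exact: (fa _ y1)|exact: (fa _ y0)].
  by apply: (fmorph_inj (rat_emb (h v))); rewrite -rE rx !rmorph0.
by case=> x i.
Qed.

End Morphisms.

Section Inertia.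
Variables (k : closedFieldType) (X : curve k) (tau : morphism X X)
  (P : closed_point X) (pi : X).
Hypotheses (P_fixed : forall u, ord P (pull tau u) = ord P u)
  (pi1 : ord P pi = 1) (pi_fixed : pull tau pi = pi).

(* tau fixes all truncated power series in pi, hence their limits. *)
Lemma inertia_trivial u : pull tau u = u.
Proof.
have regular v : vge P 0 v -> pull tau v = v.
  move=> v_ge; apply/eqP; rewrite -subr_eq0; apply: contraT => d0.
  set d := pull tau v - v in d0.
  have pi0 : pi != 0 by apply/eqP => pi0; move: pi1; rewrite pi0 ord_zero.
  pose N := `|ord P d|.+1; have [p [w [w_ge vE]]] := truncated_expansion pi1 N v_ge.
  have : vge P (N%:Z + 0) d.
    rewrite /d vE rmorphD rmorphM rmorphXn pull_evalp pi_fixed opprD addrACA subrr add0r.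
    rewrite -mulrBr; apply: vgeM; first by rewrite vgeE ?expf_neq0 // ordX // pi1 natz.
    apply: vgeB => //; move: w_ge; have [->|w0] := eqVneq w 0; first by rewrite rmorph0.
    by rewrite !vgeE ?fmorph_eq0 // P_fixed.
  by rewrite vgeE // /N; lia.
have [->|u0] := eqVneq u 0; first by rewrite rmorph0.
have [u_ge|u_lt] := leP 0 (ord P u); first by apply: regular; rewrite vgeE.
apply: invr_inj; rewrite -fmorphV; apply: regular.
by rewrite vgeE ?invr_eq0 // ordV oppr_ge0 ltW.
Qed.

End Inertia.

(** * The trigonal class and the theta-dual *)

(** As [pull tau] is surjective, the restricted valuation takes the value 1, so no ramification
    index appears. *)
Lemma translate_exists (k : closedFieldType) (X : curve k) (tau : morphism X X)
    (g : X -> X) (y : closed_point X) : (forall u, pull tau (g u) = u) ->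
  exists y' : closed_point X, forall u, ord y' u = ord y (pull tau u).
Proof.
move=> gK; have [y' [e [e0 yE]]] := image_exists tau y; exists y' => u; rewrite yE.
have [w _ w1] := ord_unif y; have := yE (g w); rewrite gK w1 -mulr_natr natz => eE.
suff -> : e = 1%N by rewrite mulr1n.
have : (e%:Z %| 1)%Z by apply/dvdzP; exists (ord y' (g w)).
by rewrite dvdz1 => /eqP.
Qed.

(** * Points of the quotient by an involution *)

Section InvolutionQuotient.
Variables (k : closedFieldType) (X Y : curve k) (pi : morphism X Y) (j : morphism X X).
Hypotheses (hpi : quotient_by pi j) (j_invol : forall u, pull j (pull j u) = u)
  (j_neq1 : exists w, pull j w <> w).
Implicit Types (y z : closed_point X) (q : closed_point Y) (u : X).
Local Notation J := (pull j).
Local Notation h := (pull pi).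

Let norm u : exists v, h v = u * J u.
Proof.
have [v _ vE] : range h (u * J u) by apply/hpi; rewrite rmorphM j_invol mulrC.
by exists v.
Qed.

(** If z is neither y nor j y, take a function with simple zeros at y and j y and order 0 at z and j
    z: its norm descends to Y, where it would both vanish and not vanish at q. *)
Lemma quotient_fibre y z q : maps pi y q -> maps pi z q ->
  (forall u, ord z u = ord y u) \/ (forall u, ord z u = ord y (J u)).
Proof.
move=> [ey [ey0 yE]] [ez [ez0 zE]].
have [y' y'E] := translate_exists y j_invol; have [z' z'E] := translate_exists z j_invol.
have [->|zy] := eqVneq z y; [by left|right].
have [->//|zy'] := eqVneq z y'.
have z'y : z' != y.
  apply: contra_neq zy' => z'y; apply: closed_point_ext => u.
  by rewrite y'E -z'y z'E j_invol.
have z'y' : z' != y'.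
  apply: contra_neq zy => z'y'; apply: closed_point_ext => u.
  by rewrite -[u]j_invol -z'E z'y' y'E.
have [u [u0 uE]] := weak_approximation_ord
  (fun P => ((P == y) || (P == y'))%:Z) (undup_uniq [:: y; y'; z; z']).
have Ju0 : J u != 0 by rewrite fmorph_eq0.
have [v vE] := norm u.
have : ord y (h v) = 2.
  rewrite vE ordM // -y'E !uE ?mem_undup ?inE ?eqxx ?orbT //.
have : ord z (h v) = 0.
  rewrite vE ordM // -z'E !uE ?mem_undup ?inE ?eqxx ?orbT //.
  by rewrite (negPf zy) (negPf zy') (negPf z'y) (negPf z'y').
rewrite yE zE => /eqP; rewrite mulrn_eq0 => /orP[/eqP ez_0|/eqP ->].
  by rewrite ez_0 in ez0.
by rewrite mul0rn.
Qed.

(** The norm of a function of order 1 at y and 0 at j y comes from Y and has order 1 at y. *)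
Lemma quotient_unramified y q e : ramification pi y q e ->
  ~ (forall u, ord y (J u) = ord y u) -> e = 1%N.
Proof.
move=> [e0 yE] nJ; have [y' y'E] := translate_exists y j_invol.
have yy' : y != y' by apply: contra_not_neq nJ => yy u; rewrite -y'E -yy.
have [u [u0 uE]] := weak_approximation_ord (fun P => (P == y)%:Z) (undup_uniq [:: y; y']).
have Ju0 : J u != 0 by rewrite fmorph_eq0.
have [v vE] := norm u.
have : ord y (h v) = 1.
  rewrite vE ordM // -y'E !uE ?mem_undup ?inE ?eqxx ?orbT //.
  by rewrite eq_sym (negPf yy').
rewrite yE -mulr_natr natz => vq.
have : (e%:Z %| 1)%Z by apply/dvdzP; exists (ord q v).
by rewrite dvdz1 => /eqP.
Qed.

(** If e were 1, a uniformizer of Y would pull back to a [j]-invariant uniformizer at a fixed point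
    of [j], and [inertia_trivial] would make [j] trivial. *)
Lemma quotient_ramified y q e : ramification pi y q e ->
  (forall u, ord y (J u) = ord y u) -> (1 < e)%N.
Proof.
move=> [e0 yE] Jy; rewrite ltn_neqAle e0 andbT eq_sym; apply/eqP => e1.
have [v _ v1] := ord_unif q; have [w] := j_neq1; apply.
apply: (@inertia_trivial _ _ j y (h v)) => //; first by rewrite yE v1 e1.
by apply/hpi; exists v.
Qed.

End InvolutionQuotient.

(** * Fibres of the trigonal map *)

Section TrigonalFibres.
Variables (k : closedFieldType) (Ct C0 : curve k) (sigma j : morphism Ct Ct)
  (pi : morphism Ct C0).
Local Notation S := (pull sigma).
Local Notation J := (pull j).
Local Notation h := (pull pi).
Hypotheses (hpi : quotient_by pi j) (j_invol : forall u, J (J u) = u)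
  (j_neq1 : exists w, J w <> w)
  (sigma3 : forall u, S (S (S u)) = u)
  (j_sigma : forall u, J (S (J (S u))) = u)
  (sigma_free : forall P : closed_point Ct, ~ forall u, ord P (S u) = ord P u).

Section Coincidence.
Variables (R : Ct -> Ct) (s : C0).
Hypotheses (R3 : forall u, R (R (R u)) = u) (JR : forall u, J (R (J (R u))) = u)
  (R_free : forall P : closed_point Ct, ~ forall u, ord P (R u) = ord P u)
  (Rs : R (h s) = h s).

(* If y and R y have the same image, then R y = j y, so that the third point
   R^2 y of the orbit is fixed by j: s has even order there. *)
Lemma orbit_coincidence (y z w : closed_point Ct) (q r : closed_point C0) :
  (forall u, ord z u = ord y (R u)) -> (forall u, ord w u = ord y (R (R u))) ->
  maps pi y q -> maps pi z q -> maps pi w r -> 0 < ord q s ->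
  1 < ord q s /\ q != r.
Proof.
move=> zE wE yq zq wr qs.
have yRJ u : ord y (R u) = ord y (J u).
  have [zy|zy] := quotient_fibre hpi j_invol yq zq; last by rewrite -zE zy.
  by case: (@R_free y) => v; rewrite -zE zy.
(* The dihedral relation J R = R^-1 J is what makes the third point [w] fixed by [j]. *)
have JRE u : J (R u) = R (R (J u)).
  by rewrite -[LHS]R3 -(j_invol (R (J (R u)))) JR.
have wJ u : ord w (J u) = ord w u.
  by rewrite !wE -JRE -yRJ.
have [ey [ey0 yE]] := yq; have [er [er0 rE]] := wr.
have ey1 : ey = 1%N.
  apply: (quotient_unramified hpi j_invol (conj ey0 yE)) => yJ.
  by apply: (@R_free y) => u; rewrite yRJ yJ.
have er2 : (1 < er)%N by apply: (quotient_ramified hpi j_neq1 (conj er0 rE)) wJ.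
have sE : ord q s = ord r s *+ er.
  by rewrite -rE wE !Rs yE ey1.
split.
  have : 0 < ord r s by rewrite -(pmulrn_lgt0 _ er0) -sE.
  by rewrite sE -mulr_natr natz; nia.
apply/eqP => qr; rewrite -qr in wr.
have [wy|wy] := quotient_fibre hpi j_invol yq wr.
  by apply: (@R_free y) => u; rewrite -wy wE R3.
by apply: (@R_free y) => u; rewrite -[u in LHS]R3 -wE wy -yRJ R3.
Qed.

End Coincidence.
Let sigma2_free (P : closed_point Ct) : ~ forall u, ord P (S (S u)) = ord P u.
Proof. by move=> fixed; apply: (@sigma_free P) => u; rewrite -fixed sigma3. Qed.

(** The dihedral relation for sigma^2, by which the coincidence p = p_2 is treated like p = p_1. *)
Let j_sigma2 u : J (S (S (J (S (S u))))) = u.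
Proof.
have JSJ w : J (S (J w)) = S (S w) by rewrite -{1}[w]sigma3 j_sigma.
by rewrite -(j_invol (S (J _))) JSJ JSJ !sigma3.
Qed.

(** Coincidences among the three points are matched by multiple zeros of [s], so p + p_1 + p_2 <=
    zeros s. The right side has degree at most [m0] <= 3, which forces equality. *)
Lemma trigonal_fibre (s0 s : C0) (m0 : nat) (p : closed_point C0) (E : divisor C0) :
  local_param s0 s -> has_dim (rat_emb s0) setT m0 -> (m0 <= 3)%N ->
  S (h s) = h s -> 0 < ord p s -> conjugates sigma pi p E ->
  << p >> + E = zeros s.
Proof.
move=> ps hm m3 Ss p_s [p' [p1 [p2 [p'p [e1 [e1_0 e1E]] [e2 [e2_0 e2E]] ->]]]].
(* [S \o S] is inverse to [S], so the translates of p' by sigma and sigma^2 exist as points. *)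
have [P1 P1E] := translate_exists p' (g := S \o S) sigma3.
have [P2 P2E] := translate_exists P1 (g := S \o S) sigma3.
have {}P2E u : ord P2 u = ord p' (S (S u)) by rewrite P2E P1E.
have P1p1 : maps pi P1 p1 by exists e1; split=> // v; rewrite P1E -e1E.
have P2p2 : maps pi P2 p2 by exists e2; split=> // v; rewrite P2E -e2E.
have pos P q : maps pi P q -> 0 < ord P (h s) -> 0 < ord q s.
  by move=> [e [e0 eE]]; rewrite eE pmulrn_lgt0.
have p's : 0 < ord p' (h s).
  by have [e [e0 eE]] := p'p; rewrite eE pmulrn_lgt0.
have p1s : 0 < ord p1 s by apply: pos P1p1 _; rewrite P1E Ss.
have p2s : 0 < ord p2 s by apply: pos P2p2 _; rewrite P2E !Ss.
have c01 : p = p1 -> 1 < ord p s /\ p != p2.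
  move=> pp1; rewrite -pp1 in P1p1.
  exact: (orbit_coincidence sigma3 j_sigma sigma_free Ss P1E P2E p'p P1p1 P2p2 p_s).
have c02 : p = p2 -> 1 < ord p s /\ p != p1.
  move=> pp2; rewrite -pp2 in P2p2.
  apply: (orbit_coincidence (R := S \o S) _ j_sigma2 sigma2_free _ P2E _ p'p P2p2 P1p1 p_s).
  - by move=> u /=; rewrite !sigma3.
  - by rewrite /= !Ss.
  - by move=> u /=; rewrite sigma3 P1E.
have c12 : p1 = p2 -> 1 < ord p1 s /\ p1 != p.
  move=> pp; rewrite -pp in P2p2.
  apply: (orbit_coincidence sigma3 j_sigma sigma_free Ss _ _ P1p1 P2p2 p'p p1s).
  - by move=> u; rewrite P2E P1E.
  - by move=> u; rewrite P1E sigma3.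
set D := _ + _; have degD3 : deg D = 3 by rewrite /D !degD !degU.
have eff Q : 0 <= coeff Q (zeros s - D).
  rewrite coeffB coeff_zeros !coeffD !coeff_pt subr_ge0.
  have [pQ|pQ] := eqVneq p Q; have [p1Q|p1Q] := eqVneq p1 Q;
  have [p2Q|p2Q] := eqVneq p2 Q; rewrite ?addr0 ?add0r ?le_max ?lexx //=.
  - by have [_ /eqP[]] := c01 (etrans pQ (esym p1Q)); rewrite pQ p2Q.
  - by have [+ _] := c01 (etrans pQ (esym p1Q)); rewrite pQ; lia.
  - by have [+ _] := c02 (etrans pQ (esym p2Q)); rewrite pQ; lia.
  - by move: p_s; rewrite pQ; lia.
  - by have [+ _] := c12 (etrans p1Q (esym p2Q)); rewrite p1Q; lia.
  - by move: p1s; rewrite p1Q; lia.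
  - by move: p2s; rewrite p2Q; lia.
have deg_le : deg (zeros s - D) <= 0.
  by rewrite degB degD3; have := deg_zeros_le ps hm; lia.
apply/esym/eqP; rewrite -subr_eq0; apply/eqP/fgpos_eq0P; first exact/fgposP.
apply: le_anti; rewrite deg_le -(freeg_sumE (zeros s - D)) raddf_sum /=.
by apply: sumr_ge0 => Q _; rewrite degU.
Qed.

Lemma conjugates_exist p' (p : closed_point C0) : maps pi p' p ->
  exists E, conjugates sigma pi p E.
Proof.
move=> p'p; have [p1 p1P] := image_exists (compm pi (iterm 1 sigma)) p'.
have [p2 p2P] := image_exists (compm pi (iterm 2 sigma)) p'.
by exists (<< p1 >> + << p2 >>), p', p1, p2.
Qed.

(* h^* O(1) is a trigonal class: p + p_1 + p_2 lies in it for every p. *)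
Lemma trigonal_class (s : C0) (m0 : nat) : nonconst s ->
  has_dim (rat_emb s) setT m0 -> (m0 <= 3)%N -> S (h s) = h s ->
  forall p E, conjugates sigma pi p E ->
  divclass (<< p >> + E) = divclass (zeros s^-1).
Proof.
(* [s'] is a parameter at the image of [p] on P^1; as it lies in k(s), its pullback is fixed by
   [sigma]. *)
move=> ns hm m3 Ss p E pE; have [s' ps [ps' s'E]] := param_at ns p.
have [ns' /adjoin_predP[a [b [_ s'_ab]]] _] := ps.
have Ss' : S (h s') = h s'.
  by rewrite s'_ab !fmorph_div /= !pull_evalp Ss.
rewrite (trigonal_fibre ps hm m3 Ss' ps' pE).
case: s'E => [<-|->//]; apply/divclass_eq; exists s'; first exact: nonconst_neq0.
by rewrite dvs_zeros addrC subrK.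
Qed.

End TrigonalFibres.

Section InfinitelyManyPoints.
Variables (k : closedFieldType) (X : curve k).
Hypothesis char0 : [pchar k] =i pred0.

(** Zeros of t - i for distinct natural numbers i are distinct points, since these i are distinct
    constants in characteristic 0. *)
Lemma point_outside (s : seq (closed_point X)) : exists P, P \notin s.
Proof.
have [t tt _] := function_fieldP X; have nt := transcendental_nonconst tt.
have /choice[P Pc] : forall i : nat, exists P : closed_point X, 0 < ord P (t - const X i%:R).
  by move=> i; exact: zero_exists (nonconstB nt).
have P_inj : injective P.
  move=> i j ij; have := Pc i; have := Pc j; rewrite -ij => Pj Pi.
  have : vge (P i) 1 (const X (i%:R - j%:R)).
    have -> : const X (i%:R - j%:R) = (t - const X j%:R) - (t - const X i%:R).
      by rewrite rmorphB; ring.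
    by apply: vgeB; rewrite vgeE ?nonconst_subC.
  rewrite /vge ord_const fmorph_eq0 orbF subr_eq0 => /eqP ijk.
  have inj_le a b : (a <= b)%N -> a%:R = b%:R :> k -> a = b.
    move=> ab abk; apply/eqP; rewrite eqn_leq ab /= -subn_eq0.
    by rewrite -(iffLR (pcharf0P _) char0) natrB // abk subrr.
  by have [/inj_le|/ltnW/inj_le] := leqP i j; [exact|move=> ji; apply/esym/ji].
apply: contrapT => no; have all_s Q : Q \in s.
  by apply: contraT => Qs; case: no; exists Q.
have := @uniq_leq_size _ [seq P i | i <- iota 0 (size s).+1] s.
rewrite map_inj_uniq // iota_uniq size_map size_iota ltnn => H.
by suff : false by []; apply: H.
Qed.

End InfinitelyManyPoints.

(** * The theta-dual, by Riemann-Roch on C_0 *)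

Section ThetaDual.
Variables (k : closedFieldType) (Ct C0 : curve k) (sigma : morphism Ct Ct)
  (pi : morphism Ct C0) (D0 : divisor C0) (n : nat) (x : closed_point C0).
Hypotheses (char0 : [pchar k] =i pred0) (cD0 : canonical_divisor D0)
  (gC0 : genus C0 n) (n_ge2 : (2 <= n)%N)
  (beta1_exists : forall p, exists b, beta1 sigma pi x p b)
  (beta1E : forall p b, beta1 sigma pi x p b -> b = divclass << x >> - divclass << p >>).
Implicit Types (D : divisor C0) (p : closed_point C0).

(** For a section [u] and a point [p] outside the supports of [D] and div u, no section of D - p is
    a nonzero multiple of [u]. *)
Lemma ell_ge2 D : (forall p, (0 < ell (D - << p >>)%R)%N) -> (2 <= ell D)%N.
Proof.
move=> Dp; have sub p : sections (D - << p >>) `<=` sections D.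
  by apply: sections_le => Q; rewrite coeffB coeff_pt gerBl ler0n.
have [u u0 uD] : exists2 u, u != 0 & sections D u.
  have /ell_gt0[u u0 uD] := Dp x.
  by exists u => //; exact: sub uD.
have [p] := point_outside char0 (dom D ++ dom (dvs u)).
rewrite mem_cat negb_or !mem_dom !negbK coeff_dvs => /andP[/eqP Dp0 /eqP up0].
have /ell_gt0[w w0 wD] := Dp p.
have nu : ~ sections (D - << p >>) u.
  by move=> /sectionsP/(_ p); rewrite coeffB coeff_pt eqxx Dp0 vgeE // up0.
rewrite -card_bool; apply: (has_dim_free (b := fun i : bool => if i then u else w) (ell_dim D)).
  by case=> //; exact: sub wD.
move=> c; rewrite big_bool /= => cE.
have c1 : c true = 0.
  apply/eqP; apply: contraT => c1; case: nu.
  have -> : u = const C0 (- (c false / c true)) * w.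
    have ec1 : const C0 (c true) != 0 by rewrite fmorph_eq0.
    apply: (mulfI ec1); move/eqP: cE; rewrite addr_eq0 => /eqP ->.
    by rewrite rmorphN fmorph_div; field.
  by have [_ _ sZ] := sections_lsub (D - << p >>); exact: sZ.
move: cE; rewrite c1 rmorph0 mul0r add0r => /eqP.
by rewrite mulf_eq0 (negPf w0) orbF fmorph_eq0 => /eqP c0 [].
Qed.

Theorem theta_dual_trigonal :
  theta_dual sigma pi x n =
  [set divclass D0 - divclass << x >> - B | B in W C0 (n - 2)].
Proof.
have degD0 := deg_canonical char0 cD0 gC0.
have WP r L := W_ell r L.
apply/seteqP; split=> [xi [[D [<- D_deg]] DW]|_ [B /WP[D [<- D_deg ellD]] <-]].
  (* Membership in the theta-dual says that each E - p has a section. As E has degree n,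
     Riemann-Roch reads ell E = 1 + ell (K - E). *)
  pose E := D + << x >>; have degE : deg E = n%:Z by rewrite degD degU D_deg; lia.
  have E2 : (2 <= ell E)%N.
    apply: ell_ge2 => p; have [b bp] := beta1_exists p.
    have : W C0 (n - 1) (b + divclass D) by apply: DW; exists b => //; exists p.
    rewrite (beta1E bp) => /WP[D' [D'E _]]; rewrite (ell_divclass (E := E - << p >>)) //.
    by rewrite D'E divclassB divclassD addrAC [divclass D + _]addrC.
  exists (divclass (D0 - E)).
    apply/WP; exists (D0 - E); split=> //.
      by rewrite degB degD0 degE; lia.
    have := riemann_roch char0 cD0 gC0 E; rewrite degE; lia.
  apply/eqP; rewrite divclassB divclassD subr_eq opprD addrCA addNKr.
  exact/eqP.
split.
  exists (D0 - << x >> - D); split; first by rewrite !divclassB.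
  by rewrite !degB degD0 degU D_deg; lia.
move=> _ [b [p /beta1E ->] <-].
apply/WP; exists (D0 - D - << p >>); split.
- rewrite !divclassB [divclass D0 - divclass << x >> - _]addrAC.
  by rewrite [RHS]addrC addrA subrK.
- by rewrite !degB degD0 degU D_deg; lia.
(* K - D has degree n, so ell (K - D) = ell D + 1 >= 2, and subtracting [p] costs at most one. *)
have := riemann_roch char0 cD0 gC0 (D0 - D).
rewrite opprB addrCA subrr addr0 degB degD0 D_deg => rr.
have := ell_addpt (D0 - D - << p >>) p; rewrite subrK => /andP[_].
by lia.
Qed.

End ThetaDual.

(** For constant [t], k(X) would have dimension 2 over k, but the powers 1, t0, t0^2 of a
    transcendental element are independent. *)
Lemma double_cover_nonconst (k : closedFieldType) (X : curve k) (t : X) :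
  double_cover_P1 t -> nonconst t.
Proof.
move=> dt [c _ ct]; have [t0 tt0 _] := function_fieldP X.
have nt0 := transcendental_nonconst tt0.
have rE : adjoin (const X) t = range (const X).
  apply/seteqP; split=> [_ [p [q [_ ->]]]|_ [a _ <-]].
    have ev r : evalp (const X) r t = const X r.[c] by rewrite /evalp -ct horner_map.
    by exists (p.[c] / q.[c]); rewrite // fmorph_div !ev.
  by exists a%:P, 1; rewrite evalp1 evalpC divr1 oner_neq0.
move: dt; rewrite /double_cover_P1 rE => /dim_over_has_dim h2.
have : lfree (const X) (fun i : 'I_3 => t0 ^+ i).
  move=> c' c'E i; pose p := \poly_(j < 3) c' (inord j).
  have p0 : p = 0.
    apply/eqP; apply: contraT => /(evalp_neq0 nt0); rewrite evalp_poly.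
    rewrite (eq_bigr (fun i : 'I_3 => const X (c' i) * t0 ^+ i)) ?c'E ?eqxx // => l _.
    by rewrite inord_val.
  by have := congr1 (fun q : {poly k} => q`_i) p0; rewrite coef_poly ltn_ord inord_val coef0.
by move=> /(has_dim_free h2 (fun=> I)); rewrite card_ord.
Qed.

Theorem proposition3p6 (R : realType) (Ct C C0 : curve R[i])
    (f : morphism Ct C) (sigma : morphism Ct Ct)
    (hf : etale f) (hsigma : cyclic_cover f 3 sigma)
    (g : nat) (hC : hyperelliptic C g)
    (iota : morphism C C) (hiota : hyperelliptic_involution iota)
    (j : morphism Ct Ct)
    (j_lifts : eqm (compm f j) (compm iota f))
    (j_invol : eqm (compm j j) (idm Ct))
    (j_sigma : eqm (compm sigma (compm j (compm sigma j))) (idm Ct))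
    (pi : morphism Ct C0) (hpi : quotient_by pi j)
    (n : nat) (hn : genus C0 n) (n_ge4 : (4 <= n)%N)
    (K : Pic C0) (hK : canonical_class K)
    (x : closed_point C0) :
  theta_dual sigma pi x n
  = [set K - divclass << x >> - B | B in W C0 (n - 2)].
Proof.
have char0 : [pchar R[i]] =i pred0 by exact: pchar_num.
have {j_invol} J2 u : pull j (pull j u) = u by exact: j_invol.
have {j_sigma} JS u : pull j (pull sigma (pull j (pull sigma u))) = u.
  exact: j_sigma.
have {j_lifts} Jf v : pull j (pull f v) = pull f (pull iota v) by exact: j_lifts.
have [f3 sigma_f sigma_ord _] := hsigma.
have Sf v : pull sigma (pull f v) = pull f v by exact: sigma_f.
have S3 u : pull sigma (pull sigma (pull sigma u)) = u.
  exact: (iffRL (sigma_ord 3%N) (dvdnn 3) u).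
have S_neq1 : ~ forall u, pull sigma u = u.
  by move=> S1; have /(iffLR (sigma_ord 1%N)) : eqm (iterm 1 sigma) (idm Ct) by exact: S1.
have [iota_neq1 [t [dt iota_t]]] := hiota.
have J_neq1 : exists w, pull j w <> w.
  apply: contrapT => /forallNP J1; apply: iota_neq1 => v.
  by apply: (fmorph_inj (pull f)); rewrite -Jf; exact: contrapT (J1 _).
(* A fixed point of sigma would be totally ramified over C. *)
have S_free (P : closed_point Ct) : ~ forall u, ord P (pull sigma u) = ord P u.
  move=> P_fixed; apply: S_neq1; have [Q [e eQ]] := image_exists f P.
  have e1 := hf _ _ _ eQ; have [_ eE] := eQ; have [v _ v1] := ord_unif Q.
  by apply: (inertia_trivial P_fixed (pi := pull f v)); rewrite ?eE ?v1 ?e1 ?Sf.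
have nt := double_cover_nonconst dt.
(* [t] is invariant under the hyperelliptic involution, so its pullback is fixed by [j] and descends
   to a function [s] on C_0: this is the map h. *)
have [s _ sT] : range (pull pi) (pull f t) by apply/hpi; rewrite Jf iota_t.
have ns : nonconst s.
  move=> [c _ sc]; apply: (pull_nonconst (phi := f) nt); exists c => //.
  by rewrite -sT -sc pull_const.
have Ss : pull sigma (pull pi s) = pull pi s by rewrite sT Sf.
have [m0 hm0] := finite_over ns.
have [N hN] := finite_over (pull_nonconst (phi := f) nt).
(* [k(Ct) : k(t)] is at most 2 * 3 through C, and at least 2 [k(C_0) : k(s)] because a function
   moved by [j] is independent of 1 over k(C_0). *)
have m0_le3 : (m0 <= 3)%N.
  have N6 : (N <= 2 * 3)%N.
    apply: (dim_tower (phi := f) _ _ hN); last exact: dim_over_has_dim f3.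
    by apply: dim_over_has_dim; rewrite range_rat_emb.
  have [w Jw] := J_neq1.
  rewrite -(leq_pmul2l (isT : 0 < 2)%N); apply: leq_trans N6.
  apply: (dim_tower2 (phi := pi) (w := w) hm0); first by rewrite sT.
  move=> y z yzw; have Jpi v : pull j (pull pi v) = pull pi v by apply/hpi; exists v.
  have := congr1 (pull j) yzw; rewrite rmorph0 rmorphD rmorphM !Jpi -[RHS]yzw.
  move=> /addrI /eqP; rewrite -subr_eq0 -mulrBr mulf_eq0 subr_eq0 fmorph_eq0.
  by move=> /orP[/eqP//|/eqP].
have [D0 [cD0 <-]] := hK.
have tri := trigonal_class hpi J2 J_neq1 S3 JS S_free ns hm0 m0_le3 Ss.
have conj_ex p : exists E, conjugates sigma pi p E.
  have [p' p'p] := preimage_exists pi p char0 cD0 hn.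
  exact: conjugates_exist p'p.
apply: theta_dual_trigonal => // [|p|p b [E [D1 [pE xD1 ->]]]].
- exact: leq_trans n_ge4.
- have [E pE] := conj_ex p; have [D1 xD1] := conj_ex x.
  by exists (divclass (E - D1)), E, D1.
(* The equivalence of p + p_1 + p_2 and x + x_1 + x_2 turns the class of E - D_1 into x - p. *)
- have := tri _ _ pE; rewrite -(tri _ _ xD1) !divclassD divclassN => pxE.
  apply/eqP; rewrite subr_eq addrAC eq_sym subr_eq.
  by rewrite -pxE addrC.
Qed.
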